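(* Let $X = (X_t)_{t\ge 0}$ be a fractional Brownian motion with Hurst index $H\in(0,1)$ and set $$J_T := \left(\int_0^T e^{X_s}\, ds\right)^{-1}, \qquad T > 0.$$ For any $k > 0$, there is a constant $c = c(H) > 0$ such that $$T^{-(1-H)} (\log T)^{-c} \precsim \mathbb{E}\left[J_T^k\right] \precsim T^{-(1-H)} (\log T)^{c}, \qquad T \to \infty.$$
   Context: Fractional Brownian motion (FBM) with Hurst index $H\in(0,1)$ is the centered Gaussian process $X$ with covariance $\mathbb{E}[X_sX_t] = \frac12\left(|s|^{2H}+|t|^{2H}-|t-s|^{2H}\right)$, taken with continuous sample paths. Notation: $f(T) \precsim g(T)$ as $T\to\infty$ means $\limsup_{T\to\infty} f(T)/g(T) < \infty$ (the implied constants may depend on all fixed parameters). *)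

(* Defs.v *)
From HB Require Import structures.
From mathcomp Require Import all_boot all_order all_algebra.
From mathcomp Require Import all_classical all_reals all_analysis.
Import Order.TTheory GRing.Theory Num.Theory.
Import numFieldNormedType.Exports.

Set Implicit Arguments.
Unset Strict Implicit.
Unset Printing Implicit Defensive.

Local Open Scope classical_set_scope.
Local Open Scope ring_scope.

(* Processes are indexed by all of R to avoid a subtype for the half-line: only
   the values at times t >= 0 are ever constrained or used. *)

(* The degenerate laws are listed separately because the library's
   [normal_prob m 0] is the uniform law on [0, 1], not the Dirac mass at m. *)
Definition gaussian_law (R : realType) (mu : set R -> \bar R) : Prop :=
  exists m : R,
    (forall A : set R, measurable A -> mu A = \d_m A) \/
    (exists2 s : R, 0 < s &
       forall A : set R, measurable A -> mu A = normal_prob m s A).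

Definition gaussian_process (R : realType) (d : measure_display)
    (Omega : measurableType d) (P : probability Omega R)
    (X : R -> {RV P >-> R}) : Prop :=
  forall (n : nat) (t a : 'I_n -> R), (forall i, 0 <= t i) ->
    gaussian_law (pushforward P (fun w : Omega => \sum_(i < n) a i * X (t i) w)).

Definition fractional_brownian_motion (R : realType) (H : R)
    (d : measure_display) (Omega : measurableType d) (P : probability Omega R)
    (X : R -> {RV P >-> R}) : Prop :=
  [/\ gaussian_process X,
      forall t : R, 0 <= t -> ('E_P[X t] = 0)%E,
      forall s t : R, 0 <= s -> 0 <= t ->
        'E_P[(fun w : Omega => X s w * X t w)%R]%E =
        ((`|s| `^ (2 * H) + `|t| `^ (2 * H) - `|t - s| `^ (2 * H)) / 2)%:E
    & forall w : Omega, {within `[0, +oo[, continuous (fun t : R => X t w)}].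

Definition exp_functional_inv (R : realType) (d : measure_display)
    (Omega : measurableType d) (P : probability Omega R)
    (X : R -> {RV P >-> R}) (T : R) (w : Omega) : R :=
  (\int[lebesgue_measure]_(s in `[0, T]) expR (X s w))^-1.

(* Extended-real valued, so that it applies to expectations with no a priori
   finiteness; the library's conventions are x / +oo = 0 and 0^-1 = +oo. *)
Definition precsim (R : realType) (f g : R -> \bar R) : Prop :=
  (limf_esup (fun T : R => f T / g T) (pinfty_nbhs R) < +oo)%E.

(* Main.v *)
(* Sample X on a grid of polylogarithmic mesh and let u_n be the mean negative
   part of the maximum of the values at the first n grid times. By stationarity
   of the increments, u_n is the increment of the expected running maximum, and
   it is nonincreasing in n; since the expected maximum over [0, T] grows like
   T^H up to logarithms, u_n has order T^(H-1) up to logarithms, and so has the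
   probability that X stays below a level of logarithmic size on the grid.

   Upper bound: J_T^k is negligible unless X stays below a logarithmic level on
   the grid. On that event J_T^k <= J_1^k is bounded, by Jensen's inequality, by
   an average over s <= 1 of exp(-k X_s), and tilting by exp(-k X_s) only shifts
   the barrier.

   Lower bound: the Gaussian variable 4 * \sum_q q^(-1-2H) X_q has bounded
   variance and induces a drift of at least 2 log t, so that tilting by it turns
   paths that stay below 0 into paths for which the integral of exp(X_s) converges.
   The tilted probability is compared with the untilted one by Cauchy-Schwarz.

   Since the law of X is only accessible through Gaussian linear combinations,
   stationarity and the Cameron-Martin formula on grids are obtained by showing
   that exponential moments determine the law. *)

Require Import Defs.
From HB Require Import structures.
From mathcomp Require Import all_boot all_order all_algebra.
From mathcomp Require Import all_classical all_reals all_analysis.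
From mathcomp Require Import measurable_realfun ring lra.
Import Order.TTheory GRing.Theory Num.Theory.
Import numFieldNormedType.Exports.

Set Implicit Arguments.
Unset Strict Implicit.
Unset Printing Implicit Defensive.

Local Open Scope classical_set_scope.
Local Open Scope ring_scope.

(** * Exponential moments determine laws *)

(** The tilts need a coarse grid, the integral a fine one. A barrier is moved by tilting with a
    multiple of X at the mesh [lam], whose covariance with every grid value is at least lam^(2H) / 2
    because no grid time precedes [lam]. A shift of order log T then needs a tilt of standard
    deviation of order log T times lam^(-H). A shift along K(q, t), which may grow with t, is
    dominated by lam^(-mu) K(lam, t) up to a factor depending on q, where mu = min(1, 2H); it needs
    standard deviation of order lam^(H-mu). Since mu > H, taking for [lam] a large power of log T
    makes both of order 1 / log T, and the error of the tilt is at most 1/T. In the lower bound the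
    integral requires a fine mesh, so the event in one of the two Cauchy-Schwarz factors is relaxed
    to a coarse subgrid. No modulus of continuity enters: an integral over a short interval is
    compared with the left endpoint by Jensen's inequality. Cauchy-Schwarz loses only logarithms,
    because staying below 0 and staying below the drift both have probability of order T^(H-1). *)

Section expR_bounds.
Context {R : realType}.
Implicit Types x u : R.

Lemma expRB1_le u : expR u - 1 <= u * expR u.
Proof.
have := expR_ge1Dx (- u); rewrite expRN => h.
have e0 := expR_gt0 u.
have : (1 - u) * expR u <= 1.
  by rewrite -ler_pdivlMr// mul1r; lra.
rewrite mulrBl mul1r => h2; lra.
Qed.

Lemma normr_expRB1_le u : `|expR u - 1| <= `|u| * expR `|u|.
Proof.
have [u0|u0] := leP 0 u.
  by rewrite !ger0_norm// ?expRB1_le// subr_ge0 -expR0 ler_expR.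
rewrite ler0_norm; last by rewrite subr_le0 expR_le1 ltW.
rewrite ltr0_norm//.
have h1 := expR_ge1Dx u.
have h2 : 1 <= expR (- u) by rewrite -expR0 ler_expR; lra.
have : - u <= - u * expR (- u) by rewrite ler_peMr; lra.
lra.
Qed.

Lemma normrX_le_expR x n : `|x| ^+ n <= n`!%:R * expR `|x|.
Proof.
case: n => [|n].
  by rewrite expr0 fact0 mul1r -expR0 ler_expR.
have := expR_ge1Dxn n (normr_ge0 x).
have f0 : (0 : R) < (n.+1)`!%:R by rewrite ltr0n fact_gt0.
move=> h; rewrite mulrC -ler_pdivrMr//; lra.
Qed.

Lemma expR_normr_le x : expR `|x| <= expR x + expR (- x).
Proof.
have [x0|x0] := leP 0 x.
  by rewrite ger0_norm// lerDl expR_ge0.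
by rewrite ltr0_norm// lerDr expR_ge0.
Qed.

Lemma cvg_expRB1 x : m.+1%:R * (expR (m.+1%:R^-1 * x) - 1) @[m --> \oo] --> x.
Proof.
have h0 : m.+1%:R^-1 * x @[m --> \oo] --> (0 : R).
  rewrite -[X in _ --> X](mul0r x); apply: cvgM; last exact: cvg_cst.
  exact: cvg_harmonic.
apply: (@squeeze_cvgr _ _ _ _ (fun=> x) (fun m => x * expR (m.+1%:R^-1 * x))).
- apply: nearW => m; apply/andP; split.
    have := expR_ge1Dx (m.+1%:R^-1 * x).
    rewrite addrC -lerBrDr => h.
    apply: (le_trans _ (ler_wpM2l (ler0n _ m.+1) h)).
    by rewrite mulrA mulfV ?mul1r// pnatr_eq0.
  have := expRB1_le (m.+1%:R^-1 * x) => h.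
  apply: le_trans (ler_wpM2l (ler0n _ m.+1) h) _.
  by rewrite !mulrA mulfV ?mul1r// pnatr_eq0.
- exact: cvg_cst.
- rewrite [X in _ --> X](_ : x = x * expR 0); last by rewrite expR0 mulr1.
  apply: cvgM; first exact: cvg_cst.
  by apply: continuous_cvg; [exact: continuous_expR|exact: h0].
Qed.

Lemma series_exp_coeff_le x n : 0 <= x -> series (exp_coeff x) n <= expR x.
Proof.
move=> x0; apply: nondecreasing_cvgn_le; last exact: is_cvg_series_exp_coeff.
apply/nondecreasing_seqP => k; rewrite /series /= big_nat_recr//= lerDl.
exact: exp_coeff_ge0.
Qed.

Lemma normr_series_cos_coeff_le x n : `|series (cos_coeff x) n| <= expR `|x|.
Proof.
apply: (le_trans _ (series_exp_coeff_le n (normr_ge0 x))).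
apply: le_trans (ler_norm_sum _ _ _) _; apply: ler_sum => i _.
rewrite /cos_coeff /exp_coeff /= !normrM normfV normrX normrX normrN1 expr1n.
rewrite mulr1 [`|i`!%:R|]ger0_norm ?ler0n// ler_wpM2r ?invr_ge0 ?ler0n//.
rewrite -[leRHS]mul1r ler_wpM2r ?exprn_ge0//.
by case: odd; rewrite ?normr0 ?normr1 ?ler01.
Qed.

Lemma normr_series_sin_coeff_le x n : `|series (sin_coeff x) n| <= expR `|x|.
Proof.
apply: (le_trans _ (series_exp_coeff_le n (normr_ge0 x))).
apply: le_trans (ler_norm_sum _ _ _) _; apply: ler_sum => i _.
rewrite /sin_coeff /exp_coeff /= !normrM normfV normrX normrX normrN1 expr1n.
rewrite mulr1 [`|i`!%:R|]ger0_norm ?ler0n// ler_wpM2r ?invr_ge0 ?ler0n//.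
rewrite -[leRHS]mul1r ler_wpM2r ?exprn_ge0//.
by case: odd; rewrite ?normr0 ?normr1 ?ler01.
Qed.

Lemma normr_series_exp_coeff_le x n : `|series (exp_coeff x) n| <= expR `|x|.
Proof.
apply: (le_trans _ (series_exp_coeff_le n (normr_ge0 x))).
apply: le_trans (ler_norm_sum _ _ _) _; apply: ler_sum => i _.
by rewrite /exp_coeff /= normrM normfV normrX [`|i`!%:R|]ger0_norm ?ler0n.
Qed.

End expR_bounds.

Section mgf_uniqueness.
Context d (T : measurableType d) {R : realType} (mu : {measure set T -> \bar R}).
Variables Z Z' X Y : T -> R.
Hypotheses (mZ : measurable_fun setT Z) (mZ' : measurable_fun setT Z').
Hypotheses (mX : measurable_fun setT X) (mY : measurable_fun setT Y).
Hypotheses (Z_ge0 : forall w, 0 <= Z w) (Z'_ge0 : forall w, 0 <= Z' w).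

(* Functions with the same integral form a class closed under dominated limits:
   from exponentials it reaches polynomials, then [cos], then
   [expR (- expR (l * cos (b * x + phi)) / l)], which tends to the indicator of
   [cos (b * x + phi) <= 0] as [l] grows; letting [b] tend to 0 gives half-lines. *)
Definition same_integral (f : R -> R) :=
  [/\ measurable_fun setT f,
      mu.-integrable setT (fun w => (Z w * f (X w))%:E),
      mu.-integrable setT (fun w => (Z' w * f (Y w))%:E)
    & \int[mu]_w (Z w * f (X w))%:E = \int[mu]_w (Z' w * f (Y w))%:E]%E.

Lemma same_integralD f g :
  same_integral f -> same_integral g -> same_integral (fun x => f x + g x).
Proof.
move=> [mf if1 if2 ef] [mg ig1 ig2 eg]; split.
- exact: measurable_funD.
- by under eq_fun do rewrite mulrDr EFinD; exact: integrableD.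
- by under eq_fun do rewrite mulrDr EFinD; exact: integrableD.
- under eq_integral do rewrite mulrDr EFinD.
  under [RHS]eq_integral do rewrite mulrDr EFinD.
  by rewrite !integralD// ef eg.
Qed.

Lemma same_integralZ c f : same_integral f -> same_integral (fun x => c * f x).
Proof.
move=> [mf if1 if2 ef]; split.
- exact: measurable_funM.
- by under eq_fun do rewrite mulrCA EFinM; exact: integrableZl.
- by under eq_fun do rewrite mulrCA EFinM; exact: integrableZl.
- under eq_integral do rewrite mulrCA EFinM.
  under [RHS]eq_integral do rewrite mulrCA EFinM.
  by rewrite !integralZl// ef.
Qed.

Lemma eq_same_integral f g : f =1 g -> same_integral f -> same_integral g.
Proof. by move=> /funext ->. Qed.

Lemma same_integral_sum n (f : nat -> R -> R) :
  (forall i, same_integral (f i)) -> same_integral (fun=> 0) ->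
  same_integral (fun x => \sum_(0 <= i < n) f i x).
Proof.
move=> hf h0; elim: n => [|n ih].
  by apply: eq_same_integral h0 => x; rewrite big_nil.
apply: eq_same_integral (same_integralD ih (hf n)) => x.
by rewrite big_nat_recr.
Qed.

(** The dominating function is taken in the class itself, which makes it integrable against both
    weights. *)
Lemma same_integral_lim (f_ : nat -> R -> R) (f g : R -> R) :
  (forall n, same_integral (f_ n)) -> same_integral g ->
  (forall x, f_ ^~ x @ \oo --> f x) -> (forall n x, `|f_ n x| <= g x) ->
  same_integral f.
Proof.
move=> hf [mg ig1 ig2 _] ff fg.
have mf : measurable_fun setT f.
  apply: (@measurable_fun_cvg _ _ _ _ f_) => //.
  by move=> n; have [] := hf n.
have D (W U : T -> R) : measurable_fun setT W -> measurable_fun setT U ->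
    (forall w, 0 <= W w) ->
    mu.-integrable setT (fun w => (W w * g (U w))%:E) ->
    mu.-integrable setT (fun w => (W w * f (U w))%:E) /\
    (\int[mu]_w (W w * f_ n (U w))%:E @[n --> \oo] -->
      \int[mu]_w (W w * f (U w))%:E)%E.
  move=> mW mU W0 ig.
  have [|||||h1 _ h3] := @dominated_convergence _ _ _ mu setT measurableT
      (fun n w => (W w * f_ n (U w))%:E) (fun w => (W w * f (U w))%:E)
      (fun w => (W w * g (U w))%:E).
  - move=> n; apply/measurable_EFinP; apply: measurable_funM => //.
    by apply: measurableT_comp => //; have [] := hf n.
  - apply/measurable_EFinP; apply: measurable_funM => //.
    exact: measurableT_comp.
  - apply: aeW => w _; apply: cvg_EFin; first exact: nearW.
    by apply: cvgM; [exact: cvg_cst|exact: ff].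
  - exact: ig.
  - apply: aeW => w n _ /=; rewrite lee_fin normrM ger0_norm//.
    by rewrite ler_wpM2l.
  - by split.
have [if1 e1] := D Z X mZ mX Z_ge0 ig1.
have [if2 e2] := D Z' Y mZ' mY Z'_ge0 ig2.
split => //; apply: cvg_unique e1 _ => //.
have -> : (fun n => \int[mu]_w (Z w * f_ n (X w))%:E)%E =
          (fun n => \int[mu]_w (Z' w * f_ n (Y w))%:E)%E.
  by apply/funext => n; have [] := hf n.
exact: e2.
Qed.

Hypothesis mgf_eq :
  forall s, (\int[mu]_w (Z w * expR (s * X w))%:E =
             \int[mu]_w (Z' w * expR (s * Y w))%:E)%E.
Hypothesis mgf_fin :
  forall s, (\int[mu]_w (Z w * expR (s * X w))%:E < +oo)%E.

Let same_expR s : same_integral (fun x => expR (s * x)).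
Proof.
have D (W U : T -> R) : measurable_fun setT W -> measurable_fun setT U ->
    (forall w, 0 <= W w) ->
    (\int[mu]_w (W w * expR (s * U w))%:E < +oo)%E ->
    mu.-integrable setT (fun w => (W w * expR (s * U w))%:E).
  move=> mW mU W0 h; apply/integrableP; split.
    apply/measurable_EFinP; apply: measurable_funM => //.
    by apply: measurableT_comp => //; exact: measurable_funM.
  under eq_integral do rewrite gee0_abs ?lee_fin ?mulr_ge0 ?expR_ge0//.
  exact: h.
split.
- by apply: measurableT_comp => //; exact: measurable_funM.
- by apply: D => //; exact: mgf_fin.
- by apply: D => //; rewrite -mgf_eq; exact: mgf_fin.
- exact: mgf_eq.
Qed.

Let same_cst c : same_integral (fun=> c).
Proof.
apply: eq_same_integral (same_integralZ c (same_expR 0)) => x.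
by rewrite mul0r expR0 mulr1.
Qed.

Let same_dom A C :
  same_integral (fun x => C * (expR (A * x) + expR (- A * x))).
Proof. by apply: same_integralZ; apply: same_integralD; exact: same_expR. Qed.

Let expR_normr_le2 (A x : R) : 0 <= A ->
  expR (A * `|x|) <= expR (A * x) + expR (- A * x).
Proof.
move=> A0; have := expR_normr_le (A * x).
by rewrite normrM ger0_norm// mulNr.
Qed.

(** Raising the power is differentiation in [s]: the function for [n.+1] is the limit of difference
    quotients of the one for [n]. Hence the induction hypothesis for all [s]. *)
Let same_Xn_expR n : forall s, same_integral (fun x => x ^+ n * expR (s * x)).
Proof.
elim: n => [|n ih] s.
  by apply: eq_same_integral (same_expR s) => x; rewrite expr0 mul1r.
(* The rate covers |s| from the exponential, 1 from the difference quotient, and 1 for absorbing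
   |x|^(n+1) <= (n+1)! expR |x|. *)
pose A := `|s| + 2.
have A0 : 0 <= A by rewrite addr_ge0.
apply: (@same_integral_lim
  (fun m x => m.+1%:R * (x ^+ n * expR ((s + m.+1%:R^-1) * x)
                         + (-1) * (x ^+ n * expR (s * x)))) _
  (fun x => n.+1`!%:R * (expR (A * x) + expR (- A * x)))).
- move=> m; apply: same_integralZ; apply: same_integralD; first exact: ih.
  by apply: same_integralZ; exact: ih.
- exact: same_dom.
- move=> x.
  have -> : (fun m => m.+1%:R * (x ^+ n * expR ((s + m.+1%:R^-1) * x)
                         + (-1) * (x ^+ n * expR (s * x)))) =
    (fun m => (x ^+ n * expR (s * x)) * (m.+1%:R * (expR (m.+1%:R^-1 * x) - 1))).
    by apply/funext => m; rewrite mulrDl expRD; ring.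
  have -> : x ^+ n.+1 * expR (s * x) = (x ^+ n * expR (s * x)) * x.
    by rewrite exprS; ring.
  by apply: cvgM; [exact: cvg_cst|exact: cvg_expRB1].
- move=> m x; set h := m.+1%:R^-1.
  have h0 : 0 < h by rewrite invr_gt0 ltr0n.
  have h1 : h <= 1 by rewrite invf_le1 ?ltr0n// ler1n.
  have mh : m.+1%:R * h = 1 by rewrite mulfV// pnatr_eq0.
  have -> : m.+1%:R * (x ^+ n * expR ((s + h) * x)
              + (-1) * (x ^+ n * expR (s * x)))
    = x ^+ n * expR (s * x) * (m.+1%:R * (expR (h * x) - 1)).
    by rewrite mulrDl expRD; ring.
  apply: (@le_trans _ _ (`|x| ^+ n * expR (`|s| * `|x|) * (`|x| * expR `|x|))).
    rewrite !normrM normrX ler_pM ?mulr_ge0 ?exprn_ge0//.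
      rewrite ler_wpM2l ?exprn_ge0// ger0_norm ?expR_ge0// ler_expR.
      by rewrite -normrM ler_norm.
    apply: (le_trans (ler_wpM2l (normr_ge0 _) (normr_expRB1_le _))).
    rewrite normrM (ger0_norm (ltW h0)) [`|m.+1%:R|]ger0_norm ?ler0n// !mulrA mh mul1r.
    by rewrite ler_wpM2l// ler_expR ler_piMl.
  apply: (@le_trans _ _ (n.+1`!%:R * expR (A * `|x|))); last first.
    by rewrite ler_wpM2l// expR_normr_le2.
  have -> : A * `|x| = `|x| + (`|s| * `|x| + `|x|) by rewrite /A; ring.
  rewrite 2!expRD.
  have -> : `|x| ^+ n * expR (`|s| * `|x|) * (`|x| * expR `|x|) =
    `|x| ^+ n.+1 * (expR (`|s| * `|x|) * expR `|x|) by rewrite exprS; ring.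
  rewrite [leRHS]mulrA ler_wpM2r ?mulr_ge0 ?expR_ge0//.
  exact: normrX_le_expR.
Qed.

Let same_Xn n : same_integral (fun x => x ^+ n).
Proof.
apply: eq_same_integral (same_Xn_expR n 0) => x.
by rewrite mul0r expR0 mulr1.
Qed.

Let same_cosM t : same_integral (fun x => cos (t * x)).
Proof.
apply: (@same_integral_lim (fun n x => series (cos_coeff (t * x)) n) _
  (fun x => 1 * (expR (`|t| * x) + expR (- `|t| * x)))).
- move=> n; apply: same_integral_sum; last exact: same_cst.
  move=> i; apply: eq_same_integral (same_integralZ
    ((~~ odd i)%:R * (-1) ^+ i./2 * t ^+ i / i`!%:R) (same_Xn i)) => x.
  by rewrite /cos_coeff /= -exprnP exprMn; ring.
- exact: same_dom.
- by move=> x; rewrite unlock; exact: is_cvg_series_cos_coeff.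
- move=> n x; apply: (le_trans (normr_series_cos_coeff_le _ _)).
  by rewrite mul1r normrM expR_normr_le2.
Qed.

Let same_sinM t : same_integral (fun x => sin (t * x)).
Proof.
apply: (@same_integral_lim (fun n x => series (sin_coeff (t * x)) n) _
  (fun x => 1 * (expR (`|t| * x) + expR (- `|t| * x)))).
- move=> n; apply: same_integral_sum; last exact: same_cst.
  move=> i; apply: eq_same_integral (same_integralZ
    ((odd i)%:R * (-1) ^+ i.-1./2 * t ^+ i / i`!%:R) (same_Xn i)) => x.
  by rewrite /sin_coeff /= exprMn; ring.
- exact: same_dom.
- by move=> x; rewrite unlock; exact: is_cvg_series_sin_coeff.
- move=> n x; apply: (le_trans (normr_series_sin_coeff_le _ _)).
  by rewrite mul1r normrM expR_normr_le2.
Qed.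

Let same_cos_phase t c : same_integral (fun x => cos (t * x + c)).
Proof.
apply: eq_same_integral (same_integralD (same_integralZ (cos c) (same_cosM t))
  (same_integralZ (- sin c) (same_sinM t))) => x.
by rewrite cosD; ring.
Qed.

(** The extra cosine with free [t] and [c] lets the product-to-sum formula close the induction on
    [j]; [t = c = 0] recovers the powers. *)
Let same_cosXn b phi j :
  forall t c, same_integral (fun x => cos (b * x + phi) ^+ j * cos (t * x + c)).
Proof.
elim: j => [|j ih] t c.
  by apply: eq_same_integral (same_cos_phase t c) => x; rewrite expr0 mul1r.
apply: eq_same_integral (same_integralD
  (same_integralZ 2^-1 (ih (t + b) (c + phi)))
  (same_integralZ 2^-1 (ih (t - b) (c - phi)))) => x.
have -> : (t + b) * x + (c + phi) = (t * x + c) + (b * x + phi) by ring.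
have -> : (t - b) * x + (c - phi) = (t * x + c) - (b * x + phi) by ring.
by move: (t * x + c) (b * x + phi) => u v; rewrite cosD cosB exprS; field.
Qed.

Let same_expR_cos b phi s : same_integral (fun x => expR (s * cos (b * x + phi))).
Proof.
apply: (@same_integral_lim
  (fun n x => series (exp_coeff (s * cos (b * x + phi))) n) _
  (fun=> expR `|s|)).
- move=> n; apply: same_integral_sum; last exact: same_cst.
  move=> i; apply: eq_same_integral (same_integralZ
    (s ^+ i / i`!%:R) (same_cosXn b phi i 0 0)) => x.
  by rewrite /exp_coeff /= exprMn mul0r addr0 cos0; ring.
- exact: same_cst.
- by move=> x; exact: is_cvg_series_exp_coeff.
- move=> n x; apply: (le_trans (normr_series_exp_coeff_le _ _)).
  by rewrite ler_expR normrM ler_piMr// cos_max.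
Qed.

Let same_expR_expR_cos (b phi s l : R) : 0 <= l ->
  same_integral (fun x => expR (- l * expR (s * cos (b * x + phi)))).
Proof.
move=> l0; apply: (@same_integral_lim
  (fun n x => series (exp_coeff (- l * expR (s * cos (b * x + phi)))) n) _
  (fun=> expR (l * expR `|s|))).
- move=> n; apply: same_integral_sum; last exact: same_cst.
  move=> i; apply: eq_same_integral (same_integralZ
    ((- l) ^+ i / i`!%:R) (same_expR_cos b phi (i%:R * s))) => x.
  by rewrite /exp_coeff /= -mulrA expRM_natl [in RHS]exprMn; ring.
- exact: same_cst.
- by move=> x; exact: is_cvg_series_exp_coeff.
- move=> n x; apply: (le_trans (normr_series_exp_coeff_le _ _)).
  rewrite ler_expR normrM normrN (ger0_norm l0) ler_wpM2l//.
  rewrite ger0_norm ?expR_ge0// ler_expR (le_trans (ler_norm _))//.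
  by rewrite normrM ler_piMr// cos_max.
Qed.

(** The prefactor 1/(n+1) settles the case y = 0, where the inner exponential stays 1; for y > 0 the
    quadratic term of that exponential already outgrows it. *)
Let cvg_expR_expR (y : R) :
  expR (- (n.+1%:R)^-1 * expR (n.+1%:R * y)) @[n --> \oo] --> ((y <= 0)%R%:R : R).
Proof.
have hn : (n.+1%:R : R)^-1 @[n --> \oo] --> (0 : R) by exact: cvg_harmonic.
have [y0|y0] := leP y 0.
  rewrite -[X in _ --> X]expR0.
  apply: continuous_cvg; first exact: continuous_expR.
  apply/cvgr0Pnorm_le => e e0.
  move/cvgr0Pnorm_le : hn => /(_ e e0); apply: filterS => n hn.
  rewrite normrM normrN (le_trans _ hn)// ler_piMr//.
  rewrite ger0_norm ?expR_ge0// -expR0 ler_expR.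
  by rewrite mulr_ge0_le0.
apply: (@squeeze_cvgr _ _ _ _ (fun=> 0) (fun n => (2 / y ^+ 2) * n.+1%:R^-1)).
- apply: nearW => n; rewrite expR_ge0/=.
  set m : R := n.+1%:R; have m0 : 0 < m by rewrite ltr0n.
  have h1 : (m * y) ^+ 2 / 2 <= expR (m * y).
    have := @expR_ge1Dxn _ (m * y) 1 (mulr_ge0 (ltW m0) (ltW y0)).
    by rewrite (_ : 2`! = 2)%N//; lra.
  have h2 : m * y ^+ 2 / 2 <= m^-1 * expR (m * y).
    rewrite -(ler_pM2l m0) mulVKf ?gt_eqF//.
    by apply: le_trans h1; rewrite exprMn; lra.
  rewrite mulNr expRN; set E := expR (m^-1 * _).
  have hE : m * y ^+ 2 / 2 <= E.
    apply: (le_trans h2); apply: le_trans (expR_ge1Dx _).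
    by rewrite lerDr.
  have p0 : 0 < m * y ^+ 2 / 2 by rewrite divr_gt0// mulr_gt0// exprn_gt0.
  have -> : 2 / y ^+ 2 * m^-1 = (m * y ^+ 2 / 2)^-1.
    by field; rewrite !gt_eqF.
  by rewrite lef_pV2// posrE (lt_le_trans p0).
- exact: cvg_cst.
- rewrite -[X in _ --> X](mulr0 (2 / y ^+ 2)).
  by apply: cvgM; [exact: cvg_cst|exact: hn].
Qed.

Let same_cos_le0 b phi : same_integral (fun x => (cos (b * x + phi) <= 0)%R%:R).
Proof.
apply: (@same_integral_lim (fun n x =>
   expR (- (n.+1%:R)^-1 * expR (n.+1%:R * cos (b * x + phi)))) _ (fun=> 1)).
- by move=> n; apply: same_expR_expR_cos; rewrite invr_ge0.
- exact: same_cst.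
- by move=> x; exact: cvg_expR_expR.
- move=> n x; rewrite ger0_norm ?expR_ge0// -[leRHS]expR0 ler_expR mulNr oppr_le0.
Qed.

(** The phase turns the cosine into sin (h (x - r)) with h = 1/(n+1), which has the sign of x - r as
    soon as h |x - r| < pi. *)
Lemma same_integral_le r : same_integral (fun x => (x <= r)%R%:R).
Proof.
apply: (@same_integral_lim (fun n x =>
   (cos (n.+1%:R^-1 * x + (- (n.+1%:R^-1 * r) - pi / 2)) <= 0)%R%:R) _ (fun=> 1)).
- by move=> n; exact: same_cos_le0.
- exact: same_cst.
- move=> x; apply: cvg_near_cst.
  have hn : (n.+1%:R : R)^-1 * `|x - r| @[n --> \oo] --> (0 : R).
    rewrite -[X in _ --> X](mul0r `|x - r|).
    by apply: cvgM; [exact: cvg_harmonic|exact: cvg_cst].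
  have ppi : 0 < pi :> R := pi_gt0 R.
  have /cvgr0Pnorm_lt/(_ _ ppi) := hn.
  apply: filterS => n; set h := n.+1%:R^-1.
  have h0 : 0 < h by rewrite invr_gt0 ltr0n.
  rewrite normrM (ger0_norm (ltW h0)) normr_id => hp.
  have -> : h * x + (- (h * r) - pi / 2) = h * (x - r) - pi / 2 by ring.
  rewrite cosBpihalf; congr (_%:R); congr nat_of_bool.
  have [xr|xr] := leP x r.
    rewrite -oppr_ge0 -sinN -mulrN opprB.
    move: xr; rewrite le_eqVlt => /predU1P[->|xr].
      by rewrite subrr mulr0 sin0 lexx.
    apply/ltW/sin_gt0_pi; rewrite mulr_gt0 ?subr_gt0//=.
    by move: hp; rewrite distrC ger0_norm// subr_ge0 ltW.
  apply/negbTE; rewrite -ltNge; apply: sin_gt0_pi.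
  rewrite mulr_gt0 ?subr_gt0//=.
  by move: hp; rewrite gtr0_norm// subr_gt0.
- by move=> n x; rewrite ger0_norm ?ler0n// lern1 leq_b1.
Qed.

End mgf_uniqueness.

Section mgf_orthant.
Context d (T : measurableType d) {R : realType} (mu : {measure set T -> \bar R}).
Variables X Y : nat -> T -> R.

Lemma measurable_ler_cst (U : T -> R) (r : R) :
  measurable_fun setT U -> measurable_fun setT (fun w => (U w <= r)%R%:R : R).
Proof.
move=> mU; have -> : (fun w => (U w <= r)%R%:R : R) = \1_[set w | (U w <= r)%R].
  by apply/funext => w; rewrite indicE mem_setE.
apply: measurable_indic.
rewrite (_ : [set w | _] = U @^-1` `]-oo, r]); last first.
  by apply/seteqP; split => w /=; rewrite in_itv.
by rewrite -[X in measurable X]setTI; apply: mU => //; exact: measurable_itv.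
Qed.

Hypotheses (mX : forall i, measurable_fun setT (X i))
           (mY : forall i, measurable_fun setT (Y i)).

(** Induction on the number of coordinates: uniqueness in one dimension turns the last exponential
    into an indicator, which then joins the weight. General weights are carried for this purpose,
    and they also cover tilted laws. *)
Lemma mgf_orthant n (Z Z' : T -> R) :
  measurable_fun setT Z -> measurable_fun setT Z' ->
  (forall w, 0 <= Z w) -> (forall w, 0 <= Z' w) ->
  (forall s : nat -> R,
    \int[mu]_w (Z w * expR (\sum_(0 <= i < n) s i * X i w))%:E =
    \int[mu]_w (Z' w * expR (\sum_(0 <= i < n) s i * Y i w))%:E)%E ->
  (forall s : nat -> R,
    \int[mu]_w (Z w * expR (\sum_(0 <= i < n) s i * X i w))%:E < +oo)%E ->
  forall r : nat -> R,
  (\int[mu]_w (Z w * \prod_(0 <= i < n) (X i w <= r i)%R%:R)%:E =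
   \int[mu]_w (Z' w * \prod_(0 <= i < n) (Y i w <= r i)%R%:R)%:E)%E.
Proof.
elim: n Z Z' => [|n ih] Z Z' mZ mZ' Z0 Z'0 h hfin r.
  have := h (fun=> 0).
  under eq_integral do rewrite big_nil expR0 mulr1.
  under [X in _ = X -> _]eq_integral do rewrite big_nil expR0 mulr1.
  move=> e.
  under eq_integral do rewrite big_nil mulr1.
  by under [RHS]eq_integral do rewrite big_nil mulr1.
under eq_integral do rewrite big_nat_recr//= [_ * (_ <= _)%R%:R]mulrC mulrA.
under [RHS]eq_integral do
  rewrite big_nat_recr//= [_ * (_ <= _)%R%:R]mulrC mulrA.
have mS (U : nat -> T -> R) (s : nat -> R) :
    (forall i, measurable_fun setT (U i)) ->
    measurable_fun setT (fun w => expR (\sum_(0 <= i < n) s i * U i w)).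
  move=> mU; apply: measurableT_comp => //.
  by apply: measurable_sum => i; exact: measurable_funM.
have K (s : nat -> R) : same_integral mu
    (fun w => Z w * expR (\sum_(0 <= i < n) s i * X i w))
    (fun w => Z' w * expR (\sum_(0 <= i < n) s i * Y i w)) (X n) (Y n)
    (fun x => (x <= r n)%R%:R).
  pose s' a i := if i == n then a else s i.
  have E a (W : T -> R) (U : nat -> T -> R) w :
      W w * expR (\sum_(0 <= i < n) s i * U i w) * expR (a * U n w) =
      W w * expR (\sum_(0 <= i < n.+1) s' a i * U i w).
    rewrite big_nat_recr//= expRD mulrA /s' eqxx; congr (_ * expR _ * _).
    by apply: eq_big_nat => i /andP[_ ilt]; rewrite ltn_eqF.
  apply: same_integral_le => //.
  - by apply: measurable_funM => //; exact: mS.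
  - by apply: measurable_funM => //; exact: mS.
  - by move=> w; rewrite mulr_ge0 ?expR_ge0.
  - by move=> w; rewrite mulr_ge0 ?expR_ge0.
  - move=> a; under eq_integral do rewrite E.
    by under [RHS]eq_integral do rewrite E; exact: h.
  - by move=> a; under eq_integral do rewrite E; exact: hfin.
apply: (ih (fun w => Z w * (X n w <= r n)%R%:R)
           (fun w => Z' w * (Y n w <= r n)%R%:R)).
- by apply: measurable_funM => //; exact: measurable_ler_cst.
- by apply: measurable_funM => //; exact: measurable_ler_cst.
- by move=> w; rewrite mulr_ge0.
- by move=> w; rewrite mulr_ge0.
- move=> s; have [_ _ _ e] := K s.
  under eq_integral do rewrite mulrAC.
  by under [RHS]eq_integral do rewrite mulrAC.
- move=> s; have [_ i1 _ _] := K s.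
  under eq_integral do rewrite mulrAC.
  have /integrableP[_] := i1.
  by under eq_integral do rewrite gee0_abs ?lee_fin ?mulr_ge0 ?expR_ge0//.
Qed.

End mgf_orthant.

(** * Gaussian linear combinations and the Cameron-Martin formula *)

Section normal_moments.
Context {R : realType}.
Notation leb := (@lebesgue_measure R).

Lemma ge0_integral_normal_prob (m s : R) (f : R -> \bar R) :
  (forall x, 0 <= f x)%E -> measurable_fun setT f ->
  (\int[normal_prob m s]_x f x = \int[leb]_x (f x * (normal_pdf m s x)%:E))%E.
Proof.
move=> f0 mf; have dom := normal_prob_dominates m s.
rewrite -(Radon_Nikodym_SigmaFinite.change_of_variables dom)//.
have mRN := measurable_int _ (Radon_Nikodym_SigmaFinite.f_integrable dom).
have mpdf : measurable_fun setT (fun x => (normal_pdf m s x)%:E).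
  by apply/measurable_EFinP; exact: measurable_normal_pdf.
apply: ae_eq_integral => //; try exact: emeasurable_funM.
apply: ae_eqe_mul2l; apply: integral_ae_eq => //.
  exact: Radon_Nikodym_SigmaFinite.f_integrable.
by move=> E _ mE; rewrite -Radon_Nikodym_SigmaFinite.f_integral.
Qed.

Lemma mgf_normal_prob (m s a : R) : s != 0 ->
  (\int[normal_prob m s]_x (expR (a * x))%:E =
   (expR (a * m + (a * s) ^+ 2 / 2))%:E)%E.
Proof.
move=> s0; rewrite ge0_integral_normal_prob; last 2 first.
- by move=> x; rewrite lee_fin expR_ge0.
- by apply/measurable_EFinP; apply: measurableT_comp.
(* Completing the square: the tilt moves the mean to [m + a * s ^+ 2]. *)
have E x : expR (a * x) * normal_pdf m s x =
    expR (a * m + (a * s) ^+ 2 / 2) * normal_pdf (m + a * s ^+ 2) s x.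
  rewrite /normal_pdf (negbTE s0) /normal_fun.
  rewrite mulrCA [RHS]mulrCA; congr (_ * _); rewrite -!expRD; congr expR.
  by field.
under eq_integral do rewrite -EFinM E EFinM.
rewrite integralZl//; last exact: integrable_normal_pdf.
by rewrite integral_normal_pdf mule1.
Qed.

End normal_moments.

Section gaussian_law_mgf.
Context d (Omega : measurableType d) {R : realType} (P : probability Omega R).
Variable Y : Omega -> R.
Hypothesis mY : measurable_fun setT Y.

Lemma mgf_gaussian_law : gaussian_law (pushforward P Y) ->
  exists m s : R, forall a : R,
    (\int[P]_w (expR (a * Y w))%:E = (expR (a * m + (a * s) ^+ 2 / 2))%:E)%E.
Proof.
have mf a : measurable_fun setT (fun x : measurableTypeR R => (expR (a * x))%:E).
  by apply/measurable_EFinP; apply: measurableT_comp.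
have push a : (\int[P]_w (expR (a * Y w))%:E =
    \int[pushforward P (Y : Omega -> measurableTypeR R)]_x (expR (a * x))%:E)%E.
  by rewrite ge0_integral_pushforward.
move=> [m [law|[s s0 law]]].
(* A Dirac mass is the case [s = 0] of the formula. *)
- exists m, 0; move=> a; rewrite push.
  transitivity (\int[\d_(m : measurableTypeR R)]_x (expR (a * x))%:E)%E.
    by apply: eq_measure_integral => A mA _; exact: law.
  by rewrite integral_dirac// diracE in_setT mul1e mulr0 expr0n/= mul0r addr0.
- exists m, s; move=> a; rewrite push -mgf_normal_prob ?gt_eqF//.
  by apply: eq_measure_integral => A mA _; exact: law.
Qed.

Let dominated (f_ : nat -> R -> R) (f g : R -> R) :
  (forall n, measurable_fun setT (f_ n)) -> measurable_fun setT f ->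
  (forall x, f_ ^~ x @ \oo --> f x) ->
  P.-integrable setT (fun w => (g (Y w))%:E) ->
  (forall n x, `|f_ n x| <= g x) ->
  (\int[P]_w (f_ n (Y w))%:E @[n --> \oo] --> \int[P]_w (f (Y w))%:E)%E.
Proof.
move=> mf_ mf ff ig fg.
have [|||||_ _ //] := @dominated_convergence _ _ _ P setT measurableT
      (fun n w => (f_ n (Y w))%:E) (fun w => (f (Y w))%:E)
      (fun w => (g (Y w))%:E).
- move=> n; apply/measurable_EFinP; exact: measurableT_comp.
- by apply/measurable_EFinP; exact: measurableT_comp.
- by apply: aeW => w _; apply: cvg_EFin; [exact: nearW|exact: ff].
- exact: ig.
- by apply: aeW => w n _ /=; rewrite lee_fin.
Qed.

(* A Gaussian law is only known through its parameters here; these are read off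
   the moment generating function by differentiating it at 0. *)
Lemma mgf_centered_gaussian_law (v : R) : gaussian_law (pushforward P Y) ->
  ('E_P[Y] = 0)%E -> ('E_P[(fun w => Y w * Y w)%R] = v%:E)%E ->
  (\int[P]_w (expR (Y w))%:E = (expR (v / 2))%:E)%E.
Proof.
move=> /mgf_gaussian_law[m [s mgf]] EY EYY.
have iexp a : P.-integrable setT (fun w => (expR (a * Y w))%:E).
  apply/integrableP; split.
    apply/measurable_EFinP; apply: measurableT_comp => //.
    exact: measurable_funM.
  under eq_integral do rewrite gee0_abs ?lee_fin ?expR_ge0//.
  by rewrite mgf ltry.
have int1 : (\int[P]_w (1 : R)%:E = 1)%E.
  by rewrite integral_cst// mul1e; exact: probability_setT.
pose g (x : R) := 2 * (expR (2 * x) + expR (- 2 * x)).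
have ig : P.-integrable setT (fun w => (g (Y w))%:E).
  have := integrableZl measurableT 2
    (integrableD measurableT (iexp 2) (iexp (- 2))).
  by apply: eq_integrable => // w _; rewrite /g EFinM EFinD.
have hle (n : nat) : 0 < n.+1%:R^-1 :> R /\ n.+1%:R^-1 <= 1 :> R.
  by rewrite invr_gt0 ltr0n invf_le1 ?ltr0n// ler1n.
have mh (n : nat) : n.+1%:R * n.+1%:R^-1 = 1 :> R by rewrite mulfV// pnatr_eq0.
have b1 n (x : R) : `|n.+1%:R * (expR (n.+1%:R^-1 * x) - 1)| <= `|x| * expR `|x|.
  have [h0 h1] := hle n.
  rewrite normrM; apply: (le_trans (ler_wpM2l (normr_ge0 _) (normr_expRB1_le _))).
  rewrite normrM (ger0_norm (ltW h0)) [`|n.+1%:R|]ger0_norm ?ler0n// !mulrA mh mul1r.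
  by rewrite ler_wpM2l// ler_expR ler_piMl.
have b2 (x : R) : `|x| * expR `|x| <= g x.
  have h := expR_normr_le (2 * x); rewrite normrM ger0_norm// -mulNr in h.
  have h' : `|x| * expR `|x| <= expR (2 * `|x|).
    rewrite (_ : 2 * `|x| = `|x| + `|x|) ?expRD ?ler_wpM2r ?expR_ge0//.
      by have := expR_ge1Dx `|x|; lra.
    by ring.
  rewrite /g; have := expR_gt0 (2 * x); have := expR_gt0 (- 2 * x); lra.
have m0 : m = 0.
  have c1 := @dominated (fun n x => n.+1%:R * (expR (n.+1%:R^-1 * x) - 1)) id g.
  have {}c1 : (\int[P]_w (n.+1%:R * (expR (n.+1%:R^-1 * Y w) - 1))%:E
      @[n --> \oo] --> \int[P]_w (Y w)%:E)%E.
    apply: c1 => //.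
    - move=> n; apply: measurable_funM => //; apply: measurable_funB => //.
      by apply: measurableT_comp => //; exact: measurable_funM.
    - exact: cvg_expRB1.
    - by move=> n x; apply: le_trans (b2 x); exact: b1.
  rewrite -/(expectation P Y) in c1.
  have EYe : (\int[P]_w (Y w)%:E = 0)%E by rewrite -EY unlock.
  rewrite EYe in c1.
  have c2 : (n.+1%:R * (expR (n.+1%:R^-1 * (m + n.+1%:R^-1 * (s ^+ 2 / 2))) - 1))%:E
      @[n --> \oo] --> (0 : \bar R).
    apply: cvg_trans c1; apply: near_eq_cvg; near=> n.
    under eq_integral do rewrite EFinM EFinB.
    rewrite integralZl//; last by apply: integrableB => //; exact: finite_measure_integrable_cst.
    rewrite integralB//; last exact: finite_measure_integrable_cst.
    rewrite mgf int1 -EFinB -EFinM.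
    by congr ((_ * (expR _ - 1))%:E); ring.
  have c3 : (n.+1%:R * (expR (n.+1%:R^-1 * (m + n.+1%:R^-1 * (s ^+ 2 / 2))) - 1))
      @[n --> \oo] --> m.
    pose u (n : nat) : R := m + n.+1%:R^-1 * (s ^+ 2 / 2).
    have uc : u n @[n --> \oo] --> m.
      rewrite -[X in _ --> X]addr0; apply: cvgD; first exact: cvg_cst.
      rewrite -[X in _ --> X](mul0r (s ^+ 2 / 2)).
      by apply: cvgM; [exact: cvg_harmonic|exact: cvg_cst].
    apply: (@squeeze_cvgr _ _ _ _ u (fun n => u n * expR (n.+1%:R^-1 * u n))).
    - apply: nearW => n; rewrite -/(u n); apply/andP; split.
        have := expR_ge1Dx (n.+1%:R^-1 * u n).
        rewrite addrC -lerBrDr => h.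
        apply: (le_trans _ (ler_wpM2l (ler0n _ n.+1) h)).
        by rewrite mulrA mh mul1r.
      apply: le_trans (ler_wpM2l (ler0n _ n.+1) (expRB1_le _)) _.
      by rewrite !mulrA mh mul1r.
    - exact: uc.
    - rewrite [X in _ --> X](_ : m = m * expR (0 * m)); last first.
        by rewrite mul0r expR0 mulr1.
      apply: cvgM; first exact: uc.
      apply: continuous_cvg; first exact: continuous_expR.
      by apply: cvgM; [exact: cvg_harmonic|exact: uc].
  apply/eqP; rewrite eq_sym; apply/eqP.
  apply: cvg_unique c3 => //; move/fine_cvgP : c2 => [_ c2].
  exact: c2.
have sv : s ^+ 2 = v.
  pose g4 (x : R) := 2 * (expR (4 * x) + expR (- 4 * x)).
  have ig4 : P.-integrable setT (fun w => (g4 (Y w))%:E).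
    have := integrableZl measurableT 2
      (integrableD measurableT (iexp 4) (iexp (- 4))).
    by apply: eq_integrable => // w _; rewrite /g4 EFinM EFinD.
  (* Expanded, this is the symmetric second difference (e^(hx) + e^(-hx) - 2) / h^2 with h =
     1/(n+1): its expectation is read off the moment generating function, and its limit is x^2. *)
  pose f_ (n : nat) x : R :=
    expR (- n.+1%:R^-1 * x) * (n.+1%:R * (expR (n.+1%:R^-1 * x) - 1)) ^+ 2.
  have mE a : measurable_fun setT (fun x : R => expR (a * x)).
    by apply: measurableT_comp => //; exact: measurable_funM.
  have c1 : (\int[P]_w (f_ n (Y w))%:E @[n --> \oo] --> \int[P]_w (Y w * Y w)%:E)%E.
    apply: (@dominated f_ (fun x => x * x) g4) => //.
    - move=> n; apply: measurable_funM; first exact: mE.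
      apply: measurable_funX; apply: measurable_funM => //.
      by apply: measurable_funB => //; exact: mE.
    - exact: measurable_funM.
    - move=> x; rewrite -[X in _ --> X]mul1r -expr2; apply: cvgM.
        rewrite -[X in _ --> X]expR0; apply: continuous_cvg.
          exact: continuous_expR.
        rewrite -[X in _ --> X](mul0r x) -oppr0.
        by apply: cvgM; [apply: cvgN; exact: cvg_harmonic|exact: cvg_cst].
      by rewrite expr2; apply: cvgM; exact: cvg_expRB1.
    - move=> n x; have [h0 h1] := hle n.
      rewrite normrM normrX.
      apply: (@le_trans _ _ (expR `|x| * (`|x| * expR `|x|) ^+ 2)).
        apply: ler_pM => //.
          rewrite ger0_norm ?expR_ge0// ler_expR (le_trans (ler_norm _))//.
          by rewrite normrM normrN (ger0_norm (ltW h0)) ler_piMl.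
        by rewrite lerXn2r ?nnegrE ?mulr_ge0 ?expR_ge0// b1.
      apply: (@le_trans _ _ (2 * expR (4 * `|x|))).
        have -> : 4 * `|x| = `|x| + (`|x| + (`|x| + `|x|)) by ring.
        rewrite !expRD.
        have := normrX_le_expR x 2; rewrite (_ : 2`! = 2)%N// => h.
        have -> : expR `|x| * (`|x| * expR `|x|) ^+ 2 =
          `|x| ^+ 2 * (expR `|x| * (expR `|x| * expR `|x|)) by ring.
        by rewrite [leRHS]mulrA ler_wpM2r// !mulr_ge0 ?expR_ge0.
      have := expR_normr_le (4 * x); rewrite normrM ger0_norm// -mulNr.
      by rewrite /g4; lra.
  have e2 : (\int[P]_w (Y w * Y w)%:E = v%:E)%E by rewrite -EYY unlock.
  rewrite e2 in c1.
  have c2 : (n.+1%:R ^+ 2 * (2 * (expR ((n.+1%:R^-1 * s) ^+ 2 / 2) - 1)))%:E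
      @[n --> \oo] --> v%:E.
    apply: cvg_trans c1; apply: near_eq_cvg; near=> n.
    have E x : f_ n x = n.+1%:R ^+ 2 * ((expR (n.+1%:R^-1 * x)
        + expR (- n.+1%:R^-1 * x)) + (- 2) * 1).
      rewrite /f_ (mulNr n.+1%:R^-1) expRN; field.
      by rewrite gt_eqF ?expR_gt0.
    under eq_integral do rewrite E EFinM EFinD EFinD.
    have i1 := iexp n.+1%:R^-1; have i2 := iexp (- n.+1%:R^-1).
    have i3 : P.-integrable setT (fun=> (- 2 * 1 : R)%:E).
      exact: finite_measure_integrable_cst.
    have i12 := integrableD measurableT i1 i2.
    rewrite integralZl//; last exact: (integrableD measurableT i12 i3).
    rewrite (integralD measurableT i12 i3) (integralD measurableT i1 i2) !mgf.
    under eq_integral do rewrite EFinM.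
    rewrite integralZl//; last exact: finite_measure_integrable_cst.
    rewrite int1 mule1 -!EFinD -EFinM m0 !mulr0 !add0r.
    by congr (_%:E); rewrite mulNr sqrrN; ring.
  have c3 : (n.+1%:R ^+ 2 * (2 * (expR ((n.+1%:R^-1 * s) ^+ 2 / 2) - 1)))
      @[n --> \oo] --> s ^+ 2.
    pose u (n : nat) : R := (n.+1%:R^-1 * s) ^+ 2 / 2.
    have uc : u n @[n --> \oo] --> 0.
      have : (n.+1%:R^-1 * s) @[n --> \oo] --> 0 * s.
        by apply: cvgM; [exact: cvg_harmonic|exact: cvg_cst].
      move=> h; rewrite (_ : 0 = (0 * s) * (0 * s) / 2); last by rewrite mul0r !mulr0 mul0r.
      by apply: cvgM; [rewrite /u; apply: cvgM|exact: cvg_cst].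
    have nu n : n.+1%:R ^+ 2 * (2 * u n) = s ^+ 2.
      rewrite /u exprMn -(mulr1 (s ^+ 2)) -[in RHS](expr1n _ 2) -(mh n).
      by field.
    apply: (@squeeze_cvgr _ _ _ _ (fun=> s ^+ 2) (fun n => s ^+ 2 * expR (u n))).
    - apply: nearW => n; rewrite -/(u n); apply/andP; split.
        rewrite -[leLHS](nu n) ler_wpM2l ?exprn_ge0// ler_wpM2l//.
        by have := expR_ge1Dx (u n); lra.
      rewrite -[s ^+ 2 in leRHS](nu n).
      have := expRB1_le (u n) => h.
      have c0 : 0 <= n.+1%:R ^+ 2 * 2 :> R by rewrite mulr_ge0 ?exprn_ge0.
      by have := ler_wpM2l c0 h; rewrite !mulrA.
    - exact: cvg_cst.
    - rewrite -[X in _ --> X](mulr1 (s ^+ 2)) -[X in _ * X](@expR0 R).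
      apply: cvgM; first exact: cvg_cst.
      by apply: continuous_cvg; [exact: continuous_expR|exact: uc].
  apply: cvg_unique c3 _ => //; move/fine_cvgP : c2 => [_ c2].
  exact: c2.
have := mgf 1; rewrite m0 mulr0 add0r mul1r sv.
by under eq_integral do rewrite mul1r.
Unshelve. all: by end_near. Qed.

End gaussian_law_mgf.

Section gaussian_law_integrable.
Context d (Omega : measurableType d) {R : realType} (P : probability Omega R).

Lemma gaussian_law_integrable_expR (Y : Omega -> R) (a : R) :
  measurable_fun setT Y -> gaussian_law (pushforward P Y) ->
  P.-integrable setT (fun w => (expR (a * Y w))%:E).
Proof.
move=> mY /(mgf_gaussian_law mY)[m [s mgf]]; apply/integrableP; split.
  apply/measurable_EFinP; apply: measurableT_comp => //.
  exact: measurable_funM.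
under eq_integral do rewrite gee0_abs ?lee_fin ?expR_ge0//.
by rewrite mgf ltry.
Qed.

Lemma gaussian_law_integrable (Y : Omega -> R) :
  measurable_fun setT Y -> gaussian_law (pushforward P Y) ->
  P.-integrable setT (fun w => (Y w)%:E).
Proof.
move=> mY gY; have i1 := gaussian_law_integrable_expR 1 mY gY.
have i2 := gaussian_law_integrable_expR (- 1) mY gY.
apply: le_integrable (integrableD measurableT i1 i2) => //.
  exact/measurable_EFinP.
move=> w _; rewrite /= lee_fin [leRHS]ger0_norm ?addr_ge0 ?expR_ge0//.
rewrite mul1r mulN1r; apply: (le_trans _ (expR_normr_le _)).
by have := expR_ge1Dx `|Y w|; lra.
Qed.

Lemma gaussian_law_integrableM (Y Z : Omega -> R) :
  measurable_fun setT Y -> gaussian_law (pushforward P Y) ->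
  measurable_fun setT Z -> gaussian_law (pushforward P Z) ->
  P.-integrable setT (fun w => (Y w * Z w)%:E).
Proof.
move=> mY gY mZ gZ.
have i U : measurable_fun setT U -> gaussian_law (pushforward P U) ->
    P.-integrable setT (fun w => (U w ^+ 2)%:E).
  move=> mU gU; have i1 := gaussian_law_integrable_expR 1 mU gU.
  have i2 := gaussian_law_integrable_expR (- 1) mU gU.
  apply: le_integrable (integrableZl measurableT 2 (integrableD measurableT i1 i2)) => //.
    by apply/measurable_EFinP; exact: measurable_funX.
  move=> w _; rewrite /= lee_fin [leRHS]ger0_norm ?mulr_ge0 ?addr_ge0 ?expR_ge0//.
  rewrite mul1r mulN1r.
  have := normrX_le_expR (U w) 2; rewrite (_ : 2`! = 2)%N// -normrX => h; apply: (le_trans h).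
  by rewrite ler_wpM2l// expR_normr_le.
apply: le_integrable (integrableD measurableT (i Y mY gY) (i Z mZ gZ)) => //.
  by apply/measurable_EFinP; exact: measurable_funM.
move=> w _; rewrite /= lee_fin [leRHS]ger0_norm ?addr_ge0 ?sqr_ge0//.
rewrite normrM -[Y w ^+ 2]ger0_norm ?sqr_ge0// -[Z w ^+ 2]ger0_norm ?sqr_ge0//.
rewrite !normrX; have := sqr_ge0 (`|Y w| - `|Z w|).
have := sqr_ge0 `|Y w|; have := sqr_ge0 `|Z w|.
by rewrite sqrrB; move: `|Y w| `|Z w| => y z; nra.
Qed.

End gaussian_law_integrable.

Section fbm_linear_span.
Context {R : realType} (H : R).
Context d (Omega : measurableType d) (P : probability Omega R).
Variable X : R -> {RV P >-> R}.
Hypothesis fbm : fractional_brownian_motion H X.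

Definition fbm_cov (H s t : R) : R :=
  (`|s| `^ (2 * H) + `|t| `^ (2 * H) - `|t - s| `^ (2 * H)) / 2.

(** A formal linear combination is a list of pairs (coefficient, time). Concatenation is addition,
    so combinations over different families of times are added and paired by [lin_cov] without
    matching their lengths. *)
Definition lin (s : seq (R * R)) (w : Omega) : R :=
  \sum_(p <- s) p.1 * X p.2 w.

Definition lin_cov (s s' : seq (R * R)) : R :=
  \sum_(p <- s) \sum_(q <- s') p.1 * q.1 * fbm_cov H p.2 q.2.

Definition nonneg_times (s : seq (R * R)) := all (fun p : R * R => 0 <= p.2) s.

Lemma measurable_lin s : measurable_fun setT (lin s).
Proof. by apply: measurable_sum => p; exact: measurable_funM. Qed.

Let gaussX t : 0 <= t -> gaussian_law (pushforward P (X t)).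
Proof.
move=> t0; have [gp _ _ _] := fbm.
have := gp 1%N (fun=> t) (fun=> 1) (fun=> t0).
congr (gaussian_law (pushforward P _)).
by apply/funext => w; rewrite big_ord1 mul1r.
Qed.

Lemma gaussian_law_lin s : nonneg_times s -> gaussian_law (pushforward P (lin s)).
Proof.
move=> s0; have [gp _ _ _] := fbm.
have := gp (size s) (fun i => (tnth (in_tuple s) i).2)
                    (fun i => (tnth (in_tuple s) i).1).
move=> /(_ (fun i => allP s0 _ (mem_tnth i (in_tuple s)))).
congr (gaussian_law (pushforward P _)).
by apply/funext => w; rewrite /lin [RHS]big_tnth.
Qed.

Lemma integrable_lin s : nonneg_times s ->
  P.-integrable setT (fun w => (lin s w)%:E).
Proof.
by move=> s0; apply: gaussian_law_integrable;
  [exact: measurable_lin|exact: gaussian_law_lin].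
Qed.

Lemma integrable_expR_lin s : nonneg_times s ->
  P.-integrable setT (fun w => (expR (lin s w))%:E).
Proof.
move=> s0; have := gaussian_law_integrable_expR 1 (measurable_lin s)
  (gaussian_law_lin s0).
by apply: eq_integrable => // w _; rewrite mul1r.
Qed.

Let EX t : 0 <= t -> (\int[P]_w (X t w)%:E = 0)%E.
Proof. by move=> t0; have [_ e _ _] := fbm; have := e t t0; rewrite unlock. Qed.

Let EXX s t : 0 <= s -> 0 <= t ->
  (\int[P]_w (X s w * X t w)%:E = (fbm_cov H s t)%:E)%E.
Proof.
by move=> s0 t0; have [_ _ e _] := fbm; have := e s t s0 t0; rewrite unlock.
Qed.

Let mX t : measurable_fun setT (X t). Proof. exact: measurable_funPT. Qed.

Let lin_cons p s w : lin (p :: s) w = p.1 * X p.2 w + lin s w.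
Proof. by rewrite /lin big_cons. Qed.

Lemma expectation_lin s : nonneg_times s -> ('E_P[lin s] = 0)%E.
Proof.
rewrite unlock; elim: s => [_|p s ih /=/andP[p0 s0]].
  by under eq_integral do rewrite /lin big_nil; rewrite integral0.
under eq_integral do rewrite lin_cons EFinD EFinM.
have ip := gaussian_law_integrable (mX p.2) (gaussX p0).
rewrite integralD//; last 2 first.
- exact: integrableZl.
- exact: integrable_lin.
by rewrite integralZl// EX// mule0 ih// add0e.
Qed.

Let expectation_X_lin t s : 0 <= t -> nonneg_times s ->
  (\int[P]_w (X t w * lin s w)%:E =
   (\sum_(q <- s) q.1 * fbm_cov H t q.2)%:E)%E.
Proof.
move=> t0; elim: s => [_|p s ih /=/andP[p0 s0]].
  by under eq_integral do rewrite /lin big_nil mulr0; rewrite integral0 big_nil.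
have E w : X t w * lin (p :: s) w = p.1 * (X t w * X p.2 w) + X t w * lin s w.
  by rewrite lin_cons; ring.
under eq_integral do rewrite E EFinD EFinM.
have ip := gaussian_law_integrableM (mX t) (gaussX t0) (mX p.2) (gaussX p0).
rewrite integralD//; last 2 first.
- exact: integrableZl.
- exact: gaussian_law_integrableM (mX t) (gaussX t0) (measurable_lin s)
    (gaussian_law_lin s0).
by rewrite integralZl// EXX// ih// big_cons EFinD EFinM.
Qed.

Lemma expectation_linM s s' : nonneg_times s -> nonneg_times s' ->
  ('E_P[(fun w => lin s w * lin s' w)%R] = (lin_cov s s')%:E)%E.
Proof.
move=> + s'0; rewrite unlock; elim: s => [_|p s ih /=/andP[p0 s0]].
  under eq_integral do rewrite /lin big_nil mul0r.
  by rewrite integral0 /lin_cov big_nil.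
have E w : lin (p :: s) w * lin s' w = p.1 * (X p.2 w * lin s' w) + lin s w * lin s' w.
  by rewrite lin_cons; ring.
under eq_integral do rewrite E EFinD EFinM.
have ms' := measurable_lin s'; have gs' := gaussian_law_lin s'0.
have ip := gaussian_law_integrableM (mX p.2) (gaussX p0) ms' gs'.
rewrite integralD//; last 2 first.
- exact: integrableZl.
- exact: gaussian_law_integrableM (measurable_lin s) (gaussian_law_lin s0) ms' gs'.
rewrite integralZl// expectation_X_lin// ih// /lin_cov big_cons EFinD.
congr (_ + _)%E; rewrite -EFinM big_distrr/=; congr (_%:E).
by apply: eq_bigr => q _; rewrite mulrA.
Qed.

Lemma mgf_lin s : nonneg_times s ->
  (\int[P]_w (expR (lin s w))%:E = (expR (lin_cov s s / 2))%:E)%E.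
Proof.
move=> s0; apply: mgf_centered_gaussian_law.
- exact: measurable_lin.
- exact: gaussian_law_lin.
- exact: expectation_lin.
- exact: expectation_linM.
Qed.

End fbm_linear_span.

Section lin_cov_algebra.
Context {R : realType} (H : R).
Implicit Types s : seq (R * R).
Local Notation cov := (lin_cov H).
Local Notation K := (fbm_cov H).

Lemma fbm_covC (s t : R) : K s t = K t s.
Proof. by rewrite /fbm_cov distrC; congr (_ / 2); ring. Qed.

Lemma lin_covC s s' : cov s s' = cov s' s.
Proof.
rewrite /lin_cov exchange_big /=; apply: eq_bigr => p _; apply: eq_bigr => q _.
by rewrite fbm_covC; ring.
Qed.

Lemma lin_cov_catl s1 s2 s : cov (s1 ++ s2) s = cov s1 s + cov s2 s.
Proof. by rewrite /lin_cov big_cat. Qed.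

Lemma lin_cov_catr s s1 s2 : cov s (s1 ++ s2) = cov s s1 + cov s s2.
Proof. by rewrite !(lin_covC s) lin_cov_catl. Qed.

Definition comb n (a t : nat -> R) : seq (R * R) :=
  [seq (a i, t i) | i <- index_iota 0 n].

Lemma lin_cov_comb n a t m a' t' :
  cov (comb n a t) (comb m a' t') =
  \sum_(0 <= i < n) \sum_(0 <= j < m) a i * a' j * K (t i) (t' j).
Proof.
rewrite /lin_cov big_map; apply: eq_bigr => i _.
by rewrite big_map.
Qed.

Lemma lin_cov_combr s n a t :
  cov s (comb n a t) = \sum_(0 <= i < n) a i * cov s [:: (1, t i)].
Proof.
rewrite lin_covC /lin_cov big_map; apply: eq_bigr => i _.
rewrite big_distrr; apply: eq_bigr => q _ /=.
by rewrite big_seq1/= fbm_covC; ring.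
Qed.

Lemma nonneg_times_comb n a t : (forall i, 0 <= t i) -> nonneg_times (comb n a t).
Proof. by move=> t0; apply/allP => _ /mapP[i _ ->]/=. Qed.

Lemma nonneg_times_cat s1 s2 :
  nonneg_times (s1 ++ s2) = nonneg_times s1 && nonneg_times s2.
Proof. exact: all_cat. Qed.

End lin_cov_algebra.

Section lin_algebra.
Context {R : realType} d (Omega : measurableType d) (P : probability Omega R).
Variable X : R -> {RV P >-> R}.

Lemma lin_cat s1 s2 w : lin X (s1 ++ s2) w = lin X s1 w + lin X s2 w.
Proof. by rewrite /lin big_cat. Qed.

Lemma lin_comb n a t w :
  lin X (comb n a t) w = \sum_(0 <= i < n) a i * X (t i) w.
Proof. by rewrite /lin big_map. Qed.

End lin_algebra.

Section fbm_law.
Context {R : realType} (H : R) (H_gt0 : 0 < H).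
Context d (Omega : measurableType d) (P : probability Omega R).
Variable X : R -> {RV P >-> R}.
Hypothesis fbm : fractional_brownian_motion H X.

Definition orthant n (Y : nat -> Omega -> R) (r : nat -> R) (w : Omega) : R :=
  \prod_(0 <= i < n) (Y i w <= r i)%R%:R.

Lemma measurable_orthant n (Y : nat -> Omega -> R) r :
  (forall i, measurable_fun setT (Y i)) -> measurable_fun setT (orthant n Y r).
Proof.
by move=> mY; apply: measurable_prod => i _; exact: measurable_ler_cst.
Qed.

Lemma orthant_ge0 n (Y : nat -> Omega -> R) r w : 0 <= orthant n Y r w.
Proof. exact: prodr_ge0. Qed.

Lemma orthantE n (Y : nat -> Omega -> R) r w :
  orthant n Y r w = (all (fun i => Y i w <= r i) (index_iota 0 n))%:R.
Proof.
rewrite /orthant; elim: (index_iota 0 n) => [|i s ih]; first by rewrite big_nil.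
by rewrite big_cons ih /= -natrM mulnb.
Qed.

(** [mgf_orthant] is applied to the weight [expR (lin X z w)] with the variables [X (t i)], and to
    the constant weight [expR V] with the translates [X (t i) + g i]; bilinearity of the covariance
    makes the exponential moments agree. *)
Lemma fbm_cameron_martin (z : seq (R * R)) n (t r : nat -> R) :
  nonneg_times z -> (forall i, 0 <= t i) ->
  (\int[P]_w (expR (lin X z w) * orthant n (fun i => X (t i)) r w)%:E =
   (expR (lin_cov H z z / 2))%:E *
   \int[P]_w (orthant n (fun i => X (t i))
                (fun i => (r i - lin_cov H z [:: (1, t i)])%R) w)%:E)%E.
Proof.
move=> z0 t0; set g := fun i => lin_cov H z [:: (1, t i)].
set V := lin_cov H z z / 2.
have mX i : measurable_fun setT (X i) by exact: measurable_funPT.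
have zs0 a : nonneg_times (z ++ comb n a t).
  by rewrite nonneg_times_cat z0 nonneg_times_comb.
have E1 a w : expR (lin X z w) * expR (\sum_(0 <= i < n) a i * X (t i) w) =
    expR (lin X (z ++ comb n a t) w).
  by rewrite -expRD lin_cat lin_comb.
have := @mgf_orthant _ _ _ P (fun i => X (t i))
  (fun i w => X (t i) w + g i) (fun i => mX (t i))
  (fun i => measurable_funD (mX (t i)) (measurable_cst (g i))) n
  (fun w => expR (lin X z w)) (fun=> expR V).
move=> -> //.
- under eq_integral do rewrite EFinM.
  rewrite ge0_integralZl//; last 2 first.
  + apply/measurable_EFinP; apply: measurable_orthant => i.
    exact: measurable_funD.
  + by move=> w _; rewrite lee_fin (orthant_ge0 _ (fun i w => X (t i) w + g i)).
  congr (_ * _)%E; apply: eq_integral => w _; congr (_%:E).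
  by apply: eq_bigr => i _; rewrite lerBrDr.
- by apply: measurableT_comp => //; exact: measurable_lin.
- move=> a; under eq_integral do rewrite E1.
  rewrite (mgf_lin fbm)//.
  have E2 w : expR V * expR (\sum_(0 <= i < n) a i * (X (t i) w + g i)) =
      expR (V + \sum_(0 <= i < n) a i * g i) * expR (lin X (comb n a t) w).
    rewrite -!expRD lin_comb; congr expR.
    under eq_bigr do rewrite mulrDr.
    by rewrite big_split/=; ring.
  under eq_integral do rewrite E2 EFinM.
  have c0 : nonneg_times (comb n a t) by exact: nonneg_times_comb.
  rewrite integralZl//; last exact: integrable_expR_lin fbm _ c0.
  rewrite (mgf_lin fbm)// -EFinM -expRD; congr (expR _)%:E.
  rewrite lin_cov_catl !lin_cov_catr (lin_covC _ (comb n a t) z).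
  by rewrite lin_cov_combr /V -/g; field.
- move=> a; under eq_integral do rewrite E1.
  by rewrite (mgf_lin fbm)// ltry.
Qed.

(** Both families are centered Gaussian with the same covariance, hence have the same exponential
    moments, and [mgf_orthant] applies with unit weights. *)
Lemma fbm_stationary_increments n (t r : nat -> R) (h : R) :
  (forall i, 0 <= t i) -> 0 <= h ->
  (\int[P]_w (orthant n (fun i w => X (t i + h) w - X h w) r w)%:E =
   \int[P]_w (orthant n (fun i => X (t i)) r w)%:E)%E.
Proof.
move=> t0 h0.
have mX i : measurable_fun setT (X i) by exact: measurable_funPT.
have := @mgf_orthant _ _ _ P (fun i w => X (t i + h) w - X h w)
  (fun i => X (t i)) (fun i => measurable_funB (mX (t i + h)) (mX h))
  (fun i => mX (t i)) n (fun=> 1) (fun=> 1).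
have th0 i : 0 <= t i + h by rewrite addr_ge0.
have c1 a : nonneg_times (comb n a (fun i => t i + h) ++ comb n (fun i => - a i) (fun=> h)).
  by rewrite nonneg_times_cat !nonneg_times_comb.
have E1 a w : 1 * expR (\sum_(0 <= i < n) a i * (X (t i + h) w - X h w)) =
    expR (lin X (comb n a (fun i => t i + h) ++ comb n (fun i => - a i) (fun=> h)) w).
  rewrite mul1r lin_cat !lin_comb -big_split/=; congr expR.
  by apply: eq_bigr => i _; ring.
move=> /(_ _ _ _ _ _ _ r) e.
under eq_integral do rewrite -(mul1r (orthant _ _ _ _)).
under [RHS]eq_integral do rewrite -(mul1r (orthant _ _ _ _)).
apply: e => //.
- move=> a; under eq_integral do rewrite E1.
  under [RHS]eq_integral do rewrite mul1r -lin_comb.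
  have c0 : nonneg_times (comb n a t) by exact: nonneg_times_comb.
  rewrite !(mgf_lin fbm)//; congr (expR (_ / 2))%:E.
  rewrite lin_cov_catl !lin_cov_catr !lin_cov_comb -!big_split/=.
  apply: eq_bigr => i _; rewrite -!big_split/=; apply: eq_bigr => j _.
  rewrite /fbm_cov.
  have -> : t j + h - (t i + h) = t j - t i by ring.
  have -> : h - (t i + h) = - t i by ring.
  have -> : t j + h - h = t j by ring.
  by rewrite subrr normrN normr0 powR0 ?mulf_neq0 ?gt_eqF//; field.
- by move=> a; under eq_integral do rewrite E1; rewrite (mgf_lin fbm)// ltry.
Qed.

End fbm_law.

(** * Running maxima on a grid *)

Section running_max.
Context {R : realType}.

(** The initial value 0 stands for the value at time 0, so the maximum is nonnegative. *)
Definition runmax n (y : nat -> R) : R := \big[Num.max/0]_(0 <= i < n) y i.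

(** The recursion isolates the first value and a running maximum of increments from it, to which
    stationarity applies. *)
Lemma runmaxS n y : runmax n.+1 y = Num.max 0 (y 0 + runmax n (fun i => y i.+1 - y 0)).
Proof.
rewrite /runmax big_nat_recl// maxC.
have -> (s : seq nat) : Num.max (\big[Num.max/0]_(i <- s) y i.+1) (y 0) =
    Num.max 0 (y 0 + \big[Num.max/0]_(i <- s) (y i.+1 - y 0)); last by [].
elim: s => [|i s ih]; first by rewrite !big_nil addr0.
by rewrite !big_cons -maxA ih addr_maxr addrCA subrr addr0 maxCA.
Qed.

Lemma runmax_ge0 n y : 0 <= runmax n y.
Proof.
rewrite /runmax; elim: (index_iota 0 n) => [|i s ih]; first by rewrite big_nil.
by rewrite big_cons le_max ih orbT.
Qed.

Lemma runmax_le n y x : 0 <= x ->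
  (runmax n y <= x) = all (fun i => y i <= x) (index_iota 0 n).
Proof.
move=> x0; rewrite /runmax; elim: (index_iota 0 n) => [|i s ih].
  by rewrite big_nil.
by rewrite big_cons ge_max ih.
Qed.

Lemma runmax_ge n y i : (i < n)%N -> y i <= runmax n y.
Proof.
move=> lin; have := lexx (runmax n y); rewrite runmax_le ?runmax_ge0//.
by move=> /allP; apply; rewrite mem_index_iota.
Qed.

Lemma runmax_le_sum n y : runmax n y <= \sum_(0 <= i < n) Num.max 0 (y i).
Proof.
rewrite /runmax; elim: (index_iota 0 n) => [|i s ih]; first by rewrite !big_nil.
have s0 : 0 <= \sum_(j <- s) Num.max 0 (y j).
  by apply: sumr_ge0 => j _; rewrite le_max lexx.
rewrite !big_cons ge_max; apply/andP; split.
  by rewrite (@le_trans _ _ (Num.max 0 (y i)))// ?le_max ?lexx ?orbT// lerDl.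
by apply: (le_trans ih); rewrite lerDr le_max lexx.
Qed.

Lemma runmax_homo n m y : (n <= m)%N -> runmax n y <= runmax m y.
Proof.
move=> nm; rewrite runmax_le ?runmax_ge0//; apply/allP => i.
by rewrite mem_index_iota => /= lin; apply: runmax_ge; rewrite (leq_trans lin).
Qed.

End running_max.

Section measurable_runmax.
Context {R : realType} d (T : measurableType d).

Lemma measurable_runmax n (Y : nat -> T -> R) :
  (forall i, measurable_fun setT (Y i)) ->
  measurable_fun setT (fun w => runmax n (fun i => Y i w)).
Proof.
move=> mY; rewrite /runmax; elim: (index_iota 0 n) => [|i s ih].
  by under eq_fun do rewrite big_nil; exact: measurable_cst.
by under eq_fun do rewrite big_cons; exact: measurable_maxr.
Qed.

End measurable_runmax.

Section equal_cdf.
Context {R : realType} d (Omega : measurableType d) (P : probability Omega R).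

(** The expectation of a nonnegative variable is the integral of its tail over r >= 0, so the
    distribution function there determines it. *)
Lemma ge0_eq_expectation (f g : Omega -> R) :
  measurable_fun setT f -> measurable_fun setT g ->
  (forall w, 0 <= f w) -> (forall w, 0 <= g w) ->
  (forall r : R, (0 <= r)%R -> \int[P]_w ((f w <= r)%R%:R)%:E = \int[P]_w ((g w <= r)%R%:R)%:E)%E ->
  (\int[P]_w (f w)%:E = \int[P]_w (g w)%:E)%E.
Proof.
move=> mf mg f0 g0 fg.
pose F : {mfun Omega >-> R} := HB.pack f (isMeasurableFun.Build _ _ _ _ f mf).
pose G : {mfun Omega >-> R} := HB.pack g (isMeasurableFun.Build _ _ _ _ g mg).
have := @ge0_expectation_ccdf _ _ _ P F f0.
have := @ge0_expectation_ccdf _ _ _ P G g0.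
rewrite unlock /= => -> ->; apply: eq_integral => r.
rewrite inE/= in_itv/= andbT => r0.
have cdfE (h : {mfun Omega >-> R}) :
    cdf (P := P) h r = (\int[P]_w ((h w <= r)%R%:R)%:E)%E.
  rewrite /cdf /distribution /pushforward /=.
  rewrite -[X in P X]setIT -integral_indic//; last first.
    by rewrite -[X in measurable X]setTI; apply: measurable_funP => //; exact: measurable_itv.
  apply: eq_integral => w _; rewrite indicE; congr ((nat_of_bool _)%:R)%:E.
  by apply/idP/idP; rewrite inE /= in_itv.
have h1 := cdf_ccdf_1 (P := P) F r.
have h2 := cdf_ccdf_1 (P := P) G r.
have e : cdf (P := P) F r = cdf (P := P) G r by rewrite !cdfE fg.
have fc : cdf (P := P) G r \is a fin_num.
  by rewrite ge0_fin_numE ?cdf_ge0// (le_lt_trans (cdf_le1 _ _)) ?ltry.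
have cE (c : \bar R) : (cdf (P := P) G r + c = 1)%E -> (c = 1 - cdf (P := P) G r)%E.
  by move=> <-; rewrite [X in (X - _)%E]addeC addeK.
by rewrite (cE _ h2) (cE (ccdf (P := P) F r))// -e.
Qed.

End equal_cdf.

Section expected_running_max.
Context {R : realType} (H : R) (H_gt0 : 0 < H) (H_lt1 : H < 1).
Context d (Omega : measurableType d) (P : probability Omega R).
Variable X : R -> {RV P >-> R}.
Hypothesis fbm : fractional_brownian_motion H X.
Variable lam : R.
Hypothesis lam_gt0 : 0 < lam.

(** Time 0 is left out, so every grid time is at least the mesh. *)
Definition grid (i : nat) (w : Omega) : R := X (i.+1%:R * lam) w.

Definition emax n : R := \int[P]_w runmax n (grid ^~ w).

(* The negative part of the maximum of [grid 0], ..., [grid n], written so that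
   its expectation telescopes under stationarity of the increments. *)
Definition gridneg n (w : Omega) : R :=
  runmax n.+1 (grid ^~ w) -
  (grid 0 w + runmax n (fun i => grid i.+1 w - grid 0 w)).

Definition eneg n : R := \int[P]_w gridneg n w.

Let time_ge0 i : 0 <= i.+1%:R * lam.
Proof. by rewrite mulr_ge0// ltW. Qed.

Lemma measurable_grid i : measurable_fun setT (grid i).
Proof. exact: measurable_funPT. Qed.

Let grid_lin i w : lin X [:: (1, i.+1%:R * lam)] w = grid i w.
Proof. by rewrite /lin big_seq1 mul1r. Qed.

Let nonneg1 (a : R) i : nonneg_times [:: (a, i.+1%:R * lam)].
Proof. by rewrite /nonneg_times /= time_ge0. Qed.

Lemma integrable_grid i : P.-integrable setT (fun w => (grid i w)%:E).
Proof.
have := integrable_lin fbm (nonneg1 1 i).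
by apply: eq_integrable => // w _; rewrite grid_lin.
Qed.

Lemma Rintegral_grid i : \int[P]_w grid i w = 0.
Proof.
have := expectation_lin fbm (nonneg1 1 i); rewrite unlock /Rintegral.
move=> e; under eq_integral do rewrite -grid_lin.
by rewrite e.
Qed.

Lemma measurable_runmax_grid n : measurable_fun setT (fun w => runmax n (grid ^~ w)).
Proof. by apply: measurable_runmax => i; exact: measurable_grid. Qed.

Lemma measurable_runmax_incr n :
  measurable_fun setT (fun w => runmax n (fun i => grid i.+1 w - grid 0 w)).
Proof.
apply: (@measurable_runmax _ _ _ n (fun i w => grid i.+1 w - grid 0 w)) => i.
by apply: measurable_funB; exact: measurable_grid.
Qed.

Let integrable_runmax n (Y : nat -> Omega -> R) :
  (forall i, measurable_fun setT (Y i)) ->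
  (forall i, P.-integrable setT (fun w => (Y i w)%:E)) ->
  P.-integrable setT (fun w => (runmax n (Y ^~ w))%:E).
Proof.
move=> mY iY.
have iS : P.-integrable setT (fun w => \sum_(0 <= i < n) (`|Y i w|)%:E)%E.
  apply: integrable_sum => // i _; exact: (integrable_norm (iY i)).
apply: le_integrable iS => //.
  by apply/measurable_EFinP; exact: measurable_runmax.
move=> w _; rewrite sumEFin /= lee_fin !ger0_norm ?runmax_ge0 ?sumr_ge0//.
apply: (le_trans (runmax_le_sum _ _)); apply: ler_sum => i _.
by rewrite ge_max normr_ge0 ler_norm.
Qed.

Lemma integrable_runmax_grid n : P.-integrable setT (fun w => (runmax n (grid ^~ w))%:E).
Proof.
by apply: integrable_runmax; [exact: measurable_grid|exact: integrable_grid].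
Qed.

Let integrable_runmax_incr n :
  P.-integrable setT (fun w => (runmax n (fun i => grid i.+1 w - grid 0 w))%:E).
Proof.
apply: (@integrable_runmax n (fun i w => grid i.+1 w - grid 0 w)) => i.
  by apply: measurable_funB; exact: measurable_grid.
exact: (integrableB measurableT (integrable_grid i.+1) (integrable_grid 0)).
Qed.

Let runmax_stationary n :
  \int[P]_w runmax n (fun i => grid i.+1 w - grid 0 w) = emax n.
Proof.
rewrite /emax /Rintegral; congr fine; apply: ge0_eq_expectation.
- exact: measurable_runmax_incr.
- exact: measurable_runmax_grid.
- by move=> w; exact: runmax_ge0.
- by move=> w; exact: runmax_ge0.
- move=> r r0; under eq_integral do rewrite runmax_le//.
  under [RHS]eq_integral do rewrite runmax_le//.
  have e := fbm_stationary_increments H_gt0 fbm n (fun=> r) time_ge0 (ltW lam_gt0).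
  transitivity (\int[P]_w (orthant n
      (fun i w => X (i.+1%:R * lam + lam) w - X lam w) (fun=> r) w)%:E)%E.
    apply: eq_integral => w _; rewrite orthantE; congr ((nat_of_bool _)%:R)%:E.
    apply: eq_all => i; rewrite /grid mul1r.
    by have -> : i.+2%:R * lam = i.+1%:R * lam + lam by rewrite -natr1 mulrDl mul1r.
  by rewrite e; apply: eq_integral => w _; rewrite orthantE.
Qed.

Lemma gridnegE n w : gridneg n w =
  Num.max 0 (- (grid 0 w + runmax n (fun i => grid i.+1 w - grid 0 w))).
Proof.
by rewrite /gridneg runmaxS; set W := grid 0 w + _; rewrite addr_maxl add0r subrr maxC.
Qed.

Lemma gridneg_ge0 n w : 0 <= gridneg n w.
Proof. by rewrite gridnegE le_max lexx. Qed.

Lemma gridneg_nonincr n m w : (n <= m)%N -> gridneg m w <= gridneg n w.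
Proof.
move=> nm; rewrite !gridnegE ge_max le_max lexx/= le_max lerN2 lerD2l.
by rewrite runmax_homo ?orbT.
Qed.

Lemma integrable_gridneg n : P.-integrable setT (fun w => (gridneg n w)%:E).
Proof.
under eq_fun do rewrite /gridneg EFinB EFinD.
apply: integrableB => //; first exact: integrable_runmax_grid.
by apply: integrableD => //; exact: integrable_grid.
Qed.

Lemma emaxS n : emax n.+1 = emax n + eneg n.
Proof.
have i1 := integrable_runmax_grid n.+1; have i2 := integrable_grid 0.
have i3 := integrable_runmax_incr n; have i23 := integrableD measurableT i2 i3.
rewrite /eneg /gridneg RintegralB// RintegralD// Rintegral_grid add0r.
by rewrite runmax_stationary /emax addrC subrK.
Qed.

Lemma eneg_ge0 n : 0 <= eneg n.
Proof. by apply: Rintegral_ge0 => w _; exact: gridneg_ge0. Qed.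

Lemma eneg_nonincr n m : (n <= m)%N -> eneg m <= eneg n.
Proof.
move=> nm; apply: le_Rintegral => //; try exact: integrable_gridneg.
by move=> w _; exact: gridneg_nonincr.
Qed.

Lemma emax0 : emax 0 = 0.
Proof.
rewrite /emax /Rintegral; under eq_integral do rewrite /runmax big_nil.
by rewrite integral0.
Qed.

Lemma emax_sum n m : (n <= m)%N -> emax m = emax n + \sum_(n <= i < m) eneg i.
Proof.
elim: m => [|m ih]; first by rewrite leqn0 => /eqP ->; rewrite big_nil addr0.
rewrite leq_eqVlt => /predU1P[->|]; first by rewrite big_geq// addr0.
by rewrite ltnS => nm; rewrite emaxS ih// big_nat_recr//= addrA.
Qed.

(** [emax] is concave with increments [eneg]: the last increment is at most the mean of all
    increments up to it. *)
Lemma eneg_le_emax n : n.+1%:R * eneg n <= emax n.+1.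
Proof.
rewrite (emax_sum (leq0n _)) emax0 add0r.
rewrite (_ : n.+1%:R * _ = \sum_(0 <= i < n.+1) eneg n); last first.
  by rewrite sumr_const_nat subn0 mulr_natl.
by apply: ler_sum_nat => i /andP[_ ilt]; apply: eneg_nonincr.
Qed.

Lemma emax_diff_le n m : (n <= m)%N -> emax m - emax n <= m%:R * eneg n.
Proof.
move=> nm; rewrite (emax_sum nm) addrC addKr.
apply: (@le_trans _ _ (\sum_(n <= i < m) eneg n)).
  by apply: ler_sum_nat => i /andP[ni _]; exact: eneg_nonincr.
rewrite sumr_const_nat -[leLHS]mulr_natl ler_wpM2r ?eneg_ge0// ler_nat.
exact: leq_subr.
Qed.

Lemma orthant_le_gridneg n w : orthant n.+1 grid (fun=> -1) w <= gridneg n w.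
Proof.
rewrite orthantE; case: allP => /= [h|_]; last exact: gridneg_ge0.
have h0 : grid 0 w <= -1 by apply: h; rewrite mem_index_iota.
rewrite gridnegE le_max lerNr; apply/orP; right.
rewrite -lerBrDl runmax_le; last by rewrite subr_ge0.
apply/allP => i; rewrite mem_index_iota => /= ilt.
by rewrite lerD2r h// mem_index_iota.
Qed.

(** If some grid value is positive, the left side vanishes. Otherwise it is at most [- grid 0 w],
    and 1 + u <= expR u at u = - grid 0 w - k splits off the level [k]. *)
Lemma gridneg_le_orthant n w (k : R) : 0 <= k ->
  gridneg n w <= k * orthant n.+1 grid (fun=> 0) w + expR (- grid 0 w - k).
Proof.
move=> k0; rewrite gridnegE ge_max addr_ge0 ?mulr_ge0 ?orthant_ge0 ?expR_ge0//=.
have rm := runmax_ge0 n (fun i => grid i.+1 w - grid 0 w).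
rewrite orthantE; case: allP => /= [h|h].
  rewrite mulr1; have := expR_ge1Dx (- grid 0 w - k); lra.
rewrite mulr0 add0r; apply: (@le_trans _ _ 0); last exact: expR_ge0.
rewrite oppr_le0; apply/negbNE/negP => W0; apply: h => i.
rewrite mem_index_iota => /= ilt; rewrite -ltNge in W0.
case: i ilt => [_|i]; first by lra.
rewrite ltnS => ilt.
have := runmax_ge (fun i => grid i.+1 w - grid 0 w) ilt; lra.
Qed.

End expected_running_max.

Section Rintegral_sum.
Context d (T : measurableType d) {R : realType} (mu : {measure set T -> \bar R}).

Lemma Rintegral_sum (n : nat) (f : nat -> T -> R) :
  (forall i, mu.-integrable setT (fun w => (f i w)%:E)) ->
  \int[mu]_w (\sum_(0 <= i < n) f i w) = \sum_(0 <= i < n) \int[mu]_w f i w.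
Proof.
move=> fi; elim: n => [|n ih].
  rewrite big_nil /Rintegral; under eq_integral do rewrite big_nil.
  by rewrite integral0.
have iS : mu.-integrable setT (fun w => (\sum_(0 <= i < n) f i w)%:E).
  under eq_fun do rewrite -sumEFin.
  by apply: integrable_sum.
rewrite big_nat_recr//= -ih -(RintegralD measurableT iS (fi n)).
by apply: eq_Rintegral => w _; rewrite big_nat_recr.
Qed.

End Rintegral_sum.

Section expected_running_max_bounds.
Context {R : realType} (H : R) (H_gt0 : 0 < H) (H_lt1 : H < 1).
Context d (Omega : measurableType d) (P : probability Omega R).
Variable X : R -> {RV P >-> R}.
Hypothesis fbm : fractional_brownian_motion H X.

Lemma fbm_cov_diag (t : R) : 0 <= t -> fbm_cov H t t = (t `^ H) ^+ 2.
Proof.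
move=> t0; rewrite /fbm_cov subrr normr0 powR0 ?mulf_neq0 ?gt_eqF//.
by rewrite ger0_norm// (mulrC 2) powRrM powR_mulrn ?powR_ge0//; field.
Qed.

Lemma lin_cov1 (a t : R) : 0 <= t ->
  lin_cov H [:: (a, t)] [:: (a, t)] = (a * t `^ H) ^+ 2.
Proof. by move=> t0; rewrite /lin_cov !big_seq1/= fbm_cov_diag//; ring. Qed.

Lemma Rintegral_expR_fbm (a t : R) : 0 <= t ->
  \int[P]_w expR (a * X t w) = expR ((a * t `^ H) ^+ 2 / 2).
Proof.
move=> t0; have n1 : nonneg_times [:: (a, t)] by rewrite /nonneg_times/= t0.
have := mgf_lin fbm n1; rewrite lin_cov1// => e.
rewrite /Rintegral (eq_integral (fun w => (expR (lin X [:: (a, t)] w))%:E)).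
  by rewrite e.
by move=> w _; rewrite /lin big_seq1.
Qed.

Lemma integrable_expR_fbm (a t : R) : 0 <= t ->
  P.-integrable setT (fun w => (expR (a * X t w))%:E).
Proof.
move=> t0; have n1 : nonneg_times [:: (a, t)] by rewrite /nonneg_times/= t0.
have := integrable_expR_lin fbm n1.
by apply: eq_integrable => // w _; rewrite /lin big_seq1.
Qed.

Lemma integrable_fbm_sqr (t : R) : 0 <= t ->
  P.-integrable setT (fun w => (X t w ^+ 2)%:E).
Proof.
move=> t0; have n1 : nonneg_times [:: (1 : R, t)] by rewrite /nonneg_times/= t0.
have m1 := measurable_lin X [:: (1, t)].
have g1 := gaussian_law_lin fbm n1.
have := gaussian_law_integrableM m1 g1 m1 g1.
by apply: eq_integrable => // w _; rewrite /lin big_seq1 mul1r expr2.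
Qed.

Lemma Rintegral_fbm_sqr (t : R) : 0 <= t -> \int[P]_w (X t w ^+ 2) = (t `^ H) ^+ 2.
Proof.
move=> t0; have n1 : nonneg_times [:: (1 : R, t)] by rewrite /nonneg_times/= t0.
have := expectation_linM fbm n1 n1; rewrite unlock lin_cov1// mul1r => e.
rewrite /Rintegral (eq_integral
  (fun w => (lin X [:: (1, t)] w * lin X [:: (1, t)] w)%:E)).
  by rewrite e.
by move=> w _; rewrite /lin big_seq1 mul1r expr2.
Qed.

Variable lam : R.
Hypothesis lam_gt0 : 0 < lam.
Local Notation emax := (emax X lam).
Local Notation eneg := (eneg X lam).

Let time_ge0 i : 0 <= i.+1%:R * lam.
Proof. by rewrite mulr_ge0// ltW. Qed.

(** A union bound through y <= k^2 + expR (y - k^2) with y = a X and a = k / s, [s] being the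
    standard deviation at the last time. For k = 1 + ln N the N error terms add up to at most [s],
    because k^2 / 2 >= ln N. *)
Lemma emax_upper N : (0 < N)%N ->
  emax N <= (N%:R * lam) `^ H * (2 + ln N%:R).
Proof.
move=> N0; have N1 : 1 <= N%:R :> R by rewrite ler1n.
set s := (N%:R * lam) `^ H.
have s0 : 0 < s by rewrite powR_gt0// mulr_gt0// ltr0n.
have l0 : 0 <= ln (N%:R : R) by exact: ln_ge0.
pose k : R := 1 + ln N%:R.
have k1 : 1 <= k by rewrite lerDl.
have k0 : 0 < k by rewrite (lt_le_trans ltr01).
pose a : R := k / s.
have a0 : 0 < a by rewrite divr_gt0.
have ask : a * (s * k) = k ^+ 2 by rewrite /a; field; rewrite gt_eqF.
pose g i w := (a^-1 * expR (- k ^+ 2)) * expR (a * X (i.+1%:R * lam) w).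
have ig i : P.-integrable setT (fun w => (g i w)%:E).
  exact: (integrableZl measurableT _ (integrable_expR_fbm a (time_ge0 i))).
have iS : P.-integrable setT (fun w => (\sum_(0 <= i < N) g i w)%:E).
  by under eq_fun do rewrite -sumEFin; apply: integrable_sum.
have icst c : P.-integrable setT (fun=> (c : R)%:E).
  exact: finite_measure_integrable_cst.
have g0 i w : 0 <= g i w by rewrite !mulr_ge0 ?expR_ge0// invr_ge0 ltW.
have bound w : runmax N (grid X lam ^~ w) <= s * k + \sum_(0 <= i < N) g i w.
  rewrite runmax_le; last first.
    by rewrite addr_ge0 ?mulr_ge0 ?sumr_ge0 ?(ltW s0) ?(ltW k0).
  apply/allP => i; rewrite mem_index_iota => /andP[_ ilt].
  apply: (@le_trans _ _ (s * k + g i w)); last first.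
    rewrite lerD2l big_mkord (bigD1 (Ordinal ilt))//= lerDl sumr_ge0//.
  rewrite -lerBlDl /g -mulrA -expRD -[leLHS](mulKf (lt0r_neq0 a0)).
  rewrite ler_pM2l ?invr_gt0// mulrBr ask /grid.
  set y := a * _; have := expR_ge1Dx (- k ^+ 2 + y); lra.
apply: (@le_trans _ _ (\int[P]_w (s * k + \sum_(0 <= i < N) g i w))).
  apply: le_Rintegral => //; first exact: (integrable_runmax_grid fbm lam_gt0).
  exact: (integrableD measurableT (icst (s * k)) iS).
rewrite (RintegralD measurableT (icst _) iS) Rintegral_cst// Rintegral_sum//.
have -> : fine (P setT) = 1 by rewrite (_ : P setT = 1%E)//; exact: probability_setT.
rewrite mulr1 (_ : s * (2 + ln N%:R) = s * k + s); last by rewrite /k; ring.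
rewrite lerD2l.
apply: (@le_trans _ _ (\sum_(0 <= i < N) (s / k * expR (- (k ^+ 2 / 2))))).
  apply: ler_sum_nat => i /andP[_ ilt].
  rewrite (RintegralZl _ measurableT (integrable_expR_fbm a (time_ge0 i))).
  rewrite Rintegral_expR_fbm// -[leLHS]mulrA -expRD.
  have -> : a^-1 = s / k by rewrite /a invf_div.
  rewrite ler_wpM2l ?divr_ge0 ?(ltW s0) ?(ltW k0)// ler_expR.
  have : (a * (i.+1%:R * lam) `^ H) ^+ 2 <= k ^+ 2.
    rewrite lerXn2r ?nnegrE ?(ltW k0) ?(mulr_ge0 (ltW a0) (powR_ge0 _ _))//.
    rewrite -[leRHS](divfK (lt0r_neq0 s0)) -/a; apply: (ler_wpM2l (ltW a0)).
    rewrite ge0_ler_powR ?nnegrE ?(ltW H_gt0)// ?mulr_ge0 ?(ltW lam_gt0)//.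
    by rewrite ler_wpM2r ?(ltW lam_gt0)// ler_nat.
  lra.
rewrite sumr_const_nat subn0 -[leLHS]mulr_natl.
have hN : N%:R <= expR (k ^+ 2 / 2) :> R.
  rewrite -[leLHS](lnK _) ?posrE ?ltr0n// ler_expR /k sqrrD.
  have := sqr_ge0 (ln (N%:R : R)); rewrite expr1n mul1r; lra.
have e0 := expR_gt0 (k ^+ 2 / 2).
have -> : N%:R * (s / k * expR (- (k ^+ 2 / 2))) =
    s * (k^-1 * (N%:R / expR (k ^+ 2 / 2))).
  by rewrite expRN; field; rewrite !gt_eqF.
rewrite -[leRHS]mulr1.
rewrite ler_pM2l// mulr_ile1 ?invr_ge0 ?divr_ge0 ?(ltW k0) ?(ltW e0)//.
  by rewrite invf_le1.
by rewrite ler_pdivrMr// mul1r.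
Qed.

(** Only the last grid value is used: max(0, x) = (x + |x|) / 2, and |x| / 2 is bounded below by x^2
    / (10 s) minus two exponentials, whose expectations are explicit. What remains is s / 10 - 2 s
    expR (- 3) / 5, at least s / 20 because 8 expR (- 3) <= 1. *)
Lemma emax_lower N : (0 < N)%N -> (N%:R * lam) `^ H / 20 <= emax N.
Proof.
case: N => // N _; set t := N.+1%:R * lam; set s := t `^ H.
have t0 : 0 <= t by exact: time_ge0.
have s0 : 0 < s by rewrite powR_gt0// mulr_gt0.
have e3 : 8 * expR (- 3) <= 1 :> R.
  have := expR_ge1Dx (1 : R) => h.
  rewrite expRN ler_pdivrMr ?expR_gt0// mul1r.
  rewrite (_ : 3 = 1 + (1 + 1) :> R); last by ring.
  rewrite !expRD; move: h; move: (expR 1) => e h.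
  have {}h : 2 <= e by lra.
  have h4 : 2 * 2 <= e * e by exact: ler_pM.
  have : 2 * (2 * 2) <= e * (e * e) by apply: ler_pM => //; rewrite mulr_ge0.
  lra.
pose c := s / 5 * expR (- 5).
pose g w := 2^-1 * X t w + ((10 * s)^-1 * X t w ^+ 2 -
  (c * expR (2 / s * X t w) + c * expR (- (2 / s) * X t w))).
have bound w : g w <= runmax N.+1 (grid X lam ^~ w).
  have hx : X t w <= runmax N.+1 (grid X lam ^~ w) by exact: (runmax_ge (grid X lam ^~ w)).
  have h0 := runmax_ge0 N.+1 (grid X lam ^~ w).
  apply: (@le_trans _ _ (2^-1 * X t w + 2^-1 * `|X t w|)); last first.
    have [x0|x0] := leP 0 (X t w).
      by rewrite ger0_norm//; lra.
    by rewrite ltr0_norm//; lra.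
  rewrite lerD2l.
  set y := `|X t w| / s.
  have y0 : 0 <= y by rewrite divr_ge0// ltW.
  have ys : `|X t w| = s * y by rewrite /y mulrC divfK// gt_eqF.
  have -> : X t w ^+ 2 = s ^+ 2 * y ^+ 2.
    by rewrite -exprMn -ys -normrX ger0_norm ?sqr_ge0.
  have E : expR (2 * y) <= expR (2 / s * X t w) + expR (- (2 / s) * X t w).
    have := expR_normr_le (2 / s * X t w); rewrite -mulNr; apply: le_trans.
    by rewrite normrM ger0_norm ?divr_ge0 ?(ltW s0)// ler_expR /y mulrAC mulrA.
  have -> : (10 * s)^-1 * (s ^+ 2 * y ^+ 2) = s / 10 * y ^+ 2.
    by field; rewrite gt_eqF.
  have c0 : 0 <= c by rewrite /c !mulr_ge0 ?expR_ge0// ltW.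
  (* Up to 5 the linear term suffices; beyond 5, y^2 <= 2 expR y and y <= 2 y - 5. *)
  have key : y ^+ 2 <= 5 * y + 2 * (expR (- 5) * expR (2 * y)).
    have [y5|y5] := leP y 5.
      apply: (@le_trans _ _ (5 * y)); first by rewrite expr2 ler_wpM2r.
      by rewrite lerDl !mulr_ge0 ?expR_ge0.
    rewrite -expRD; have := normrX_le_expR y 2.
    rewrite (_ : 2`! = 2)%N// (ger0_norm y0) => h.
    have : expR y <= expR (- 5 + 2 * y) by rewrite ler_expR; lra.
    lra.
  have : c * expR (2 * y) <= c * expR (2 / s * X t w) + c * expR (- (2 / s) * X t w).
    by rewrite -mulrDr ler_wpM2l.
  rewrite ys /c; move: key => /(ler_wpM2l (ltW s0)).
  have -> : s / 5 * expR (- 5) * expR (2 * y) =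
    s * (expR (- 5) * expR (2 * y)) / 5 by field.
  rewrite !mulrDr; lra.
have i1 : P.-integrable setT (fun w => (2^-1 * X t w)%:E).
  have := integrableZl measurableT 2^-1 (integrable_grid fbm lam_gt0 N).
  by [].
have i2 : P.-integrable setT (fun w => ((10 * s)^-1 * X t w ^+ 2)%:E).
  exact: (integrableZl measurableT (10 * s)^-1 (integrable_fbm_sqr t0)).
have i3 a : P.-integrable setT (fun w => (c * expR (a * X t w))%:E).
  exact: (integrableZl measurableT c (integrable_expR_fbm a t0)).
have i33 := integrableD measurableT (i3 (2 / s)) (i3 (- (2 / s))).
have i233 := integrableB measurableT i2 i33.
have ig : P.-integrable setT (fun w => (g w)%:E).
  exact: (integrableD measurableT i1 i233).
apply: (@le_trans _ _ (\int[P]_w g w)); last first.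
  by apply: le_Rintegral => //; exact: (integrable_runmax_grid fbm lam_gt0).
rewrite /g (RintegralD measurableT i1 i233) (RintegralB measurableT i2 i33).
rewrite (RintegralD measurableT (i3 _) (i3 _)).
rewrite (RintegralZl _ measurableT (integrable_grid fbm lam_gt0 N)).
rewrite (RintegralZl _ measurableT (integrable_fbm_sqr t0)).
rewrite !(RintegralZl _ measurableT (integrable_expR_fbm _ t0)).
rewrite (Rintegral_grid fbm lam_gt0 N) Rintegral_fbm_sqr// !Rintegral_expR_fbm//.
have -> : (2 / s * t `^ H) ^+ 2 / 2 = 2 by rewrite -/s; field; rewrite gt_eqF.
have -> : (- (2 / s) * t `^ H) ^+ 2 / 2 = 2 by rewrite -/s; field; rewrite gt_eqF.
rewrite -/s mulr0 add0r.
have -> : (10 * s)^-1 * s ^+ 2 = s / 10 by field; rewrite gt_eqF.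
have -> : c * expR 2 = s / 5 * expR (- 3).
  by rewrite /c -mulrA -expRD; congr (_ * expR _); ring.
have := ler_wpM2l (ltW s0) e3; rewrite mulr1; lra.
Qed.

End expected_running_max_bounds.

(** * Comparison of the covariances of X at different times *)

Section fbm_cov_bounds.
Context {R : realType} (H : R) (H_gt0 : 0 < H) (H_lt1 : H < 1).
Local Notation K := (fbm_cov H).
Local Notation p := (2 * H).

Let p_gt0 : 0 < p. Proof. by rewrite mulr_gt0. Qed.
Let p_le2 : p <= 2. Proof. by have := H_lt1; lra. Qed.

(** The exponent of decay in l of K(q, t) / K(l, t), uniformly in t >= l. For large t the covariance
    K(q, t) behaves like q t^(p-1) if p > 1, which gives the ratio q / l, and like q^p if p <= 1,
    which gives (q / l)^p. *)
Definition cov_exp : R := Num.min 1 p.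
Local Notation mu := cov_exp.

Let mu_le_p : mu <= p. Proof. by rewrite ge_min lexx orbT. Qed.

Lemma fbm_covE (s t : R) : 0 <= s -> s <= t ->
  K s t = (s `^ p + t `^ p - (t - s) `^ p) / 2.
Proof.
move=> s0 st; have t0 := le_trans s0 st.
by rewrite /fbm_cov !ger0_norm ?subr_ge0.
Qed.

Lemma fbm_cov_ge (l t : R) : 0 <= l -> l <= t -> l `^ p / 2 <= K l t.
Proof.
move=> l0 lt; rewrite fbm_covE// ler_pM2r ?invr_gt0// -addrA lerDl subr_ge0.
by rewrite ge0_ler_powR ?nnegrE ?(ltW p_gt0) ?subr_ge0 ?(le_trans l0 lt)// lerBlDr lerDl.
Qed.

Lemma fbm_cov_ge0 (s t : R) : 0 <= s -> 0 <= t -> 0 <= K s t.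
Proof.
move=> s0 t0; have [st|ts] := leP s t.
  by apply: le_trans (fbm_cov_ge s0 st); rewrite divr_ge0 ?powR_ge0.
by rewrite fbm_covC; apply: le_trans (fbm_cov_ge t0 (ltW ts)); rewrite divr_ge0 ?powR_ge0.
Qed.

Lemma fbm_cov_le1 (s t : R) : 0 <= s -> s <= 1 -> 1 <= t -> K s t <= K 1 t.
Proof.
move=> s0 s1 t1; rewrite !fbm_covE// ?(le_trans s1)// ler_pM2r ?invr_gt0//.
have h1 : s `^ p <= 1 `^ p by rewrite ge0_ler_powR ?nnegrE ?(ltW p_gt0).
have h2 : (t - 1) `^ p <= (t - s) `^ p.
  by rewrite ge0_ler_powR ?nnegrE ?(ltW p_gt0) ?subr_ge0 ?(le_trans s1)// lerD2l lerN2.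
by rewrite lerB// lerD2r.
Qed.

Let powR_split (s t : R) : 0 <= s -> s < t ->
  (t - s) `^ p = t `^ p * (1 - s / t) `^ p.
Proof.
move=> s0 st; have t0 := le_lt_trans s0 st.
rewrite -powRM ?(ltW t0) ?subr_ge0 ?ler_pdivrMr ?mul1r ?(ltW st)//.
by rewrite mulrBr mulr1 mulrCA divff ?mulr1// gt_eqF.
Qed.

(** For q < t this rests on subadditivity of the power p <= 1, obtained from x^p >= x on (0, 1] at x
    = q / t and at 1 - q / t. *)
Let fbm_cov_le (q t : R) : 0 < q -> 0 < t -> (t <= q) || (p <= 1) -> K q t <= q `^ p.
Proof.
move=> q0 t0; have [tq _|qt /= p1] := leP t q.
  rewrite fbm_covC fbm_covE// ?(ltW t0)//.
  have := powR_ge0 (q - t) p.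
  have : t `^ p <= q `^ p by rewrite ge0_ler_powR ?nnegrE ?(ltW p_gt0) ?(ltW t0) ?(ltW q0).
  lra.
rewrite fbm_covE ?(ltW q0) ?(ltW qt)// powR_split ?(ltW q0)//.
set x := q / t.
have x01 : 0 < x <= 1 by rewrite divr_gt0//= ler_pdivrMr// mul1r ltW.
have y01 : 0 < 1 - x <= 1.
  by rewrite subr_gt0 ltr_pdivrMr// mul1r qt/= lerBlDr lerDl ltW// divr_gt0.
have -> : q `^ p = t `^ p * x `^ p.
  rewrite -powRM ?(ltW t0) ?divr_ge0 ?(ltW q0) ?(ltW t0)//.
  by rewrite /x mulrCA divff ?mulr1// gt_eqF.
have h1 := ger1_powR x01 p1; have h2 := ger1_powR y01 p1.
have h3 : t `^ p * 1 <= t `^ p * ((1 - x) `^ p + x `^ p).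
  by rewrite ler_wpM2l ?powR_ge0//; lra.
by rewrite mulrDr mulr1 in h3; lra.
Qed.

(** If t <= q or p <= 1, then K q t <= q^p is compared with K l t >= l^p / 2. If p > 1 and q < t,
    the inequalities 1 - 2x <= (1 - x)^p <= 1 - x bound K q t above by q^p / 2 + q t^(p-1) and K l t
    below by half of l^p + l t^(p-1), and the terms are compared one by one. *)
Lemma fbm_cov_ratio (q l t : R) : 1 <= q -> 1 <= l -> l <= t ->
  K q t <= 4 * q `^ p * l `^ (- mu) * K l t.
Proof.
move=> q1 l1 lt.
have q0 : 0 < q by apply: lt_le_trans q1.
have l0 : 0 < l by apply: lt_le_trans l1.
have t0 : 0 < t by apply: lt_le_trans lt.
have Kge := fbm_cov_ge (ltW l0) lt.
have [h|] := boolP ((t <= q) || (p <= 1)).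
  apply: le_trans (fbm_cov_le q0 t0 h) _.
  have e1 : 1 <= l `^ (- mu) * l `^ p.
    rewrite -powRD; last by rewrite (gt_eqF l0) implybT.
    by rewrite -[leLHS](powRr0 l) ler_powR// addrC subr_ge0.
  have e2 : l `^ (- mu) * (l `^ p / 2) <= l `^ (- mu) * K l t.
    by rewrite ler_wpM2l ?powR_ge0.
  have e3 : 1 <= 4 * (l `^ (- mu) * K l t) by lra.
  by rewrite (mulrC 4) -2!mulrA (mulrCA 4) ler_peMr ?powR_ge0//; lra.
rewrite negb_or -!ltNge => /andP[qt p1].
have muE : mu = 1 by rewrite /cov_exp min_l// ltW.
rewrite muE powR_inv1 ?(ltW l0)//.
have tp0 : 0 <= t `^ p / t by rewrite divr_ge0 ?powR_ge0 ?(ltW t0).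
have up : K q t <= q `^ p / 2 + q * (t `^ p / t).
  rewrite fbm_covE ?(ltW q0) ?(ltW qt)// powR_split ?(ltW q0)//.
  set x := q / t.
  have y01 : 0 < 1 - x <= 1.
    by rewrite subr_gt0 ltr_pdivrMr// mul1r qt/= lerBlDr lerDl ltW// divr_gt0.
  have h2 : (1 - x) ^+ 2 <= (1 - x) `^ p.
    have /andP[y0 _] := y01.
    by rewrite -powR_mulrn ?(ltW y0)// ger_powR.
  have h3 : t `^ p * (1 - 2 * x) <= t `^ p * (1 - x) `^ p.
    by rewrite ler_wpM2l ?powR_ge0//; have := sqr_ge0 x; rewrite sqrrB in h2; lra.
  have -> : q * (t `^ p / t) = t `^ p * x by rewrite /x; ring.
  by rewrite mulrBr mulr1 (mulrCA _ 2) in h3; lra.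
have lo : l `^ p / 2 + l * (t `^ p / t) / 2 <= K l t.
  rewrite fbm_covE ?(ltW l0)//.
  move: lt; rewrite le_eqVlt => /predU1P[lt|lt].
    rewrite lt subrr powR0 ?gt_eqF// mulrCA divff ?gt_eqF// mulr1; lra.
  rewrite powR_split ?(ltW l0)//.
  set x := l / t.
  have y01 : 0 < 1 - x <= 1.
    by rewrite subr_gt0 ltr_pdivrMr// mul1r lt/= lerBlDr lerDl ltW// divr_gt0.
  have h2 := ge1r_powR y01 (ltW p1).
  have h3 : t `^ p * (1 - x) `^ p <= t `^ p * (1 - x) by rewrite ler_wpM2l ?powR_ge0.
  have -> : l * (t `^ p / t) = t `^ p * x by rewrite /x; ring.
  by rewrite mulrBr mulr1 in h3; lra.
have qp : q <= q `^ p by apply: le1r_powR => //; exact: ltW.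
have lp : l <= l `^ p by apply: le1r_powR => //; exact: ltW.
apply: (@le_trans _ _ (4 * q `^ p * l^-1 * (l `^ p / 2 + l * (t `^ p / t) / 2))); last first.
  by rewrite ler_wpM2l// !mulr_ge0 ?powR_ge0 ?invr_ge0 ?(ltW l0).
apply: (le_trans up).
have -> : 4 * q `^ p * l^-1 * (l `^ p / 2 + l * (t `^ p / t) / 2) =
  2 * (q `^ p * (l `^ p / l)) + 2 * (q `^ p * (t `^ p / t)).
  by field; rewrite !gt_eqF.
have a1 : q * (t `^ p / t) <= q `^ p * (t `^ p / t) by rewrite ler_wpM2r.
have a2 : q `^ p <= q `^ p * (l `^ p / l).
  by rewrite ler_peMr ?powR_ge0// ler_pdivlMr// mul1r.
have a3 : 0 <= q `^ p * (t `^ p / t) by rewrite mulr_ge0 ?powR_ge0.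
have a4 := powR_ge0 q p.
lra.
Qed.

End fbm_cov_bounds.

(** * Order of the mean negative part, and shifts of the barrier *)

Section one_sided_exit.
Context {R : realType} (H : R) (H_gt0 : 0 < H) (H_lt1 : H < 1).
Context d (Omega : measurableType d) (P : probability Omega R).
Variable X : R -> {RV P >-> R}.
Hypothesis fbm : fractional_brownian_motion H X.

Lemma integrable_orthant n (Y : nat -> Omega -> R) r :
  (forall i, measurable_fun setT (Y i)) ->
  P.-integrable setT (fun w => (orthant n Y r w)%:E).
Proof.
move=> mY; have i1 : P.-integrable setT (fun=> (1 : R)%:E).
  exact: finite_measure_integrable_cst.
apply: le_integrable i1 => //.
  by apply/measurable_EFinP; exact: measurable_orthant.
move=> w _; rewrite /= lee_fin normr1 ger0_norm ?orthant_ge0//.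
by rewrite orthantE lern1 leq_b1.
Qed.

Lemma orthant_homo n (Y : nat -> Omega -> R) r r' w :
  (forall i, (i < n)%N -> r i <= r' i) -> orthant n Y r w <= orthant n Y r' w.
Proof.
move=> rr'; rewrite !orthantE; case: allP => [h|_]; last by rewrite ler0n.
rewrite (_ : all _ _ = true)//; apply/allP => i ilt.
by apply: le_trans (h i ilt) _; apply: rr'; rewrite mem_index_iota in ilt.
Qed.

Lemma Rintegral_cameron_martin (z : seq (R * R)) n (t r : nat -> R) :
  nonneg_times z -> (forall i, 0 <= t i) ->
  \int[P]_w (expR (lin X z w) * orthant n (fun i => X (t i)) r w) =
  expR (lin_cov H z z / 2) *
  \int[P]_w (orthant n (fun i => X (t i))
                (fun i => r i - lin_cov H z [:: (1, t i)]) w).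
Proof.
move=> z0 t0; rewrite /Rintegral (fbm_cameron_martin fbm)// fineM//.
apply: integrable_fin_num => //; apply: integrable_orthant => i.
exact: measurable_funPT.
Qed.

Lemma integrable_expR_orthant (z : seq (R * R)) n (Y : nat -> Omega -> R) r :
  nonneg_times z -> (forall i, measurable_fun setT (Y i)) ->
  P.-integrable setT (fun w => (expR (lin X z w) * orthant n Y r w)%:E).
Proof.
move=> z0 mY; apply: le_integrable (integrable_expR_lin fbm z0) => //.
  apply/measurable_EFinP; apply: measurable_funM; last exact: measurable_orthant.
  by apply: measurableT_comp => //; exact: measurable_lin.
move=> w _; rewrite /= lee_fin !ger0_norm ?mulr_ge0 ?expR_ge0 ?orthant_ge0//.
by rewrite ler_piMr ?expR_ge0// orthantE lern1 leq_b1.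
Qed.

Variable lam : R.
Hypothesis lam_ge1 : 0 < lam.
Local Notation emax := (emax X lam).
Local Notation eneg := (eneg X lam).
Local Notation mu := (cov_exp H).

Lemma eneg_upper n :
  eneg n <= (n.+1%:R * lam) `^ H * (2 + ln n.+1%:R) / n.+1%:R.
Proof.
rewrite ler_pdivlMr ?ltr0n// mulrC.
apply: le_trans (eneg_le_emax H_gt0 fbm lam_ge1 n) _.
exact: (emax_upper H_gt0 fbm).
Qed.

(** Concavity bounds the growth of [emax] from [N] to [m * N] by a multiple of [eneg N]. The factor
    [m] satisfies m^H >= 40 (2 + ln N), so that the lower bound for [emax (m * N)] is at least twice
    the upper bound for [emax N]. *)
Lemma eneg_lower N : (0 < N)%N ->
  (N%:R * lam) `^ H / N%:R / (2 * (40 * (2 + ln N%:R)) `^ H^-1) <= eneg N.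
Proof.
move=> N0; set s := (N%:R * lam) `^ H; set l := 2 + ln N%:R.
have N1 : 1 <= N%:R :> R by rewrite ler1n.
have l2 : 2 <= l by rewrite lerDl ln_ge0.
have s0 : 0 < s by rewrite powR_gt0// mulr_gt0// ltr0n.
set y := (40 * l) `^ H^-1.
have y1 : 1 <= y.
  by rewrite -(powRr0 (40 * l)) ler_powR ?invr_ge0 ?(ltW H_gt0)//; lra.
pose m := (Num.truncn y).+1.
have y0 : 0 <= y by apply: le_trans y1.
have ym : y <= m%:R by rewrite ltW// truncnS_gt.
have my : m%:R <= 2 * y.
  by rewrite /m -natr1; have := truncn_le y; rewrite y0; lra.
have m0 : (0 : R) < m%:R by rewrite ltr0n.
have mN0 : (0 < m * N)%N by rewrite muln_gt0 N0.
have lo := emax_lower H_gt0 fbm lam_ge1 mN0.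
have up := emax_upper H_gt0 fbm lam_ge1 N0.
have df := emax_diff_le H_gt0 fbm lam_ge1 (leq_pmull N (ltn0Sn _ : (0 < m)%N)).
have mH : 40 * l <= m%:R `^ H.
  have -> : 40 * l = y `^ H.
    rewrite /y -powRrM mulVf ?gt_eqF// powRr1//; lra.
  by rewrite ge0_ler_powR ?nnegrE ?(ltW H_gt0)// ltW.
have e1 : ((m * N)%:R * lam) `^ H = m%:R `^ H * s.
  by rewrite natrM -mulrA powRM ?mulr_ge0 ?(ltW lam_ge1).
rewrite e1 in lo.
have h1 : 40 * l * s <= m%:R `^ H * s by rewrite ler_wpM2r ?(ltW s0).
have h2 : s * l <= (m * N)%:R * eneg N.
  apply: le_trans df; rewrite -/s -/l in up; lra.
have h3 : s <= 2 * y * N%:R * eneg N.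
  apply: (@le_trans _ _ ((m * N)%:R * eneg N)).
    by apply: le_trans h2; rewrite ler_peMr ?(ltW s0)//; lra.
  rewrite natrM; apply: (ler_wpM2r (eneg_ge0 X lam N)).
  exact: (ler_wpM2r (ler0n _ N)).
rewrite -mulrA -invfM ler_pdivrMr ?mulr_gt0 ?ltr0n//; last by rewrite (lt_le_trans ltr01).
by apply: le_trans h3 _; rewrite le_eqVlt; apply/orP; left; apply/eqP; ring.
Qed.

(* Tilting by a multiple of [X lam] pushes the barrier below -1 on the whole grid;
   the tilt is harmless unless [X lam] is very negative. *)
Lemma grid_shift_bound n (r : nat -> R) (a b v : R) :
  0 <= a -> 0 <= b -> 0 < v -> v <= 1 ->
  (2 * (1 + a) * lam `^ (- (2 * H)) + b * lam `^ (- mu)) * lam `^ H <= v ->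
  (forall i, (i < n.+1)%N ->
     r i <= a + b * lam `^ (- mu) * fbm_cov H lam (i.+1%:R * lam)) ->
  \int[P]_w (orthant n.+1 (grid X lam) r w) <=
    expR 2 * eneg n + expR (- (2 * v ^+ 2)^-1).
Proof.
move=> a0 b0 v0 v1; set be := _ + _ => bv ra.
have be0 : 0 <= be by rewrite addr_ge0 ?mulr_ge0 ?powR_ge0// addr_ge0.
have n1 c : nonneg_times [:: (c, lam)] by rewrite /nonneg_times/= ltW.
pose z := [:: (be, lam)].
have mg i : measurable_fun setT (grid X lam i) by exact: measurable_grid.
have t0 i : 0 <= i.+1%:R * lam by rewrite mulr_ge0// ltW.
have gE i : lin_cov H z [:: (1, i.+1%:R * lam)] = be * fbm_cov H lam (i.+1%:R * lam).
  by rewrite /lin_cov !big_seq1/= mulr1.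
(* On the grid K lam t >= lam^(2H) / 2, so the first summand of [be] lowers the barrier by at least
   1 + a; the second cancels the part of [r] proportional to K lam t. *)
have rg i : (i < n.+1)%N -> r i - lin_cov H z [:: (1, i.+1%:R * lam)] <= -1.
  move=> /ra hr; rewrite gE.
  have lt : lam <= i.+1%:R * lam by rewrite ler_peMl ?ler1n// ltW.
  have kge := fbm_cov_ge H_gt0 (ltW lam_ge1) lt.
  have : 1 + a <= 2 * (1 + a) * lam `^ (- (2 * H)) * fbm_cov H lam (i.+1%:R * lam).
    have c0 : 0 <= 2 * (1 + a) * lam `^ (- (2 * H)).
      by rewrite !mulr_ge0 ?powR_ge0// addr_ge0.
    apply: le_trans (ler_wpM2l c0 kge).
    rewrite powRN; have := powR_gt0 (2 * H) lam_ge1; set x := lam `^ _ => x0.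
    by rewrite le_eqVlt; apply/orP; left; apply/eqP; field; rewrite gt_eqF.
  rewrite /be mulrDl; lra.
have V1 : lin_cov H z z <= v ^+ 2.
  rewrite lin_cov1 ?(ltW lam_ge1)// lerXn2r ?nnegrE ?(ltW v0)//.
  by rewrite mulr_ge0 ?powR_ge0.
have v2 : v ^+ 2 <= 1 by rewrite -[leRHS](expr1n _ 2) lerXn2r ?nnegrE ?(ltW v0).
(* The exponent that optimizes the exponential bound for the event 1 + be X < 0, given that
   [be * X lam] has variance at most v^2. *)
pose th := (v ^+ 2)^-1.
have th0 : 0 < th by rewrite invr_gt0 exprn_gt0.
have pw w : orthant n.+1 (grid X lam) r w <=
    expR 1 * (expR (lin X z w) * orthant n.+1 (grid X lam) r w) +
    expR (- th) * expR (lin X [:: (- (th * be), lam)] w).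
  have o0 := orthant_ge0 n.+1 (grid X lam) r w.
  have o1 : orthant n.+1 (grid X lam) r w <= 1 by rewrite orthantE lern1 leq_b1.
  rewrite mulrA -!expRD /lin !big_seq1/=; set y := X lam w.
  have [h|h] := leP 0 (1 + be * y).
    apply: (@le_trans _ _ (expR (1 + be * y) * orthant n.+1 (grid X lam) r w)).
      by rewrite ler_peMl// -[leLHS]expR0 ler_expR.
    by rewrite lerDl expR_ge0.
  apply: (le_trans o1); apply: (@le_trans _ _ (expR (- th + - (th * be) * y))).
    rewrite -[leLHS]expR0 ler_expR.
    have -> : - th + - (th * be) * y = th * (- (1 + be * y)) by ring.
    by rewrite mulr_ge0 ?(ltW th0)//; lra.
  by rewrite lerDr mulr_ge0 ?expR_ge0.
have i0 : P.-integrable setT (fun w => (orthant n.+1 (grid X lam) r w)%:E).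
  exact: integrable_orthant.
have i1 : P.-integrable setT
    (fun w => (expR (lin X z w) * orthant n.+1 (grid X lam) r w)%:E).
  exact: (integrable_expR_orthant _ _ (n1 be) mg).
have i2 : P.-integrable setT (fun w => (expR (lin X [:: (- (th * be), lam)] w))%:E).
  exact: (integrable_expR_lin fbm (n1 _)).
have j1 := integrableZl measurableT (expR 1) i1.
have j2 := integrableZl measurableT (expR (- th)) i2.
apply: (@le_trans _ _ (\int[P]_w (
    expR 1 * (expR (lin X z w) * orthant n.+1 (grid X lam) r w) +
    expR (- th) * expR (lin X [:: (- (th * be), lam)] w)))).
  by apply: le_Rintegral => //; exact: (integrableD measurableT j1 j2).
rewrite (RintegralD measurableT j1 j2) (RintegralZl _ measurableT i1).
rewrite (RintegralZl _ measurableT i2); apply: lerD.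
  rewrite (Rintegral_cameron_martin n.+1 r (n1 be) t0).
  apply: (@le_trans _ _ (expR 1 * (expR (1 / 2) * eneg n))).
    rewrite ler_wpM2l ?expR_ge0//; apply: ler_pM; rewrite ?expR_ge0//.
    - by apply: Rintegral_ge0 => w _; exact: orthant_ge0.
    - by rewrite ler_expR; lra.
    - apply: le_Rintegral => //.
      + by apply: integrable_orthant => i; exact: mg.
      + exact: (integrable_gridneg fbm lam_ge1).
      + move=> w _; apply: le_trans (orthant_le_gridneg X lam n w).
        exact: orthant_homo.
  rewrite mulrA -expRD ler_wpM2r ?eneg_ge0//.
  by rewrite ler_expR; lra.
have := mgf_lin fbm (n1 (- (th * be))); rewrite lin_cov1 ?(ltW lam_ge1)// => e.
rewrite /Rintegral e /= -expRD ler_expR.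
have hV : (be * lam `^ H) ^+ 2 <= v ^+ 2 by rewrite -lin_cov1// ltW.
have tv : th * v ^+ 2 = 1 by rewrite mulVf// gt_eqF// exprn_gt0.
have h1 : th ^+ 2 * (be * lam `^ H) ^+ 2 <= th ^+ 2 * v ^+ 2.
  by rewrite ler_wpM2l// sqr_ge0.
have h2 : th ^+ 2 * v ^+ 2 = th by rewrite expr2 -mulrA tv mulr1.
have -> : (- (th * be) * lam `^ H) ^+ 2 = th ^+ 2 * (be * lam `^ H) ^+ 2 by ring.
have -> : (2 * v ^+ 2)^-1 = th / 2 by rewrite invfM mulrC.
lra.
Qed.

End one_sided_exit.

(** * The exponential functional over short intervals *)

Section jensen_expR.
Context {R : realType}.
Notation leb := (@lebesgue_measure R).

Lemma within_continuous_expR (D : set R) (Y : R -> R) :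
  {within D, continuous Y} -> {within D, continuous (fun s => expR (Y s))}.
Proof.
move=> cY x; apply: (@continuous_comp _ _ _ (Y : subspace D -> R) expR).
  exact: cY.
exact: continuous_expR.
Qed.

Lemma within_continuousZ (D : set R) (Y : R -> R) (a : R) :
  {within D, continuous Y} -> {within D, continuous (fun s => a * Y s)}.
Proof. by move=> cY x; apply: cvgM; [exact: cvg_cst|exact: cY]. Qed.

Lemma within_continuousD (D : set R) (Y : R -> R) (c : R) :
  {within D, continuous Y} -> {within D, continuous (fun s => Y s + c)}.
Proof. by move=> cY x; apply: cvgD; [exact: cY|exact: cvg_cst]. Qed.

Lemma integrable_within_continuous (a b : R) (f : R -> R) :
  {within `[a, b], continuous f} -> leb.-integrable `[a, b] (EFin \o f).
Proof.
by move=> cf; apply: continuous_compact_integrable => //; exact: segment_compact.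
Qed.

Lemma Rintegral_cst_itv (a b c : R) : a <= b ->
  \int[leb]_(s in `[a, b]) c = c * (b - a).
Proof.
move=> ab; rewrite Rintegral_cst//= lebesgue_measure_itv/= lte_fin.
by move: ab; rewrite le_eqVlt => /predU1P[->|->]; rewrite ?ltxx ?subrr//= mulr0.
Qed.

Let affine_integral (a b k : R) (Y : R -> R) : a <= b ->
  {within `[a, b], continuous Y} ->
  leb.-integrable `[a, b] (fun s => (1 + k * (expR (Y s) - 1))%:E) /\
  \int[leb]_(s in `[a, b]) (1 + k * (expR (Y s) - 1)) =
  (b - a) + k * (\int[leb]_(s in `[a, b]) expR (Y s) - (b - a)).
Proof.
move=> ab cY.
have cE : {within `[a, b], continuous (fun s => expR (Y s))}.
  exact: within_continuous_expR.
have i1 := integrable_within_continuous cE.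
have ic (c : R) : leb.-integrable `[a, b] (EFin \o (fun=> c)).
  by apply: integrable_within_continuous => x; exact: cvg_cst.
have mD : measurable (`[a, b]%classic : set (measurableTypeR R)) by exact: measurable_itv.
have iB := integrableB mD i1 (ic 1).
have iZ := integrableZl mD k iB.
split; first exact: (integrableD mD (ic 1) iZ).
rewrite (RintegralD mD (ic 1) iZ) (RintegralZl _ mD iB) (RintegralB mD i1 (ic 1)).
by rewrite !Rintegral_cst_itv// mul1r.
Qed.

(* Tangent line inequalities: x^(-k) >= 1 - k (x - 1) and, for k >= 1,
   x^k >= 1 + k (x - 1), at x = expR y. *)
Lemma jensen_expR_neg (a b k : R) (Y : R -> R) : a <= b -> 0 <= k ->
  {within `[a, b], continuous Y} ->
  \int[leb]_(s in `[a, b]) expR (Y s) <= b - a ->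
  b - a <= \int[leb]_(s in `[a, b]) expR (- k * Y s).
Proof.
move=> ab k0 cY h; have [i1 e1] := affine_integral (- k) ab cY.
apply: (@le_trans _ _ (\int[leb]_(s in `[a, b]) (1 + - k * (expR (Y s) - 1)))).
  by rewrite e1 lerDl mulNr oppr_ge0 mulr_ge0_le0// subr_le0.
apply: le_Rintegral => //.
  apply: integrable_within_continuous; apply: within_continuous_expR.
  exact: within_continuousZ.
move=> s _; have h1 := expR_ge1Dx (- k * Y s).
have : k * Y s <= k * (expR (Y s) - 1).
  by rewrite ler_wpM2l//; have := expR_ge1Dx (Y s); lra.
lra.
Qed.

Lemma jensen_expR_pos (a b k : R) (Y : R -> R) : a <= b -> 1 <= k ->
  {within `[a, b], continuous Y} ->
  b - a <= \int[leb]_(s in `[a, b]) expR (Y s) ->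
  b - a <= \int[leb]_(s in `[a, b]) expR (k * Y s).
Proof.
move=> ab k1 cY h; have [i1 e1] := affine_integral k ab cY.
apply: (@le_trans _ _ (\int[leb]_(s in `[a, b]) (1 + k * (expR (Y s) - 1)))).
  by rewrite e1 lerDl mulr_ge0 ?subr_ge0//; lra.
apply: le_Rintegral => //.
  apply: integrable_within_continuous; apply: within_continuous_expR.
  exact: within_continuousZ.
move=> s _; set y := Y s.
have e0 := expR_gt0 y.
have h1 : expR y * (1 + (k - 1) * y) <= expR (k * y).
  have -> : k * y = y + (k - 1) * y by ring.
  by rewrite expRD ler_pM2l// expR_ge1Dx.
have h2 : (k - 1) * (expR y - 1) <= (k - 1) * (y * expR y).
  by rewrite ler_wpM2l ?subr_ge0// expRB1_le.
lra.
Qed.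

End jensen_expR.

(** * Joint measurability, Tonelli's theorem and short-interval estimates *)

Section fbm_paths.
Context {R : realType} (H : R) (H_gt0 : 0 < H) (H_lt1 : H < 1).
Context d (Omega : measurableType d) (P : probability Omega R).
Variable X : R -> {RV P >-> R}.
Hypothesis fbm : fractional_brownian_motion H X.
Notation leb := (@lebesgue_measure R).

(* Continuity of the paths is only known on the half-line, hence the cut-off. *)
Definition fbm_pos (z : measurableTypeR R * Omega) : R :=
  \1_(`[0, +oo[ : set R) z.1 * X z.1 z.2.

Lemma fbm_posE s w : 0 <= s -> fbm_pos (s, w) = X s w.
Proof. by move=> s0; rewrite /fbm_pos/= indicE mem_set ?mul1r//= in_itv/= s0. Qed.

(** Left-endpoint approximation with mesh 1/(n+1) on [0, n+1), hence (n+1)^2 cells. It is jointly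
    measurable, and continuity of the paths identifies the limit as [fbm_pos]. *)
Let step n (z : measurableTypeR R * Omega) : R :=
  \sum_(0 <= k < n.+1 * n.+1)
    \1_(`[k%:R / n.+1%:R, k.+1%:R / n.+1%:R[ : set R) z.1 *
    X (k%:R / n.+1%:R) z.2.

Let measurable_step n : measurable_fun setT (step n).
Proof.
apply: measurable_sum => k; apply: measurable_funM.
  have m1 : measurable_fun setT (\1_(`[k%:R / n.+1%:R, k.+1%:R / n.+1%:R[) :
      measurableTypeR R -> R).
    by apply: measurable_indic; exact: measurable_itv.
  exact: (measurableT_comp m1 measurable_fst).
by apply: measurableT_comp => //; exact: measurable_funPT.
Qed.

Let stepE n s w : 0 <= s -> s < n.+1%:R ->
  step n (s, w) = X ((Num.truncn (s * n.+1%:R))%:R / n.+1%:R) w.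
Proof.
move=> s0 sn; have n0 : 0 < n.+1%:R :> R by rewrite ltr0n.
have sn0 : 0 <= s * n.+1%:R by rewrite mulr_ge0// ltW.
set m := Num.truncn _.
have hm : m%:R <= s * n.+1%:R by rewrite truncn_le.
have hm1 : s * n.+1%:R < m.+1%:R by exact: truncnS_gt.
have mlt : (m < n.+1 * n.+1)%N.
  by rewrite -(ltr_nat R) (le_lt_trans hm)// natrM ltr_pM2r.
rewrite /step big_mkord (bigD1 (Ordinal mlt))//= indicE mem_set ?mul1r; last first.
  by rewrite /= in_itv/= ler_pdivrMr// hm ltr_pdivlMr.
rewrite big1 ?addr0// => k /eqP km; rewrite indicE memNset ?mul0r//=.
rewrite in_itv/= ler_pdivrMr// ltr_pdivlMr// => /andP[h1 h2].
apply: km; apply/val_inj => /=; apply/eqP; rewrite eqn_leq; apply/andP; split.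
  by rewrite -ltnS -(ltr_nat R) (le_lt_trans h1).
by rewrite -ltnS -(ltr_nat R) (le_lt_trans hm).
Qed.

Lemma measurable_fbm_pos : measurable_fun setT fbm_pos.
Proof.
apply: (@measurable_fun_cvg _ _ _ _ step) => // -[s w] _.
have [s0|s0] := ltP s 0.
  have -> : fbm_pos (s, w) = 0.
    by rewrite /fbm_pos/= indicE memNset ?mul0r//= in_itv/= leNgt s0.
  apply: cvg_near_cst; apply: nearW => n; rewrite /step big1// => k _.
  rewrite indicE memNset ?mul0r//= in_itv/= => /andP[h _].
  have : 0 <= k%:R / n.+1%:R :> R by rewrite divr_ge0.
  by move=> /le_trans /(_ h); rewrite leNgt s0.
rewrite fbm_posE//.
pose t n := (Num.truncn (s * n.+1%:R))%:R / n.+1%:R : R.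
have t0 n : 0 <= t n by rewrite divr_ge0.
have tc : t n @[n --> \oo] --> s.
  apply: (@squeeze_cvgr _ _ _ _ (fun n => s - n.+1%:R^-1) (fun=> s)).
  - apply: nearW => n; have n0 : 0 < n.+1%:R :> R by rewrite ltr0n.
    have sn0 : 0 <= s * n.+1%:R by rewrite mulr_ge0// ltW.
    rewrite /t lerBlDr -[X in _ + X]mul1r -mulrDl natr1.
    rewrite ler_pdivlMr// ler_pdivrMr//.
    by rewrite truncn_le sn0 andbT ltW// truncnS_gt.
  - rewrite -[X in _ --> X]subr0; apply: cvgB; first exact: cvg_cst.
    exact: cvg_harmonic.
  - exact: cvg_cst.
have [_ _ _ cX] := fbm.
have XC : X (t n) w @[n --> \oo] --> X s w.
  have /subspace_continuousP/(_ s) := cX w.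
  rewrite /= in_itv/= s0 => /(_ isT) h.
  apply: (cvg_comp t (fun u => X u w) _ h).
  move=> A [/= e e0 eA].
  have /cvgrPdist_lt/(_ e e0) := tc.
  apply: filterS => n hn; apply: eA => //=.
  by rewrite in_itv/= t0.
apply: cvg_trans XC; apply: near_eq_cvg.
near=> n; rewrite stepE//.
near: n; exists (Num.truncn s).+1 => // n /= hn.
apply: (lt_le_trans (truncnS_gt _)).
by rewrite ler_nat (leq_trans hn).
Unshelve. all: by end_near. Qed.

End fbm_paths.

Section fbm_tonelli.
Context {R : realType} (H : R) (H_gt0 : 0 < H) (H_lt1 : H < 1).
Context d (Omega : measurableType d) (P : probability Omega R).
Variable X : R -> {RV P >-> R}.
Hypothesis fbm : fractional_brownian_motion H X.
Notation leb := (@lebesgue_measure R).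

Definition expint (a b : R) (w : Omega) : R :=
  \int[leb]_(s in `[a, b]) expR (X s w).

Lemma continuous_path w a b : 0 <= a -> {within `[a, b], continuous (fun s => X s w)}.
Proof.
move=> a0; have [_ _ _ cX] := fbm.
apply: continuous_subspaceW (cX w) => s /=.
by rewrite !in_itv/= andbT => /andP[/(le_trans a0)].
Qed.

Section tonelli.
Variables (a b c : R) (g h : Omega -> R).
Hypotheses (a0 : 0 <= a) (mg : measurable_fun setT g) (mh : measurable_fun setT h).
Hypothesis h0 : forall w, 0 <= h w.

Let F (z : measurableTypeR R * Omega) : \bar R :=
  (\1_(`[a, b] : set R) z.1 * (h z.2 * expR (c * fbm_pos X z + g z.2)))%:E.

Let mF : measurable_fun setT F.
Proof.
apply/measurable_EFinP; apply: measurable_funM.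
  have m1 : measurable_fun setT (\1_(`[a, b]) : measurableTypeR R -> R).
    by apply: measurable_indic; exact: measurable_itv.
  exact: (measurableT_comp m1 measurable_fst).
apply: measurable_funM; first exact: (measurableT_comp mh measurable_snd).
apply: measurableT_comp => //; apply: measurable_funD.
  by apply: measurable_funM => //; exact: (measurable_fbm_pos fbm).
exact: (measurableT_comp mg measurable_snd).
Qed.

Let F0 z : (0 <= F z)%E.
Proof. by rewrite lee_fin mulr_ge0// mulr_ge0// expR_ge0. Qed.

Let F_in s w : s \in `[a, b]%classic -> F (s, w) = (h w * expR (c * X s w + g w))%:E.
Proof.
rewrite inE /= in_itv/= => /andP[sa sb].
by rewrite /F/= indicE mem_set/= ?in_itv/= ?sa// mul1r fbm_posE// (le_trans a0).
Qed.

Let F_out s w : s \notin `[a, b]%classic -> F (s, w) = 0%E.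
Proof. by move=> /negbTE sD; rewrite /F/= indicE sD mul0r. Qed.

Let integrable_path w :
  leb.-integrable `[a, b] (EFin \o (fun s => expR (c * X s w + g w))).
Proof.
apply: integrable_within_continuous; apply: within_continuous_expR.
apply: within_continuousD; apply: within_continuousZ; exact: continuous_path.
Qed.

Let innerE w : (h w * \int[leb]_(s in `[a, b]) expR (c * X s w + g w))%:E =
  (\int[leb]_s F (s, w))%E.
Proof.
have mD : measurable (`[a, b]%classic : set (measurableTypeR R)) by exact: measurable_itv.
rewrite -(RintegralZl _ mD (integrable_path w)).
rewrite /Rintegral fineK; last first.
  exact: integrable_fin_num (integrableZl mD (h w) (integrable_path w)).
rewrite integral_mkcond; apply: eq_integral => s _.
rewrite patchE; case: ifPn => sD; first by rewrite F_in.
by rewrite F_out.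
Qed.

Lemma measurable_weighted_integral : measurable_fun setT
  (fun w => h w * \int[leb]_(s in `[a, b]) expR (c * X s w + g w)).
Proof.
apply/measurable_EFinP; rewrite (_ : _ \o _ = fun w => \int[leb]_s F (s, w))%E.
  exact: (@measurable_fun_fubini_tonelli_G _ _ _ _ _ leb F mF F0).
by apply/funext => w; rewrite /= innerE.
Qed.

Lemma fbm_fubini_tonelli :
  (\int[P]_w (h w * \int[leb]_(s in `[a, b]) expR (c * X s w + g w))%:E =
   \int[leb]_(s in `[a, b]) \int[P]_w (h w * expR (c * X s w + g w))%:E)%E.
Proof.
under eq_integral do rewrite innerE.
rewrite -(@fubini_tonelli _ _ _ _ _ leb P F mF F0).
rewrite [RHS]integral_mkcond; apply: eq_integral => s _.
rewrite patchE; case: ifPn => sD.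
  by apply: eq_integral => w _; rewrite F_in.
by under eq_integral do rewrite F_out//; rewrite integral0.
Qed.

Lemma fbm_fubini_tonelli_le (B : R) : a <= b -> 0 <= B ->
  (forall s : R, (a <= s <= b)%R ->
     \int[P]_w (h w * expR (c * X s w + g w))%:E <= B%:E)%E ->
  (\int[P]_w (h w * \int[leb]_(s in `[a, b]) expR (c * X s w + g w))%:E <=
   ((b - a) * B)%:E)%E.
Proof.
move=> ab B0 hB; rewrite fbm_fubini_tonelli.
have mD : measurable (`[a, b]%classic : set (measurableTypeR R)) by exact: measurable_itv.
apply: (@le_trans _ _ (\int[leb]_(s in `[a, b]) B%:E)%E); last first.
  rewrite integral_cst//= lebesgue_measure_itv/= lte_fin.
  move: ab; rewrite le_eqVlt => /predU1P[->|->].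
    by rewrite ltxx subrr mul0r mule0.
  by rewrite -EFinB -EFinM mulrC.
apply: ge0_le_integral => //.
- by move=> s _; apply: integral_ge0 => w _; rewrite lee_fin mulr_ge0// expR_ge0.
- have mG := @measurable_fun_fubini_tonelli_F _ _ _ _ _ P F mF F0.
  apply: (eq_measurable_fun (fubini_F P F)); last exact: measurable_funTS.
  by move=> s sD; apply: eq_integral => w _; rewrite F_in.
Qed.

End tonelli.

Lemma measurable_expint (a b : R) : 0 <= a -> measurable_fun setT (expint a b).
Proof.
move=> a0; have := @measurable_weighted_integral a b 1 (cst 0) (cst 1) a0
  (measurable_cst _) (measurable_cst _) (fun=> ler01).
congr (measurable_fun _ _); apply/funext => w; rewrite /= mul1r /expint.
by apply: eq_Rintegral => s _; rewrite mul1r addr0.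
Qed.

Lemma mgf_increment (c s t : R) : 0 <= t -> t <= s ->
  (\int[P]_w (expR (c * (X s w - X t w)))%:E =
   (expR ((c * (s - t) `^ H) ^+ 2 / 2))%:E)%E.
Proof.
move=> t0 ts; have s0 := le_trans t0 ts.
have n1 : nonneg_times [:: (c, s); (- c, t)] by rewrite /nonneg_times/= s0 t0.
have := mgf_lin fbm n1.
have -> : lin_cov H [:: (c, s); (- c, t)] [:: (c, s); (- c, t)] =
    (c * (s - t) `^ H) ^+ 2.
  rewrite /lin_cov !big_cons !big_nil/= !fbm_cov_diag// (fbm_covC _ s t) fbm_covE//.
  have st0 : 0 <= s - t by rewrite subr_ge0.
  rewrite exprMn !(mulrC 2 H) !powRrM !powR_mulrn ?powR_ge0//.
  by field.
move=> <-; apply: eq_integral => w _; rewrite /lin !big_cons big_nil/=.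
by congr ((expR _)%:E); ring.
Qed.

Section regularity.
Variables (t eta theta : R).
Hypotheses (t0 : 0 <= t) (eta0 : 0 < eta) (theta0 : 0 <= theta).

(** Markov's inequality for the average over the interval. Tonelli reduces its expectation to the
    increments X s - X t, whose standard deviation is at most eta^H. *)
Let tail_bound (c e : R) (A : Omega -> bool) : `|c| = theta ->
  measurable_fun setT (fun w => (A w)%:R : R) ->
  (forall w, A w ->
    eta <= \int[leb]_(s in `[t, t + eta]) expR (c * X s w + (e - c * X t w))) ->
  (\int[P]_w ((A w)%:R)%:E <= (expR (e + (theta * eta `^ H) ^+ 2 / 2))%:E)%E.
Proof.
move=> ct mA hA.
have mX s : measurable_fun setT (X s) by exact: measurable_funPT.
pose g w := e - c * X t w.
have mg : measurable_fun setT g.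
  by apply: measurable_funB => //; exact: measurable_funM.
have mI := @measurable_weighted_integral t (t + eta) c g (cst eta^-1) t0 mg
  (measurable_cst _) (fun=> ltac:(by rewrite invr_ge0 ltW)).
apply: (@le_trans _ _ (\int[P]_w (eta^-1 *
    \int[leb]_(s in `[t, t + eta]) expR (c * X s w + g w))%:E)%E).
  apply: ge0_le_integral => //; first exact/measurable_EFinP.
  - exact/measurable_EFinP.
  - move=> w _; rewrite lee_fin; have [/hA h|_] := boolP (A w).
      by rewrite mulrC ler_pdivlMr ?mul1r.
    by rewrite mulr_ge0 ?invr_ge0 ?(ltW eta0)// Rintegral_ge0// => s _; exact: expR_ge0.
set B := expR _.
have -> : B = (t + eta - t) * (eta^-1 * B) by rewrite addrC addKr mulVKf ?gt_eqF.
apply: (@fbm_fubini_tonelli_le t (t + eta) c g (cst eta^-1)) => //.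
- by move=> w; rewrite invr_ge0 ltW.
- by rewrite lerDl ltW.
- by rewrite mulr_ge0 ?expR_ge0// invr_ge0 ltW.
move=> s /andP[ts st].
have E w : cst eta^-1 w * expR (c * X s w + g w) =
    (eta^-1 * expR e) * expR (c * (X s w - X t w)).
  by rewrite /= -mulrA -expRD; congr (_ * expR _); rewrite /g; ring.
under eq_integral do rewrite E EFinM.
have n1 : nonneg_times [:: (c, s); (- c, t)].
  by rewrite /nonneg_times/= t0 (le_trans t0).
rewrite ge0_integralZl//; last 2 first.
- apply/measurable_EFinP; apply: measurableT_comp => //.
  by apply: measurable_funM => //; exact: measurable_funB.
- by rewrite lee_fin mulr_ge0 ?expR_ge0// invr_ge0 ltW.
rewrite mgf_increment// -EFinM lee_fin -mulrA -expRD ler_wpM2l ?invr_ge0 ?(ltW eta0)//.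
rewrite ler_expR lerD2l ler_pM2r ?invr_gt0// -[leLHS]ger0_norm ?sqr_ge0// normrX.
rewrite lerXn2r ?nnegrE ?mulr_ge0 ?powR_ge0 ?(ltW theta0)//.
rewrite normrM ct ger0_norm ?powR_ge0// ler_wpM2l//.
by rewrite ge0_ler_powR ?nnegrE ?(ltW H_gt0) ?subr_ge0 ?(ltW eta0)// lerBlDl.
Qed.

Let mX s : measurable_fun setT (X s). Proof. exact: measurable_funPT. Qed.

Let mexpX (e : R) : measurable_fun setT (fun w => eta * expR (X t w + e)).
Proof.
apply: measurable_funM => //; apply: measurableT_comp => //.
exact: measurable_funD.
Qed.

Lemma measurable_ler_indic (f g : Omega -> R) :
  measurable_fun setT f -> measurable_fun setT g ->
  measurable_fun setT (fun w => (f w <= g w)%R%:R : R).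
Proof.
move=> mf mg; have := measurable_ler_cst 0 (measurable_funB mf mg).
by congr (measurable_fun _ _); apply/funext => w; rewrite subr_le0.
Qed.

Let expint_shift (e : R) w :
  \int[leb]_(s in `[t, t + eta]) expR (X s w + e) = expR e * expint t (t + eta) w.
Proof.
have mD : measurable (`[t, t + eta]%classic : set (measurableTypeR R)).
  exact: measurable_itv.
have iX : leb.-integrable `[t, t + eta] (EFin \o (fun s => expR (X s w))).
  apply: integrable_within_continuous; apply: within_continuous_expR.
  exact: continuous_path.
rewrite /expint -(RintegralZl _ mD iX).
by apply: eq_Rintegral => s _; rewrite expRD mulrC.
Qed.

Let tE : t + eta - t = eta. Proof. by rewrite addrC addKr. Qed.

Let tle : t <= t + eta. Proof. by rewrite lerDl ltW. Qed.

(** When expR (X s - X t + 1) has average at most 1 over the interval, Jensen's inequality forces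
    its power of exponent -theta to have average at least 1. The free [theta] later makes the bound
    smaller than any power of T although [eta] is only polylogarithmic. *)
Lemma expint_lower_tail :
  (\int[P]_w ((expint t (t + eta) w <= eta * expR (X t w - 1))%R%:R)%:E <=
   (expR (- theta + (theta * eta `^ H) ^+ 2 / 2))%:E)%E.
Proof.
apply: (@tail_bound (- theta)); first by rewrite normrN ger0_norm.
  by apply: measurable_ler_indic; [exact: measurable_expint|exact: mexpX].
move=> w hw.
have := @jensen_expR_neg R t (t + eta) theta (fun s => X s w + (1 - X t w)) tle theta0
  (within_continuousD (continuous_path t0)).
rewrite tE expint_shift => h.
have -> : \int[leb]_(s in `[t, t + eta]) expR (- theta * X s w + (- theta - - theta * X t w))
   = \int[leb]_(s in `[t, t + eta]) expR (- theta * (X s w + (1 - X t w))).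
  by apply: eq_Rintegral => s _; congr expR; ring.
apply: h; apply: (le_trans (ler_wpM2l (expR_ge0 _) hw)).
by rewrite mulrCA -expRD (_ : _ + _ = 0) ?expR0 ?mulr1//; ring.
Qed.

Lemma expint_upper_tail : 1 <= theta ->
  (\int[P]_w ((eta * expR (X t w + 1) <= expint t (t + eta) w)%R%:R)%:E <=
   (expR (- theta + (theta * eta `^ H) ^+ 2 / 2))%:E)%E.
Proof.
move=> theta1; apply: (@tail_bound theta); first by rewrite ger0_norm.
  by apply: measurable_ler_indic; [exact: mexpX|exact: measurable_expint].
move=> w hw.
have := @jensen_expR_pos R t (t + eta) theta (fun s => X s w + (- 1 - X t w)) tle theta1
  (within_continuousD (continuous_path t0)).
rewrite tE expint_shift => h.
have -> : \int[leb]_(s in `[t, t + eta]) expR (theta * X s w + (- theta - theta * X t w))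
   = \int[leb]_(s in `[t, t + eta]) expR (theta * (X s w + (- 1 - X t w))).
  by apply: eq_Rintegral => s _; congr expR; ring.
apply: h; apply: le_trans (ler_wpM2l (expR_ge0 _) hw).
by rewrite mulrCA -expRD (_ : _ + _ = 0) ?expR0 ?mulr1//; ring.
Qed.

End regularity.

End fbm_tonelli.

(** * Upper bound *)

Section moment_upper_bound.
Context {R : realType} (H : R) (H_gt0 : 0 < H) (H_lt1 : H < 1).
Context d (Omega : measurableType d) (P : probability Omega R).
Variable X : R -> {RV P >-> R}.
Hypothesis fbm : fractional_brownian_motion H X.
Notation leb := (@lebesgue_measure R).
Local Notation expint := (expint X).

Let integrable_expX (a b : R) w : 0 <= a ->
  leb.-integrable `[a, b] (EFin \o (fun s => expR (X s w))).
Proof.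
move=> a0; apply: integrable_within_continuous; apply: within_continuous_expR.
exact: (continuous_path fbm).
Qed.

Lemma expint_ge0 (a b : R) w : 0 <= expint a b w.
Proof. by apply: Rintegral_ge0 => s _; exact: expR_ge0. Qed.

Lemma expint_add (a b c : R) w : 0 <= a -> a <= b -> b <= c ->
  expint a c w = expint a b w + expint b c w.
Proof.
move=> a0 ab bc; have b0 := le_trans a0 ab.
have := @Rintegral_itvB R (fun s => expR (X s w)) (BLeft a) (BRight c) b
  (integrable_expX c w a0).
rewrite !bnd_simp => /(_ ab bc); rewrite Rintegral_itv_obnd_cbnd; last first.
  have mD : measurable (`[b, c]%classic : set (measurableTypeR R)) by exact: measurable_itv.
  apply: integrableS (integrable_expX c w b0) => //.
  by apply: subset_itvr; rewrite bnd_simp.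
by rewrite /expint => <-; rewrite addrC subrK.
Qed.

Lemma expint_subset (a b a' b' : R) w : 0 <= a -> a <= a' -> a' <= b' -> b' <= b ->
  expint a' b' w <= expint a b w.
Proof.
move=> a0 aa' ab' bb'; have a'0 := le_trans a0 aa'.
rewrite (@expint_add a a' b)// ?(le_trans ab')// (@expint_add a' b' b)//.
by have := expint_ge0 a a' w; have := expint_ge0 b' b w; lra.
Qed.

Lemma expint_shiftE (a b e : R) w : 0 <= a ->
  \int[leb]_(s in `[a, b]) expR (X s w + e) = expR e * expint a b w.
Proof.
move=> a0; have mD : measurable (`[a, b]%classic : set (measurableTypeR R)).
  exact: measurable_itv.
rewrite /expint -(RintegralZl _ mD (integrable_expX b w a0)).
by apply: eq_Rintegral => s _; rewrite expRD mulrC.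
Qed.

(** If the integral vanished, it would stay zero after adding any constant [e] to the path, and
    [jensen_expR_neg] would give b - a <= expR (- e) * M for every [e]. *)
Lemma expint_gt0 (a b : R) w : 0 <= a -> a < b -> 0 < expint a b w.
Proof.
move=> a0 ab; rewrite lt_neqAle eq_sym expint_ge0 andbT; apply/eqP => I0.
have cX : {within `[a, b], continuous (fun s => X s w)} by exact: (continuous_path fbm).
pose M := \int[leb]_(s in `[a, b]) expR (- 1 * X s w).
have h e : b - a <= expR (- e) * M.
  have := @jensen_expR_neg R a b 1 (fun s => X s w + e) (ltW ab) ler01
    (within_continuousD cX).
  rewrite expint_shiftE// I0 mulr0 => /(_ _)/le_trans; apply.
    by rewrite subr_ge0 ltW.
  have mD : measurable (`[a, b]%classic : set (measurableTypeR R)).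
    exact: measurable_itv.
  have iM : leb.-integrable `[a, b] (EFin \o (fun s => expR (- 1 * X s w))).
    apply: integrable_within_continuous; apply: within_continuous_expR.
    exact: within_continuousZ.
  rewrite /M -(RintegralZl _ mD iM) le_eqVlt; apply/orP; left; apply/eqP.
  by apply: eq_Rintegral => s _; rewrite -expRD; congr expR; ring.
have M0 : 0 < M.
  have := h 0; rewrite oppr0 expR0 mul1r; apply: lt_le_trans.
  by rewrite subr_gt0.
have q0 : 0 < (b - a) / (2 * M) by rewrite divr_gt0 ?subr_gt0// mulr_gt0.
have := h (- ln ((b - a) / (2 * M))).
rewrite opprK lnK ?posrE//.
have -> : (b - a) / (2 * M) * M = (b - a) / 2 by field; rewrite gt_eqF.
by have := ab; lra.
Qed.

(** Jensen's inequality for x^(-k), after subtracting [ln A] from the path so that its exponential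
    has average 1. *)
Lemma inv_expint_powR_le (k : R) w : 0 < k ->
  (expint 0 1 w)^-1 `^ k <= \int[leb]_(s in `[0, 1]) expR (- k * X s w + 0).
Proof.
move=> k0; have A0 := expint_gt0 w (lexx 0) ltr01.
set A := expint 0 1 w in A0 *.
have cX : {within `[0, 1], continuous (fun s => X s w)} by exact: (continuous_path fbm).
have := @jensen_expR_neg R 0 1 k (fun s => X s w + - ln A) ler01 (ltW k0)
  (within_continuousD cX).
rewrite expint_shiftE// expRN lnK ?posrE// mulVf ?gt_eqF// subr0 lexx => /(_ isT) h.
have mD : measurable (`[0, 1]%classic : set (measurableTypeR R)).
  exact: measurable_itv.
have iM : leb.-integrable `[0, 1] (EFin \o (fun s => expR (- k * X s w + 0))).
  apply: integrable_within_continuous; apply: within_continuous_expR.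
  by apply: within_continuousD; exact: within_continuousZ.
rewrite /powR invr_eq0 gt_eqF// lnV ?posrE//.
rewrite -[leLHS]mulr1; apply: le_trans (ler_wpM2l (expR_ge0 _) h) _.
have -> : \int[leb]_(s in `[0, 1]) expR (- k * (X s w + - ln A)) =
    expR (k * ln A) * \int[leb]_(s in `[0, 1]) expR (- k * X s w + 0).
  rewrite -(RintegralZl _ mD iM).
  by apply: eq_Rintegral => s _; rewrite -expRD; congr expR; ring.
by rewrite mulrA -expRD mulrN addrC subrr expR0 mul1r.
Qed.

Lemma measurable_exp_functional_inv (T k : R) :
  measurable_fun setT (fun w => exp_functional_inv X T w `^ k).
Proof.
have mE : measurable_fun setT (expint 0 T) by exact: (measurable_expint fbm).
have := measurableT_comp (measurable_powR (- k)) mE.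
congr (measurable_fun _ _); apply/funext => w /=.
rewrite /exp_functional_inv -/(expint 0 T w).
by rewrite -powR_inv1 ?expint_ge0// -powRrM mulN1r.
Qed.

Section fixed_horizon.
Variables (k T lam eta theta v : R) (n : nat).
Hypotheses (k0 : 0 < k) (T1 : 1 <= T) (lam1 : 1 <= lam) (eta0 : 0 < eta).
Hypotheses (nT : n.+1%:R * lam + eta <= T) (theta0 : 0 <= theta).
Hypotheses (v0 : 0 < v) (v1 : v <= 1).

(** The barrier: J^k > 1/T puts the integral below T^(1/k), and if the integral exceeds eta expR (X
    - 1) then X < r. *)
Let r := 1 + ln T / k - ln eta.
Hypothesis r0 : 0 <= r.
Hypothesis hv : (2 * (1 + r) * lam `^ (- (2 * H)) +
  4 * k * lam `^ (- cov_exp H)) * lam `^ H <= v.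

Let lam0 : 0 < lam. Proof. exact: lt_le_trans lam1. Qed.
Let T0 : 0 < T. Proof. exact: lt_le_trans T1. Qed.
Let t i : R := i.+1%:R * lam.
Let t_ge0 i : 0 <= t i. Proof. by rewrite mulr_ge0// ltW. Qed.

Let bad i w : R := (expint (t i) (t i + eta) w <= eta * expR (X (t i) w - 1))%R%:R.
Let Q c w := \int[leb]_(s in `[0, 1]) expR (- c * X s w + 0).
Let B w := orthant n.+1 (grid X lam) (fun=> r) w.

Let Q_ge0 c w : 0 <= Q c w.
Proof. by apply: Rintegral_ge0 => s _; exact: expR_ge0. Qed.

Let inv_le_Q c w : 0 < c -> exp_functional_inv X T w `^ c <= Q c w.
Proof.
move=> c0; apply: le_trans (inv_expint_powR_le w c0).
have A0 := expint_gt0 w (lexx 0) ltr01.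
have AT : expint 0 1 w <= expint 0 T w by exact: expint_subset.
have AT0 := lt_le_trans A0 AT.
rewrite ge0_ler_powR ?nnegrE ?(ltW c0) ?invr_ge0 ?(ltW A0) ?(ltW AT0)//.
by rewrite lef_pV2.
Qed.

(** Three cases: J^k <= 1/T; some short interval is bad, and then J^k <= J^(2k) / (2T) + T/2; or all
    grid values are at most [r]. The powers of J are bounded by the averages [Q]. *)
Let pointwise w : exp_functional_inv X T w `^ k <=
  T^-1 + 2^-1 * (T^-1 * Q (2 * k) w) + 2^-1 * (T * \sum_(0 <= i < n.+1) bad i w)
  + B w * Q k w.
Proof.
have q1 := Q_ge0 (2 * k) w; have q2 := Q_ge0 k w.
have B0 : 0 <= B w by exact: orthant_ge0.
have b0 i : 0 <= bad i w by rewrite ler0n.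
have s0 : 0 <= \sum_(0 <= i < n.+1) bad i w by exact: sumr_ge0.
have Ti : 0 < T^-1 by rewrite invr_gt0.
have e1 : 0 <= T^-1 * Q (2 * k) w by rewrite mulr_ge0// ltW.
have e2 : 0 <= T * \sum_(0 <= i < n.+1) bad i w by rewrite mulr_ge0// ltW.
have e3 : 0 <= B w * Q k w by rewrite mulr_ge0.
set J := exp_functional_inv X T w.
have A0 : 0 < expint 0 T w by exact: expint_gt0.
have [hJ|hJ] := leP (J `^ k) T^-1; first lra.
have [hb|hb] := boolP (all (fun i => bad i w == 0) (index_iota 0 n.+1)); last first.
  have [i ilt bi] : exists2 i, (i < n.+1)%N & bad i w = 1.
    move/allPn : hb => [i]; rewrite mem_index_iota => /= ilt bi; exists i => //.
    by move: bi; rewrite /bad; case: (_ <= _)%R; rewrite ?eqxx.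
  have s1 : 1 <= \sum_(0 <= j < n.+1) bad j w.
    by rewrite big_mkord (bigD1 (Ordinal ilt))//= bi lerDl sumr_ge0.
  have J2 : J `^ k * J `^ k <= Q (2 * k) w.
    apply: le_trans (inv_le_Q w _); last by rewrite mulr_gt0.
    by rewrite -expr2 -powR_mulrn ?powR_ge0// -powRrM mulrC.
  have Ts : T <= T * \sum_(0 <= j < n.+1) bad j w by rewrite ler_peMr// ltW.
  have TJ : T^-1 * (J `^ k * J `^ k) <= T^-1 * Q (2 * k) w by rewrite ler_pM2l.
  have := sqr_ge0 (J `^ k - T).
  rewrite sqrrB => h; have := mulr_ge0 (ltW Ti) h.
  have -> : T^-1 * (J `^ k ^+ 2 - J `^ k * T *+ 2 + T ^+ 2) =
    T^-1 * (J `^ k * J `^ k) - 2 * J `^ k + T by field; rewrite gt_eqF.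
  lra.
suff -> : B w = 1 by rewrite mul1r; have := inv_le_Q w k0; rewrite -/J; lra.
rewrite /B orthantE (_ : all _ _ = true)//; apply/allP => i.
rewrite mem_index_iota => /= ilt.
move/allP/(_ i) : hb; rewrite mem_index_iota => /(_ ilt).
rewrite /bad; case: (leP _ (eta * _)) => [_|hi _]; first by rewrite oner_eq0.
have lT : expint (t i) (t i + eta) w <= expint 0 T w.
  apply: expint_subset => //; first by rewrite lerDl ltW.
  apply: le_trans nT; rewrite lerD2r /t ler_wpM2r ?ler_nat//; exact: ltW.
have hA : expint 0 T w <= expR (ln T / k).
  have JE : J `^ k = (expint 0 T w `^ k)^-1.
    by rewrite -powR_inv1 ?powR_ge0// powRAC powR_inv1 ?expint_ge0.
  rewrite JE ltf_pV2 ?posrE ?powR_gt0// in hJ.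
  rewrite -[leLHS]lnK ?posrE// ler_expR ler_pdivlMr// mulrC -ln_powR.
  by rewrite ler_ln ?posrE ?powR_gt0// ltW.
have : eta * expR (X (t i) w - 1) <= expR (ln T / k).
  by apply: le_trans hA; apply: le_trans lT; exact: ltW.
rewrite -[X in X * _]lnK ?posrE// -expRD ler_expR /r /grid -/(t i); lra.
Qed.

Let powR_le1 (s : R) : 0 <= s -> s <= 1 -> s `^ H <= 1.
Proof.
move=> s0 s1; have : s `^ H <= 1 `^ H by rewrite ge0_ler_powR ?nnegrE ?(ltW H_gt0).
by rewrite powR1.
Qed.

Let mQ c : measurable_fun setT (Q c).
Proof.
have := @measurable_weighted_integral _ _ _ _ _ _ fbm 0 1 (- c) (cst 0) (cst 1)
  (lexx 0) (measurable_cst _) (measurable_cst _) (fun=> ler01).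
by congr (measurable_fun _ _); apply/funext => w; rewrite /= mul1r.
Qed.

Let mB : measurable_fun setT B.
Proof. by apply: measurable_orthant => i; exact: measurable_grid. Qed.

Let mbad i : measurable_fun setT (bad i).
Proof.
apply: measurable_ler_indic; first exact: (measurable_expint fbm).
apply: measurable_funM => //; apply: measurableT_comp => //.
by apply: measurable_funB => //; exact: measurable_funPT.
Qed.

Let EQ c : (\int[P]_w (Q c w)%:E <= (expR (c ^+ 2 / 2))%:E)%E.
Proof.
have := @fbm_fubini_tonelli_le _ _ _ _ _ _ fbm 0 1 (- c) (cst 0) (cst 1)
  (lexx 0) (measurable_cst _) (measurable_cst _) (fun=> ler01) (expR (c ^+ 2 / 2))
  ler01 (expR_ge0 _).
rewrite subr0 mul1r => h; apply: le_trans (h _).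
  rewrite le_eqVlt; apply/orP; left; apply/eqP.
  by apply: eq_integral => w _; rewrite /= mul1r.
move=> s /andP[s0 s1]; under eq_integral do rewrite /= mul1r addr0.
have n1 : nonneg_times [:: (- c, s)] by rewrite /nonneg_times/= s0.
have := mgf_lin fbm n1; rewrite lin_cov1//.
have -> : (\int[P]_w (expR (lin X [:: ((- c)%R, s)] w))%:E =
           \int[P]_w (expR (- c * X s w))%:E)%E.
  by apply: eq_integral => w _; rewrite /lin big_seq1.
move=> ->; rewrite lee_fin ler_expR ler_pM2r ?invr_gt0// mulNr sqrrN exprMn.
rewrite ler_piMr ?sqr_ge0// -[leRHS](expr1n _ 2) lerXn2r ?nnegrE ?powR_ge0//.
exact: powR_le1.
Qed.

Let EBQ : (\int[P]_w (B w * Q k w)%:E <=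
  (expR (k ^+ 2 / 2) * (expR 2 * eneg X lam n + expR (- (2 * v ^+ 2)^-1)))%:E)%E.
Proof.
set Bd := expR _ * _.
have Bd0 : 0 <= Bd.
  by rewrite mulr_ge0 ?expR_ge0// addr_ge0 ?expR_ge0// mulr_ge0 ?expR_ge0 ?eneg_ge0.
have := @fbm_fubini_tonelli_le _ _ _ _ _ _ fbm 0 1 (- k) (cst 0) B
  (lexx 0) (measurable_cst _) mB (orthant_ge0 _ _ _) Bd ler01 Bd0.
rewrite subr0 mul1r; apply => s /andP[s0 s1].
have n1 : nonneg_times [:: (- k, s)] by rewrite /nonneg_times/= s0.
under eq_integral do rewrite /= addr0 mulrC.
have E w : expR (- k * X s w) = expR (lin X [:: (- k, s)] w).
  by rewrite /lin big_seq1.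
under eq_integral do rewrite E.
rewrite (fbm_cameron_martin fbm _ _ n1 t_ge0) lin_cov1//.
have io r' : P.-integrable setT (fun w => (orthant n.+1 (fun i => X (t i)) r' w)%:E).
  by apply: integrable_orthant => i; exact: measurable_funPT.
have gb := @grid_shift_bound R H H_gt0 d Omega P X fbm lam lam0 n
  (fun i => r - lin_cov H [:: (- k, s)] [:: (1, t i)]) r (4 * k) v r0.
rewrite -(@fineK _ (\int[P]_w _)%E); last exact: integrable_fin_num (io _).
rewrite -EFinM lee_fin /Bd; apply: ler_pM; rewrite ?expR_ge0//.
- by apply: fine_ge0; apply: integral_ge0 => w _; rewrite lee_fin orthant_ge0.
- rewrite ler_expR ler_pM2r ?invr_gt0// mulNr sqrrN exprMn.
  rewrite ler_piMr ?sqr_ge0// -[leRHS](expr1n _ 2) lerXn2r ?nnegrE ?powR_ge0//.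
  exact: powR_le1.
apply: gb => //; first by rewrite mulr_ge0// ltW.
move=> i _; rewrite /lin_cov !big_seq1/= mulr1 mulNr opprK -/(t i).
have lt : lam <= t i by rewrite /t ler_peMl ?ler1n// ltW.
have k1 : fbm_cov H s (t i) <= fbm_cov H 1 (t i).
  exact: (fbm_cov_le1 H_gt0 _ _ (le_trans lam1 lt)).
have k2 := fbm_cov_ratio H_gt0 H_lt1 (lexx 1) lam1 lt.
rewrite powR1 /= mulr1 in k2.
rewrite lerD2l (mulrC 4) -!mulrA ler_pM2l// mulrA.
exact: le_trans k2.
Qed.

Let Ebad i : (\int[P]_w (bad i w)%:E <=
  (expR (- theta + (theta * eta `^ H) ^+ 2 / 2))%:E)%E.
Proof. exact: (expint_lower_tail H_gt0 fbm (t_ge0 i) eta0 theta0). Qed.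

Lemma moment_upper : ('E_P[(fun w => exp_functional_inv X T w `^ k)%R] <=
  (T^-1 + 2^-1 * (T^-1 * expR ((2 * k) ^+ 2 / 2)) +
   2^-1 * (T * (n.+1%:R * expR (- theta + (theta * eta `^ H) ^+ 2 / 2))) +
   expR (k ^+ 2 / 2) * (expR 2 * eneg X lam n + expR (- (2 * v ^+ 2)^-1)))%:E)%E.
Proof.
rewrite unlock.
have Ti : 0 < T^-1 by rewrite invr_gt0.
have mS : measurable_fun setT (fun w => \sum_(0 <= i < n.+1) bad i w).
  exact: measurable_sum.
have S0 w : 0 <= \sum_(0 <= i < n.+1) bad i w.
  by apply: sumr_ge0 => i _; rewrite ler0n.
have m1 : measurable_fun setT (fun w => 2^-1 * (T^-1 * Q (2 * k) w)).
  by do 2 apply: measurable_funM => //.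
have m2 : measurable_fun setT (fun w => 2^-1 * (T * \sum_(0 <= i < n.+1) bad i w)).
  by do 2 apply: measurable_funM => //.
have m3 : measurable_fun setT (fun w => B w * Q k w) by exact: measurable_funM.
have f1 w : 0 <= 2^-1 * (T^-1 * Q (2 * k) w) by rewrite !mulr_ge0// ltW.
have f2 w : 0 <= 2^-1 * (T * \sum_(0 <= i < n.+1) bad i w) by rewrite !mulr_ge0// ltW.
have f3 w : 0 <= B w * Q k w by rewrite mulr_ge0// orthant_ge0.
apply: (@le_trans _ _ (\int[P]_w (T^-1 + 2^-1 * (T^-1 * Q (2 * k) w) +
  2^-1 * (T * \sum_(0 <= i < n.+1) bad i w) + B w * Q k w)%:E)%E).
  apply: ge0_le_integral => //.
  - by move=> w _; rewrite lee_fin powR_ge0.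
  - by apply/measurable_EFinP; exact: measurable_exp_functional_inv.
  - by apply/measurable_EFinP; do 3 apply: measurable_funD => //.
  - by move=> w _; rewrite lee_fin pointwise.
under eq_integral do rewrite 3!EFinD.
rewrite ge0_integralD//; last 4 first.
- by move=> w _; rewrite -!EFinD lee_fin !addr_ge0// ltW.
- by apply/measurable_EFinP; do 2 apply: measurable_funD => //.
- by move=> w _; rewrite lee_fin.
- exact/measurable_EFinP.
rewrite EFinD; apply: leeD; last exact: EBQ.
rewrite ge0_integralD//; last 4 first.
- by move=> w _; rewrite -!EFinD lee_fin !addr_ge0// ltW.
- by apply/measurable_EFinP; apply: measurable_funD => //.
- by move=> w _; rewrite lee_fin.
- exact/measurable_EFinP.
rewrite EFinD; apply: leeD; last first.
  under eq_integral do rewrite mulrA EFinM.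
  rewrite ge0_integralZl//; last 3 first.
  - exact/measurable_EFinP.
  - by move=> w _; rewrite lee_fin.
  - by rewrite lee_fin mulr_ge0// ltW.
  rewrite [leRHS](_ : _ = (2^-1 * T)%:E * (n.+1%:R *
    expR (- theta + (theta * eta `^ H) ^+ 2 / 2))%:E)%E; last first.
    by rewrite -EFinM; congr EFin; ring.
  rewrite lee_wpmul2l//; first by rewrite lee_fin mulr_ge0// ltW.
  under eq_integral do rewrite -sumEFin.
  rewrite ge0_integral_sum//; last 2 first.
  - by move=> i; exact/measurable_EFinP.
  - by move=> i w _; rewrite lee_fin ler0n.
  apply: (@le_trans _ _ (\sum_(0 <= i < n.+1)
      (expR (- theta + (theta * eta `^ H) ^+ 2 / 2))%:E)%E).
    by apply: lee_sum => i _; exact: Ebad.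
  by rewrite sumEFin sumr_const_nat subn0 mulr_natl.
rewrite ge0_integralD//; last 3 first.
- by move=> w _; rewrite lee_fin ltW.
- by move=> w _; rewrite lee_fin.
- exact/measurable_EFinP.
rewrite EFinD; apply: leeD.
  rewrite integral_cst// (_ : _ setT = 1%E) ?mule1//; exact: probability_setT.
under eq_integral do rewrite mulrA EFinM.
rewrite ge0_integralZl//; last 3 first.
- exact/measurable_EFinP.
- by move=> w _; rewrite lee_fin.
- by rewrite lee_fin mulr_ge0// ltW.
rewrite [leRHS](_ : _ = (2^-1 * T^-1)%:E * (expR ((2 * k) ^+ 2 / 2))%:E)%E.
  by rewrite lee_wpmul2l//; rewrite lee_fin mulr_ge0// ltW.
by rewrite -EFinM; congr EFin; ring.
Qed.

End fixed_horizon.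

End moment_upper_bound.

(** * Lower bound *)

Section harmonic_sums.
Context {R : realType}.

Lemma ln_le_harmonic n : ln n.+1%:R <= \sum_(0 <= q < n) q.+1%:R^-1 :> R.
Proof.
elim: n => [|n ih]; first by rewrite ln1 big_nil.
rewrite big_nat_recr//=; have n0 : 0 < n.+1%:R :> R by rewrite ltr0n.
have -> : n.+2%:R = n.+1%:R * (1 + n.+1%:R^-1) :> R.
  by rewrite mulrDr mulr1 mulfV ?gt_eqF// natr1.
have i0 : 0 < n.+1%:R^-1 :> R by rewrite invr_gt0.
rewrite lnM ?posrE ?addr_gt0//; apply: lerD => //.
by apply: le_ln1Dx; apply: lt_trans i0; rewrite oppr_lt0.
Qed.

Let pred_split n : n.+1%:R = n.+2%:R * (1 + - n.+2%:R^-1) :> R.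
Proof.
by rewrite mulrDr mulr1 mulrN mulfV ?pnatr_eq0// -[in n.+2%:R]natr1 addrK.
Qed.

Let pred_gt0 n : 0 < 1 + - n.+2%:R^-1 :> R.
Proof. by rewrite subr_gt0 invf_lt1 ?ltr0n// ltr1n. Qed.

Let ln_pred n : ln (1 + - n.+2%:R^-1) <= - n.+2%:R^-1 :> R.
Proof. by apply: le_ln1Dx; rewrite ltrN2 invf_lt1 ?ltr0n// ltr1n. Qed.

Lemma harmonic_le_ln n : (0 < n)%N ->
  \sum_(0 <= q < n) q.+1%:R^-1 <= 1 + ln n%:R :> R.
Proof.
case: n => // n _; elim: n => [|n ih].
  by rewrite big_nat1 ln1 addr0 invr1.
have e : ln n.+1%:R = ln n.+2%:R + ln (1 + - n.+2%:R^-1) :> R.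
  by rewrite -lnM ?posrE ?ltr0n// -pred_split.
rewrite e in ih; rewrite big_nat_recr//=; have := ln_pred n.
move: (ln (1 + - n.+2%:R^-1)) (ln n.+2%:R) ih => a b.
move: (\sum_(_ <= _ < _) _) (n.+2%:R^-1) => s i; lra.
Qed.

(** The comparison with an integral in discrete form: y^(-1-a) <= ((y - 1)^(-a) - y^(-a)) / a. The
    induction carries the telescoped bound. *)
Lemma sum_powR_le (a : R) n : 0 < a ->
  \sum_(0 <= q < n) q.+1%:R `^ (- (1 + a)) <= 1 + a^-1.
Proof.
move=> a0.
suff h m : \sum_(0 <= q < m.+1) q.+1%:R `^ (- (1 + a)) <=
    1 + a^-1 * (1 - m.+1%:R `^ (- a)).
  case: n => [|n]; first by rewrite big_nil addr_ge0// invr_ge0 ltW.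
  apply: (le_trans (h n)); rewrite lerD2l ler_piMr ?invr_ge0 ?(ltW a0)//.
elim: m => [|m ih]; first by rewrite big_nat1 !powR1 subrr mulr0 addr0.
rewrite big_nat_recr//=.
set y : R := m.+2%:R; have y0 : 0 < y by rewrite ltr0n.
have e : y `^ (- (1 + a)) <= a^-1 * (m.+1%:R `^ (- a) - y `^ (- a)).
  have -> : y `^ (- (1 + a)) = y `^ (- a) * y^-1.
    rewrite opprD addrC powRD ?(gt_eqF y0) ?implybT// powR_inv1//; exact: ltW.
  have -> : m.+1%:R `^ (- a) = y `^ (- a) * (1 + - y^-1) `^ (- a).
    by rewrite -powRM ?(ltW y0) ?(ltW (pred_gt0 m))// -pred_split.
  have -> : a^-1 * (y `^ (- a) * (1 + - y^-1) `^ (- a) - y `^ (- a)) =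
    y `^ (- a) * (a^-1 * ((1 + - y^-1) `^ (- a) - 1)) by ring.
  rewrite ler_wpM2l ?powR_ge0//.
  rewrite ler_pdivlMl// /powR gt_eqF ?pred_gt0//.
  have := expR_ge1Dx (- a * ln (1 + - y^-1)).
  have := ler_wpM2l (ltW a0) (ln_pred m); rewrite -/y.
  by clearbody y; rewrite mulrN mulNr; lra.
by move: ih; rewrite !mulrBr in e *; lra.
Qed.

End harmonic_sums.

(** * The logarithmic drift *)

Section log_drift.
Context {R : realType} (H : R) (H_gt0 : 0 < H) (H_lt1 : H < 1).
Context d (Omega : measurableType d) (P : probability Omega R).
Variable X : R -> {RV P >-> R}.
Hypothesis fbm : fractional_brownian_motion H X.
Local Notation K := (fbm_cov H).

Lemma lin_cov_ge0 s : nonneg_times s -> 0 <= lin_cov H s s.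
Proof.
move=> s0; rewrite -lee_fin -(expectation_linM fbm s0 s0).
by apply: expectation_ge0 => w; rewrite -expr2 sqr_ge0.
Qed.

(** The variance of X_q / q^H - X_r / r^H is nonnegative. *)
Lemma fbm_cov_cauchy_schwarz (q r : R) : 0 < q -> 0 < r -> K q r <= q `^ H * r `^ H.
Proof.
move=> q0 r0; have a0 := powR_gt0 H q0; have b0 := powR_gt0 H r0.
have n1 : nonneg_times [:: ((q `^ H)^-1, q); (- (r `^ H)^-1, r)].
  by rewrite /nonneg_times/= !ltW.
have := lin_cov_ge0 n1.
rewrite /lin_cov !big_cons !big_nil/= !(fbm_cov_diag H_gt0) ?(ltW q0) ?(ltW r0)//.
rewrite (fbm_covC _ r q).
set a := q `^ H in a0 *; set b := r `^ H in b0 *; set k := K q r.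
have -> : a^-1 * a^-1 * a ^+ 2 + (a^-1 * - b^-1 * k + 0) +
  (- b^-1 * a^-1 * k + (- b^-1 * - b^-1 * b ^+ 2 + 0) + 0) = 2 - 2 * (k / (a * b)).
  by field; rewrite !gt_eqF.
have ab0 : 0 < a * b by rewrite mulr_gt0.
by rewrite subr_ge0 -[X in _ <= X]mulr1 ler_pM2l// ler_pdivrMr// mul1r.
Qed.

(* The variance of [log_drift n] stays bounded in [n], while its covariance with
   [X t] grows at least like [2 ln t]; the exponent [1 + 2 H] balances the two. *)
Definition log_drift n : seq (R * R) :=
  comb n (fun q => 4 * q.+1%:R `^ (- (1 + 2 * H))) (fun q => q.+1%:R).

Definition drift n (t : R) : R := lin_cov H (log_drift n) [:: (1, t)].

Lemma driftE n t : drift n t =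
  \sum_(0 <= q < n) 4 * q.+1%:R `^ (- (1 + 2 * H)) * K q.+1%:R t.
Proof.
rewrite /drift /lin_cov /log_drift /comb big_map.
by apply: eq_bigr => q _; rewrite big_seq1/= mulr1.
Qed.

Lemma nonneg_log_drift n : nonneg_times (log_drift n).
Proof. exact: nonneg_times_comb. Qed.

(** By Cauchy-Schwarz K q r <= q^H r^H, so the double sum is at most 16 times the square of the sum
    of q^(-1-H). *)
Lemma log_drift_var n : lin_cov H (log_drift n) (log_drift n) <=
  16 * (1 + H^-1) ^+ 2.
Proof.
set S := \sum_(0 <= q < n) q.+1%:R `^ (- (1 + H)) : R.
have S0 : 0 <= S by apply: sumr_ge0 => q _; exact: powR_ge0.
apply: (@le_trans _ _ (16 * (S * S))); last first.
  rewrite ler_pM2l// -expr2 lerXn2r ?nnegrE// ?sum_powR_le//.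
  by rewrite addr_ge0// invr_ge0 ltW.
rewrite /log_drift lin_cov_comb /S big_distrl /= mulr_sumr.
apply: ler_sum => q _; rewrite big_distrr /= mulr_sumr.
apply: ler_sum => r _.
set x : R := q.+1%:R; set y : R := r.+1%:R.
have x0 : 0 < x by rewrite ltr0n.
have y0 : 0 < y by rewrite ltr0n.
have E z : 0 < z -> z `^ (- (1 + H)) = z `^ (- (1 + 2 * H)) * z `^ H.
  by move=> z0; rewrite -powRD ?(gt_eqF z0) ?implybT//; congr (_ `^ _); ring.
rewrite (E x x0) (E y y0).
apply: (@le_trans _ _ (4 * x `^ (- (1 + 2 * H)) * (4 * y `^ (- (1 + 2 * H))) *
   (x `^ H * y `^ H))).
  by rewrite ler_wpM2l ?mulr_ge0 ?powR_ge0// fbm_cov_cauchy_schwarz.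
by rewrite le_eqVlt; apply/orP; left; apply/eqP; ring.
Qed.

(** Every q <= t contributes at least 2/q, because K q t >= q^(2H) / 2. So the drift is at least 2
    ln (m + 1), with m the integer part of t, and 1 + t <= 2 (m + 1). *)
Lemma drift_lower n t : 0 <= t -> t <= n%:R -> expR (- drift n t) <= 4 / (1 + t) ^+ 2.
Proof.
move=> t0 tn; pose m := Num.truncn t.
have mt : m%:R <= t by rewrite truncn_le.
have tm : t < m.+1%:R by exact: truncnS_gt.
have mn : (m <= n)%N by rewrite -(ler_nat R) (le_trans mt).
have g : 2 * ln m.+1%:R <= drift n t.
  apply: (@le_trans _ _ (2 * \sum_(0 <= q < m) q.+1%:R^-1)).
    by rewrite ler_pM2l// ln_le_harmonic.
  rewrite driftE [leRHS](big_cat_nat (n := m))//= mulr_sumr.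
  apply: ler_wpDr.
    by apply: sumr_ge0 => q _; rewrite mulr_ge0 ?(fbm_cov_ge0 H_gt0)// mulr_ge0 ?powR_ge0.
  apply: ler_sum_nat => q /andP[_ qm].
  set x : R := q.+1%:R; have x0 : 0 < x by rewrite ltr0n.
  have xt : x <= t by apply: le_trans mt; rewrite ler_nat.
  have := fbm_cov_ge H_gt0 (ltW x0) xt => h.
  have c0 : 0 <= 4 * x `^ (- (1 + 2 * H)) by rewrite mulr_ge0 ?powR_ge0.
  apply: le_trans (ler_wpM2l c0 h).
  have -> : 4 * x `^ (- (1 + 2 * H)) * (x `^ (2 * H) / 2) =
    2 * (x `^ (- (1 + 2 * H)) * x `^ (2 * H)) by field.
  rewrite -powRD ?(gt_eqF x0) ?implybT//.
  have -> : - (1 + 2 * H) + 2 * H = -1 by ring.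
  by rewrite powR_inv1// ltW.
have m0 : 0 < m.+1%:R :> R by rewrite ltr0n.
apply: (@le_trans _ _ (expR (- (2 * ln m.+1%:R)))); first by rewrite ler_expR lerN2.
rewrite expRN expRM_natl lnK ?posrE//.
have t1 : 0 < 1 + t by rewrite ltr_pwDl.
have le2 : (1 + t) ^+ 2 <= (2 * m.+1%:R) ^+ 2.
  rewrite lerXn2r ?nnegrE ?mulr_ge0 ?(ltW t1)//.
  have : 1 <= m.+1%:R :> R by rewrite ler1n.
  lra.
rewrite ler_pdivlMr ?exprn_gt0// mulrC ler_pdivrMr ?exprn_gt0//.
by apply: le_trans le2 _; rewrite exprMn; lra.
Qed.

(** [fbm_cov_ratio] compares each X_q with X_l at a cost q^(2H), which the weights reduce to 1/q.
    From time [l] on, the drift is thus below a multiple of a single covariance function, as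
    [grid_shift_bound] requires. *)
Lemma drift_upper n l t : (0 < n)%N -> 1 <= l -> l <= t ->
  drift n t <= 16 * (1 + ln n%:R) * l `^ (- cov_exp H) * K l t.
Proof.
move=> n0 l1 lt; have l0 := lt_le_trans ltr01 l1.
have t0 := lt_le_trans l0 lt.
have k0 : 0 <= l `^ (- cov_exp H) * K l t.
  by rewrite mulr_ge0 ?powR_ge0 ?(fbm_cov_ge0 H_gt0) ?(ltW l0) ?(ltW t0).
apply: (@le_trans _ _ (16 * (\sum_(0 <= q < n) q.+1%:R^-1) *
   (l `^ (- cov_exp H) * K l t))); last first.
  by rewrite -[leRHS]mulrA ler_wpM2r// ler_pM2l// harmonic_le_ln.
rewrite driftE mulr_sumr mulr_suml; apply: ler_sum => q _.
set x : R := q.+1%:R; have x0 : 0 < x by rewrite ltr0n.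
have x1 : 1 <= x by rewrite ler1n.
have := fbm_cov_ratio H_gt0 H_lt1 x1 l1 lt => h.
have c0 : 0 <= 4 * x `^ (- (1 + 2 * H)) by rewrite mulr_ge0 ?powR_ge0.
apply: le_trans (ler_wpM2l c0 h) _.
have e : x `^ (- (1 + 2 * H)) * x `^ (2 * H) = x^-1.
  rewrite -powRD ?(gt_eqF x0) ?implybT//.
  have -> : - (1 + 2 * H) + 2 * H = -1 by ring.
  by rewrite powR_inv1// ltW.
rewrite -e le_eqVlt; apply/orP; left; apply/eqP; ring.
Qed.

End log_drift.

Section moment_lower_bound.
Context {R : realType} (H : R) (H_gt0 : 0 < H) (H_lt1 : H < 1).
Context d (Omega : measurableType d) (P : probability Omega R).
Variable X : R -> {RV P >-> R}.
Hypothesis fbm : fractional_brownian_motion H X.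
Local Notation expint := (expint X).

Definition opp_lin (s : seq (R * R)) : seq (R * R) := [seq (- p.1, p.2) | p <- s].

Lemma lin_opp s w : lin X (opp_lin s) w = - lin X s w.
Proof. by rewrite /lin big_map -sumrN; apply: eq_bigr => p _; rewrite mulNr. Qed.

Lemma lin_cov_oppl s s' : lin_cov H (opp_lin s) s' = - lin_cov H s s'.
Proof.
rewrite /lin_cov big_map -sumrN; apply: eq_bigr => p _.
by rewrite -sumrN; apply: eq_bigr => q _; rewrite !mulNr.
Qed.

Lemma nonneg_opp s : nonneg_times s -> nonneg_times (opp_lin s).
Proof. by rewrite /nonneg_times all_map. Qed.

Variables (delta : R) (n : nat).
Hypotheses (delta0 : 0 < delta) (delta1 : delta <= 1).

Let S := orthant n.+1 (grid X delta) (fun=> 0).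
Let PS := \int[P]_w S w.
Let t i : R := i.+1%:R * delta.
Let t_ge0 i : 0 <= t i. Proof. by rewrite mulr_ge0// ltW. Qed.
Let mg i : measurable_fun setT (grid X delta i). Proof. exact: measurable_grid. Qed.

Let iS : P.-integrable setT (fun w => (S w)%:E).
Proof. exact: integrable_orthant. Qed.

(** For [k] a multiple of ln T the last term is a negative power of T, so passing from the mean
    negative part to the probability costs one logarithm. The 1 in the exponent absorbs the variance
    of the first grid value, as delta <= 1. *)
Lemma eneg_le_persistence (k : R) : 0 <= k ->
  eneg X delta n <= k * PS + expR (1 - k).
Proof.
move=> k0; have i1 : P.-integrable setT (fun w => (k * S w)%:E).
  exact: (integrableZl measurableT k iS).
have i2' := integrable_expR_fbm fbm (- 1) (t_ge0 0).
have i2 := integrableZl measurableT (expR (- k)) i2'.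
apply: (@le_trans _ _ (\int[P]_w (k * S w + expR (- k) * expR (- 1 * X (t 0) w)))).
  apply: le_Rintegral => //.
  - exact: (integrable_gridneg fbm delta0).
  - exact: (integrableD measurableT i1 i2).
  - move=> w _; rewrite -expRD; apply: le_trans (gridneg_le_orthant X delta n w k0) _.
    by rewrite lerD2l ler_expR mulN1r addrC.
rewrite (RintegralD measurableT i1 i2) (RintegralZl _ measurableT i2').
rewrite (RintegralZl _ measurableT iS).
rewrite (Rintegral_expR_fbm H_gt0 fbm)// -expRD lerD2l ler_expR.
have h0 := powR_ge0 (t 0) H.
have h1 : t 0 `^ H <= 1 `^ H.
  by rewrite ge0_ler_powR ?nnegrE ?(ltW H_gt0)// /t mul1r.
rewrite powR1 in h1.
have : (-1 * t 0 `^ H) ^+ 2 <= 1.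
  by rewrite mulN1r sqrrN -[leRHS](expr1n _ 2) lerXn2r ?nnegrE.
lra.
Qed.

Section drifted.
Variables (m n' q : nat) (v : R).
Hypotheses (m0 : (0 < m)%N) (mn : (n'.+1 * m <= n.+1)%N) (q0 : (0 < q)%N).
Let lam := m%:R * delta.
Hypotheses (lam1 : 1 <= lam) (v0 : 0 < v) (v1 : v <= 1).
Hypothesis hv : (2 * (1 + 0) * lam `^ (- (2 * H)) +
  16 * (1 + ln q%:R) * lam `^ (- cov_exp H)) * lam `^ H <= v.

Let lam0 : 0 < lam. Proof. exact: lt_le_trans lam1. Qed.
Let Q := log_drift H q.
Let V := lin_cov H Q Q.
Let U := expR 2 * eneg X lam n' + expR (- (2 * v ^+ 2)^-1).
Let p1 := \int[P]_w (orthant n.+1 (grid X delta) (fun i => - drift H q (t i)) w).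

(** Time [i.+1 * lam] is a fine grid time, of index [(i.+1 * m).-1] since indices start at the first
    mesh point. The coarse grid is there for [grid_shift_bound], which needs a large mesh. *)
Let subgrid w : S w <= orthant n'.+1 (grid X lam) (fun=> 0) w.
Proof.
rewrite /S !orthantE; case: allP => [h|_]; last by rewrite ler0n.
rewrite (_ : all _ _ = true)//; apply/allP => i; rewrite mem_index_iota => /= ilt.
have i1 : (0 < i.+1 * m)%N by rewrite muln_gt0.
have -> : grid X lam i w = grid X delta (i.+1 * m).-1 w.
  by rewrite /grid prednK// natrM -mulrA.
apply: h; rewrite mem_index_iota /= prednK//.
by apply: leq_trans mn; rewrite leq_mul2r ilt orbT.
Qed.

(* Cauchy-Schwarz for the tilts by [Q] and [- Q]: the first produces the
   probability of staying below [- drift], the second that of staying below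
   [drift], which [grid_shift_bound] controls on the coarser grid. *)
Lemma persistence_drift : PS ^+ 2 <= expR V * p1 * U.
Proof.
have nQ : nonneg_times Q by exact: nonneg_log_drift.
have nQ' := nonneg_opp nQ.
have mS : measurable_fun setT S by exact: measurable_orthant.
have iA := integrable_expR_orthant fbm n.+1 (fun=> 0) nQ mg.
have iB := integrable_expR_orthant fbm n.+1 (fun=> 0) nQ' mg.
pose A := \int[P]_w (expR (lin X Q w) * S w).
pose B := \int[P]_w (expR (lin X (opp_lin Q) w) * S w).
have AE : A = expR (V / 2) * p1.
  rewrite /A /S /V (Rintegral_cameron_martin fbm n.+1 (fun=> 0) nQ t_ge0).
  congr (_ * _); apply: eq_Rintegral => w _; rewrite /orthant.
  by apply: eq_bigr => i _; rewrite sub0r.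
have p0 : 0 <= p1 by apply: Rintegral_ge0 => w _; exact: orthant_ge0.
have U0 : 0 <= U by rewrite addr_ge0 ?mulr_ge0 ?expR_ge0 ?eneg_ge0.
have BU : B <= expR (V / 2) * U.
  have mg' i : measurable_fun setT (grid X lam i) by exact: measurable_grid.
  have t0' i : 0 <= i.+1%:R * lam by rewrite mulr_ge0// ltW.
  apply: (@le_trans _ _ (\int[P]_w (expR (lin X (opp_lin Q) w) *
      orthant n'.+1 (grid X lam) (fun=> 0) w))).
    apply: le_Rintegral => //; first exact: (integrable_expR_orthant fbm _ _ nQ' mg').
    by move=> w _; rewrite ler_wpM2l ?expR_ge0.
  rewrite (Rintegral_cameron_martin fbm n'.+1 (fun=> 0) nQ' t0').
  rewrite lin_cov_oppl lin_covC lin_cov_oppl opprK ler_wpM2l ?expR_ge0//.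
  apply: (grid_shift_bound H_gt0 fbm lam0 (lexx 0) _ v0 v1 hv).
    by rewrite mulr_ge0// addr_ge0// ln_ge0// ler1n.
  move=> i ilt; rewrite sub0r lin_cov_oppl opprK add0r.
  by apply: drift_upper => //; rewrite ler_peMl ?ler1n// ltW.
(* The inequality z + 1/z >= 2 with a free scale [al]; optimizing over [al] after integration gives
   Cauchy-Schwarz. *)
have pw w (al : R) : 0 < al ->
    S w <= 2^-1 * (al * (expR (lin X Q w) * S w)) +
           2^-1 * (al^-1 * (expR (lin X (opp_lin Q) w) * S w)).
  move=> al0; rewrite lin_opp.
  have s0 : 0 <= S w by exact: orthant_ge0.
  have h : 2 <= al * expR (lin X Q w) + al^-1 * expR (- lin X Q w).
    have e0 : 0 < al * expR (lin X Q w) by rewrite mulr_gt0 ?expR_gt0.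
    rewrite expRN -invfM; move: e0; set z := al * _ => z0.
    have e : z + z^-1 - 2 = (z - 1) ^+ 2 / z by field; rewrite gt_eqF.
    by rewrite -subr_ge0 e divr_ge0 ?sqr_ge0// ltW.
  have := ler_wpM2r s0 h.
  move: (expR (lin X Q w)) (expR (- lin X Q w)) (al^-1) (S w) => a b c e; lra.
have PSle (al : R) : 0 < al -> PS <= 2^-1 * (al * A) + 2^-1 * (al^-1 * B).
  move=> al0; have jA := integrableZl measurableT 2^-1 (integrableZl measurableT al iA).
  have jB := integrableZl measurableT 2^-1 (integrableZl measurableT al^-1 iB).
  apply: (@le_trans _ _ (\int[P]_w (2^-1 * (al * (expR (lin X Q w) * S w)) +
           2^-1 * (al^-1 * (expR (lin X (opp_lin Q) w) * S w))))).
    apply: le_Rintegral => //.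
      exact: (integrableD measurableT jA jB).
    by move=> w _; exact: pw.
  rewrite (RintegralD measurableT jA jB).
  rewrite !(RintegralZl _ measurableT (integrableZl measurableT _ iA)).
  rewrite !(RintegralZl _ measurableT (integrableZl measurableT _ iB)).
  by rewrite !(RintegralZl _ measurableT iA) !(RintegralZl _ measurableT iB).
have A0 : 0 <= A by rewrite AE mulr_ge0 ?expR_ge0.
have B0 : 0 <= B.
  by apply: Rintegral_ge0 => w _; rewrite mulr_ge0 ?expR_ge0 ?orthant_ge0.
have PS0 : 0 <= PS by apply: Rintegral_ge0 => w _; exact: orthant_ge0.
apply: (@le_trans _ _ (A * B)); last first.
  apply: (@le_trans _ _ (A * (expR (V / 2) * U))); first by rewrite ler_wpM2l.
  have -> : expR V = expR (V / 2) * expR (V / 2) by rewrite -expRD -splitr.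
  by rewrite AE le_eqVlt; apply/orP; left; apply/eqP; ring.
move: PS0; rewrite le_eqVlt => /predU1P[<-|PS0].
  by rewrite expr0n/= mulr_ge0.
move: B0; rewrite le_eqVlt => /predU1P[B0|B0].
  rewrite -B0 mulr0.
  (* For B = 0 this scale yields PS <= PS / 2, which is absurd. *)
  have := PSle (PS / (A + 1)) _; rewrite -B0 !mulr0 addr0 => h.
  have A1 : 0 < A + 1 by rewrite ltr_wpDl.
  have := h (divr_gt0 PS0 A1).
  have : PS / (A + 1) * A <= PS.
    rewrite mulrAC ler_pdivrMr// ler_wpM2l ?(ltW PS0)//; lra.
  lra.
(* With al = B / PS the second term is PS / 2, which leaves PS <= A B / PS. *)
have := PSle (B / PS) (divr_gt0 B0 PS0).
rewrite invf_div divfK ?gt_eqF// => h.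
have h2 : PS <= B / PS * A by lra.
by rewrite mulrAC ler_pdivlMr// -expr2 mulrC in h2.
Qed.

End drifted.

Section path_control.
Variables (T k theta : R) (q : nat).
Hypotheses (T0 : 0 < T) (k0 : 0 < k) (theta1 : 1 <= theta).
Hypotheses (nT : T <= n.+2%:R * delta) (nq : n.+1%:R * delta <= q%:R).

(** Bounds the exponential integral of a path that stays below minus the drift on the grid: [expR 2]
    for the first mesh interval, where the drift gives no control, and [4 * expR 1] for the
    telescoping sum over the others. *)
Definition exit_cst : R := expR 2 + 4 * expR 1.

Let O w := orthant n.+1 (grid X delta) (fun i => - drift H q (t i)) w.
Let s j : R := j%:R * delta.
Let s_ge0 j : 0 <= s j. Proof. by rewrite mulr_ge0// ltW. Qed.
Let bad j w : R := (delta * expR (X (s j) w + 1) <= expint (s j) (s j + delta) w)%R%:R.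
Let C0 := exit_cst.

Let C0_gt0 : 0 < C0.
Proof. by rewrite addr_gt0 ?mulr_gt0 ?expR_gt0. Qed.

Let expint_sum j w : expint 0 (s j) w = \sum_(0 <= i < j) expint (s i) (s i + delta) w.
Proof.
elim: j => [|j ih].
  rewrite big_nil /s mul0r /expint set_itv1 Rintegral_set1//.
rewrite big_nat_recr//= -ih /s -natr1 mulrDl mul1r.
by rewrite -(expint_add fbm)// ?s_ge0// lerDl ltW.
Qed.

(** On the event in [O] the integral up to T is at most [C0], unless a short interval is bad or X 0
    >= 1. In either exceptional case one of the last two terms is at least 1. *)
Let pointwise w : O w <= C0 `^ k * exp_functional_inv X T w `^ k +
  (\sum_(0 <= j < n.+2) bad j w + expR (- theta) * expR (theta * X 0 w)).
Proof.
have b0 j : 0 <= bad j w by rewrite ler0n.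
have sb0 : 0 <= \sum_(0 <= j < n.+2) bad j w by exact: sumr_ge0.
have e0 : 0 <= expR (- theta) * expR (theta * X 0 w) by rewrite mulr_ge0 ?expR_ge0.
have c0 : 0 <= C0 `^ k * exp_functional_inv X T w `^ k by rewrite mulr_ge0 ?powR_ge0.
have O1 : O w <= 1 by rewrite /O orthantE lern1 leq_b1.
have [hb|hb] := boolP (all (fun i => bad i w == 0) (index_iota 0 n.+2)); last first.
  have [i ilt bi] : exists2 i, (i < n.+2)%N & bad i w = 1.
    move/allPn : hb => [i]; rewrite mem_index_iota => /= ilt bi; exists i => //.
    by move: bi; rewrite /bad; case: (_ <= _)%R; rewrite ?eqxx.
  have s1 : 1 <= \sum_(0 <= j < n.+2) bad j w.
    by rewrite big_mkord (bigD1 (Ordinal ilt))//= bi lerDl sumr_ge0.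
  lra.
(* X 0 vanishes only almost surely, so the event X 0 >= 1 is charged to an exponential moment. *)
have [X0|X0] := leP 1 (X 0 w).
  have : 1 <= expR (- theta) * expR (theta * X 0 w).
    rewrite -expRD -[leLHS]expR0 ler_expR addrC subr_ge0 ler_peMr//.
    exact: le_trans theta1.
  lra.
have [h00|h01] : O w = 0 \/ all (fun i => grid X delta i w <= - drift H q (t i)) (index_iota 0 n.+1).
  by rewrite /O orthantE; case: all; [right|left].
  by rewrite h00; lra.
suff AT : expint 0 T w <= C0.
  have A0 : 0 < expint 0 T w by exact: (expint_gt0 fbm).
  have : 1 <= C0 `^ k * exp_functional_inv X T w `^ k.
    have -> : exp_functional_inv X T w = (expint 0 T w)^-1 by [].
    rewrite -powRM ?invr_ge0 ?(ltW A0) ?(ltW C0_gt0)//.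
    have h1 : 1 <= C0 * (expint 0 T w)^-1 by rewrite ler_pdivlMr// mul1r.
    by rewrite -(powRr0 (C0 * (expint 0 T w)^-1)) ler_powR// ltW.
  lra.
apply: (@le_trans _ _ (expint 0 (s n.+2) w)).
  by apply: (expint_subset fbm) => //; exact: ltW.
rewrite expint_sum big_nat_recl//=.
have good j : (j < n.+2)%N -> expint (s j) (s j + delta) w <= delta * expR (X (s j) w + 1).
  move=> jlt; move/allP/(_ j) : hb; rewrite mem_index_iota => /(_ jlt).
  by rewrite /bad; case: (leP (delta * _)) => [_|/ltW//]; rewrite oner_eq0.
have e1 := expR_gt0 (1 : R).
have h0 : expint (s 0) (s 0 + delta) w <= expR 2.
  apply: le_trans (good 0%N isT) _.
  have -> : s 0 = 0 by rewrite /s mul0r.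
  have : expR (X 0 w + 1) <= expR 2 by rewrite ler_expR; lra.
  have := expR_gt0 (X 0 w + 1); move: (expR _) (expR 2) => a b a0 ab.
  by apply: le_trans ab; rewrite ler_piMl// ltW.
(* The drift at the left endpoint bounds the integral over this interval by 4 e delta / (1 + s
   i.+1)^2, which is below a telescoping term. *)
have hi i : (i < n.+1)%N -> expint (s i.+1) (s i.+1 + delta) w <=
    4 * expR 1 * ((1 + s i)^-1 - (1 + s i.+1)^-1).
  move=> ilt; apply: le_trans (good i.+1 ilt) _.
  have gi : X (s i.+1) w <= - drift H q (s i.+1).
    by move/allP/(_ i) : h01; rewrite mem_index_iota => /(_ ilt).
  have sq : s i.+1 <= q%:R.
    by apply: le_trans nq; rewrite ler_wpM2r ?(ltW delta0)// ler_nat.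
  have dl := drift_lower H_gt0 (s_ge0 i.+1) sq.
  have x0 : 0 < 1 + s i by rewrite ltr_pwDl.
  have y0 : 0 < 1 + s i.+1 by rewrite ltr_pwDl.
  have sS : s i.+1 = s i + delta by rewrite /s -natr1 mulrDl mul1r.
  apply: (@le_trans _ _ (delta * (expR 1 * (4 / (1 + s i.+1) ^+ 2)))).
    rewrite ler_pM2l// addrC expRD ler_pM2l//.
    by apply: le_trans dl; rewrite ler_expR.
  have -> : (1 + s i)^-1 - (1 + s i.+1)^-1 = delta / ((1 + s i) * (1 + s i.+1)).
    by rewrite sS in y0 *; field; rewrite !gt_eqF.
  have -> : delta * (expR 1 * (4 / (1 + s i.+1) ^+ 2)) =
    4 * expR 1 * (delta / (1 + s i.+1) ^+ 2) by ring.
  rewrite ler_wpM2l ?mulr_ge0 ?expR_ge0// ler_pM2l// lef_pV2 ?posrE ?exprn_gt0 ?mulr_gt0//.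
  by rewrite expr2 ler_pM2r// lerD2l sS lerDl ltW.
have tele j : \sum_(0 <= i < j) 4 * expR 1 * ((1 + s i)^-1 - (1 + s i.+1)^-1) =
    4 * expR 1 * (1 - (1 + s j)^-1).
  rewrite -mulr_sumr; congr (_ * _); elim: j => [|j ih].
    by rewrite big_nil /s mul0r addr0 invr1 subrr.
  by rewrite big_nat_recr//= ih; ring.
rewrite /C0 /exit_cst; apply: lerD => //.
apply: (@le_trans _ _ (\sum_(0 <= i < n.+1)
   4 * expR 1 * ((1 + s i)^-1 - (1 + s i.+1)^-1))).
  by apply: ler_sum_nat => i /andP[_ ilt]; exact: hi.
rewrite tele ler_piMr ?mulr_ge0 ?expR_ge0// gerBl invr_ge0.
by rewrite addr_ge0.
Qed.

Let mX u : measurable_fun setT (X u). Proof. exact: measurable_funPT. Qed.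

Let mbad j : measurable_fun setT (bad j).
Proof.
apply: measurable_ler_indic; last exact: (measurable_expint fbm).
apply: measurable_funM => //; apply: measurableT_comp => //.
exact: measurable_funD.
Qed.

Lemma persistence_le_moment : ((\int[P]_w O w)%:E <=
  (C0 `^ k)%:E * 'E_P[(fun w => exp_functional_inv X T w `^ k)%R] +
  (n.+2%:R * expR (- theta + (theta * delta `^ H) ^+ 2 / 2) + expR (- theta))%:E)%E.
Proof.
rewrite unlock.
have mJ := measurable_exp_functional_inv fbm T k.
have mS : measurable_fun setT (fun w => \sum_(0 <= j < n.+2) bad j w).
  exact: measurable_sum.
have me : measurable_fun setT (fun w => expR (- theta) * expR (theta * X 0 w)).
  by apply: measurable_funM => //; apply: measurableT_comp => //; exact: measurable_funM.
have S0 w : 0 <= \sum_(0 <= j < n.+2) bad j w.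
  by apply: sumr_ge0 => i _; rewrite ler0n.
have e0 w : 0 <= expR (- theta) * expR (theta * X 0 w).
  by rewrite mulr_ge0 ?expR_ge0.
have J0 w : 0 <= C0 `^ k * exp_functional_inv X T w `^ k.
  by rewrite mulr_ge0 ?powR_ge0.
have iO : P.-integrable setT (fun w => (O w)%:E) by exact: integrable_orthant.
rewrite /Rintegral fineK; last exact: integrable_fin_num iO.
apply: (@le_trans _ _ (\int[P]_w (C0 `^ k * exp_functional_inv X T w `^ k +
  (\sum_(0 <= j < n.+2) bad j w + expR (- theta) * expR (theta * X 0 w)))%:E)%E).
  apply: ge0_le_integral => //.
  - by move=> w _; rewrite lee_fin orthant_ge0.
  - by apply/measurable_EFinP; exact: measurable_orthant.
  - apply/measurable_EFinP; apply: measurable_funD; last exact: measurable_funD.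
    exact: measurable_funM.
  - by move=> w _; rewrite lee_fin pointwise.
under eq_integral do rewrite 2!EFinD.
rewrite ge0_integralD//; last 4 first.
- by move=> w _; rewrite lee_fin.
- by apply/measurable_EFinP; exact: measurable_funM.
- by move=> w _; rewrite -EFinD lee_fin addr_ge0.
- by apply/measurable_EFinP; exact: measurable_funD.
apply: leeD.
  under eq_integral do rewrite EFinM.
  rewrite ge0_integralZl//.
  - exact/measurable_EFinP.
  - by move=> w _; rewrite lee_fin powR_ge0.
  - by rewrite lee_fin powR_ge0.
rewrite ge0_integralD//; last 3 first.
- by move=> w _; rewrite lee_fin.
- exact/measurable_EFinP.
- exact/measurable_EFinP.
rewrite EFinD; apply: leeD.
  under eq_integral do rewrite -sumEFin.
  rewrite ge0_integral_sum//; last 2 first.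
  - by move=> i; exact/measurable_EFinP.
  - by move=> i w _; rewrite lee_fin ler0n.
  apply: (@le_trans _ _ (\sum_(0 <= i < n.+2)
      (expR (- theta + (theta * delta `^ H) ^+ 2 / 2))%:E)%E).
    apply: lee_sum => i _; apply: (expint_upper_tail H_gt0 fbm) => //.
    exact: le_trans theta1.
  by rewrite sumEFin sumr_const_nat subn0 mulr_natl.
have i0 := integrable_expR_fbm fbm theta (lexx 0).
have h := Rintegral_expR_fbm H_gt0 fbm theta (lexx 0).
rewrite powR0 ?gt_eqF// mulr0 expr0n/= mul0r expR0 in h.
under eq_integral do rewrite EFinM.
rewrite ge0_integralZl//; last first.
  by apply/measurable_EFinP; apply: measurableT_comp => //; exact: measurable_funM.
rewrite -(@fineK _ (\int[P]_w _)%E); last exact: integrable_fin_num i0.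
by rewrite [fine _]h mule1.
Qed.

End path_control.

End moment_lower_bound.

(** * Choice of the parameters *)

Section logarithmic_scales.
Context {R : realType}.

Lemma powR_le_expR (a x : R) : 0 < a -> 0 <= x -> x `^ a <= a `^ a * expR x.
Proof.
move=> a0 x0.
have h : x <= a * expR (x / a).
  have := expR_ge1Dx (x / a); rewrite -(ler_pM2l a0) mulrDr mulr1 mulrCA divff ?gt_eqF//.
  by rewrite mulr1; lra.
apply: (@le_trans _ _ ((a * expR (x / a)) `^ a)).
  by rewrite ge0_ler_powR ?nnegrE ?mulr_ge0 ?expR_ge0 ?(ltW a0).
by rewrite powRM ?expR_ge0 ?(ltW a0)// -expRM divfK ?gt_eqF.
Qed.

(** The left side is the error term of [grid_shift_bound] for v = C / L; with L = ln T it is at most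
    1/T. *)
Lemma expR_gauss_le (C L : R) : 0 < C -> 0 < L -> 2 * C ^+ 2 <= L ->
  expR (- (2 * (C / L) ^+ 2)^-1) <= expR (- L).
Proof.
move=> C0 L0 CL; rewrite ler_expR lerN2.
have -> : (2 * (C / L) ^+ 2)^-1 = L ^+ 2 / (2 * C ^+ 2).
  by field; rewrite !gt_eqF.
rewrite ler_pdivlMr ?mulr_gt0 ?exprn_gt0// expr2 ler_pM2l//.
Qed.

End logarithmic_scales.

Section asymptotics.
Context {R : realType} (H : R) (H_gt0 : 0 < H) (H_lt1 : H < 1).

(** The tilt in [grid_shift_bound] has standard deviation of order ln T times lam^(- gap_exp); with
    lam = (ln T)^mesh_exp this becomes 1 / ln T. *)
Definition gap_exp : R := cov_exp H - H.
Definition mesh_exp : R := 2 / gap_exp.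

Lemma gap_exp_gt0 : 0 < gap_exp.
Proof.
by rewrite subr_gt0 /cov_exp lt_min H_lt1/= mulr_natl mulr2n ltrDl.
Qed.

Lemma mesh_exp_gt0 : 0 < mesh_exp.
Proof. by rewrite divr_gt0// gap_exp_gt0. Qed.

Lemma drift_mesh_le (L lam A B : R) : 1 <= L -> L `^ mesh_exp <= lam ->
  0 <= A -> 0 <= B ->
  (A * lam `^ (- (2 * H)) + B * lam `^ (- cov_exp H)) * lam `^ H <=
  (A + B) / L ^+ 2.
Proof.
move=> L1 Ll A0 B0.
have L0 : 0 < L by exact: lt_le_trans L1.
have lam1 : 1 <= lam.
  by apply: le_trans Ll; rewrite -(powRr0 L) ler_powR// ltW// mesh_exp_gt0.
have lam0 : 0 < lam by exact: lt_le_trans lam1.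
have E a b : lam `^ a * lam `^ b = lam `^ (a + b).
  by rewrite powRD// (gt_eqF lam0) implybT.
rewrite [leLHS]mulrDl -2!mulrA !E [leRHS]mulrDl.
have h : lam `^ (- gap_exp) <= (L ^+ 2)^-1.
  rewrite powRN lef_pV2 ?posrE ?powR_gt0 ?exprn_gt0//.
  have -> : L ^+ 2 = (L `^ mesh_exp) `^ gap_exp.
    by rewrite -powRrM /mesh_exp divfK ?(gt_eqF gap_exp_gt0)// -powR_mulrn// ltW.
  by rewrite ge0_ler_powR ?nnegrE ?powR_ge0 ?(ltW lam0) ?(ltW gap_exp_gt0).
have mu2 : cov_exp H <= 2 * H by rewrite /cov_exp ge_min lexx orbT.
apply: lerD; apply: ler_wpM2l => //; apply: le_trans h; apply: ler_powR => //.
  rewrite /gap_exp; lra.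
rewrite /gap_exp; lra.
Qed.

Lemma mesh_le_horizon (T : R) : 0 < T -> 1 <= ln T ->
  2 * (mesh_exp + 1) `^ (mesh_exp + 1) <= ln T -> 2 * ln T `^ mesh_exp <= T.
Proof.
move=> T0; set L := ln T; set lam := L `^ mesh_exp => L1 hB.
have L0 : 0 < L by lra.
have := powR_le_expR (addr_gt0 mesh_exp_gt0 ltr01) (ltW L0).
rewrite {1}powRD ?(gt_eqF L0) ?implybT// powRr1 ?(ltW L0)// /L lnK// -/L -/lam => h.
have h2 : lam * L <= L / 2 * T.
  have hB' : (mesh_exp + 1) `^ (mesh_exp + 1) <= L / 2 by lra.
  by apply: le_trans h _; rewrite ler_wpM2r ?(ltW T0).
rewrite -(ler_pM2r L0) -mulrA; move: h2; rewrite mulrAC [L * T]mulrC.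
move: (lam * L) (T * L) => x y; lra.
Qed.

Context d (Omega : measurableType d) (P : probability Omega R).
Variable X : R -> {RV P >-> R}.
Hypothesis fbm : fractional_brownian_motion H X.

(** [M] plays the role of the mesh: the last hypothesis says that the grid covers a fixed fraction
    of [0, T], so that dividing by n + 1 costs a factor 4 M / T. *)
Lemma eneg_upper_log (T lam M : R) n : 0 < T -> 1 <= ln T -> 0 < lam -> 0 <= M ->
  n.+1%:R * lam <= 2 * T -> n.+1%:R <= 2 * T -> T <= 4 * M * n.+1%:R ->
  eneg X lam n <= 32 * M * ln T * T `^ (- (1 - H)).
Proof.
move=> T0 L1 lam0 M0 nl n2 Tn.
apply: le_trans (eneg_upper H_gt0 fbm lam0 n) _.
have n0 : 0 < n.+1%:R :> R by rewrite ltr0n.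
have TH : T `^ H = T * T `^ (- (1 - H)).
  rewrite -{2}(powRr1 (ltW T0)) -powRD ?(gt_eqF T0) ?implybT//.
  by congr (_ `^ _); ring.
have a1 : (n.+1%:R * lam) `^ H <= 2 * T `^ H.
  apply: (@le_trans _ _ ((2 * T) `^ H)).
    by rewrite ge0_ler_powR ?nnegrE ?(ltW H_gt0)// mulr_ge0// ltW.
  rewrite powRM ?(ltW T0)// ler_wpM2r ?powR_ge0//.
  by apply: ler1_powR; [lra|exact: ltW].
have a2 : 2 + ln n.+1%:R <= 4 * ln T.
  have : ln n.+1%:R <= ln (2 * T) by rewrite ler_ln// posrE mulr_gt0.
  rewrite lnM ?posrE//; have := @le_ln1Dx R 1; rewrite (_ : 1 + 1 = 2) ?natr1//.
  by move=> /(_ ltac:(lra)); lra.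
have l0 : 0 <= 2 + ln n.+1%:R :> R by rewrite addr_ge0// ln_ge0// ler1n.
rewrite ler_pdivrMr//.
apply: (@le_trans _ _ (2 * T `^ H * (4 * ln T))).
  by apply: ler_pM => //; exact: powR_ge0.
rewrite TH.
have D0 := powR_ge0 T (- (1 - H)).
have : T * (8 * ln T * T `^ (- (1 - H))) <= 4 * M * n.+1%:R * (8 * ln T * T `^ (- (1 - H))).
  by apply: ler_wpM2r => //; rewrite mulr_ge0// mulr_ge0//; lra.
move: (ln T) (T `^ _) (n.+1%:R) => l D N; lra.
Qed.

Lemma moment_upper_log (k : R) : 0 < k -> exists M C : R, forall T : R, 0 < T ->
  M <= ln T ->
  ('E_P[(fun w => exp_functional_inv X T w `^ k)%R] <=
    (C * (T `^ (- (1 - H)) * ln T `^ (1 + mesh_exp)))%:E)%E.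
Proof.
move=> k0.
have tailE (x y : R) : 6 * y <= x -> y + (y + (- x + x / 2)) <= - y by lra.
have sumE (a e z x y g w : R) : z <= g -> z * x <= g * x -> y <= g ->
    w <= a * (e * (32 * g) + g) -> z + 2^-1 * (z * x) + 2^-1 * y + w <=
    (1 + 2^-1 * x + 2^-1 + a * (e * 32 + 1)) * g by lra.
have b0 := mesh_exp_gt0.
pose b1 := mesh_exp + 1.
have b10 : 0 < b1 by rewrite addr_gt0.
(* Chosen so that C L bounds 2 (1 + r) + 4 k, where r = 1 + L / k + ln L / H. *)
pose C := 4 + 2 / k + 2 / H + 4 * k.
have k'0 : 0 < 2 / k by rewrite divr_gt0.
have H'0 : 0 < 2 / H by rewrite divr_gt0.
have C0 : 0 < C by rewrite /C; lra.
exists (6 + C + 2 * C ^+ 2 + 2 * b1 `^ b1).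
pose e2 : R := expR 2; pose ek := expR (k ^+ 2 / 2).
exists (1 + 2^-1 * expR ((2 * k) ^+ 2 / 2) + 2^-1 + ek * (e2 * 32 + 1)) => T T0.
set L := ln T => ML.
have c2 : 0 <= C ^+ 2 by rewrite exprn_ge0// ltW.
have bb0 := powR_ge0 b1 b1.
have L6 : 6 <= L by lra.
have L1 : 1 <= L by lra.
have L0 : 0 < L by lra.
have CL : 2 * C ^+ 2 <= L by lra.
have TE : T = expR L by rewrite /L lnK.
have TVE : T^-1 = expR (- L) by rewrite TE expRN.
have T1 : 1 <= T by rewrite TE -expR0 ler_expR ltW.
pose lam := L `^ mesh_exp.
have lam1 : 1 <= lam by rewrite /lam -(powRr0 L) ler_powR// ltW.
have lam0 : 0 < lam by lra.
have lamT : 2 * lam <= T by apply: mesh_le_horizon => //; rewrite -/b1 -/L; lra.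
pose eta := L `^ (- H^-1).
have eta0 : 0 < eta by rewrite powR_gt0.
have eta1 : eta <= 1.
  by rewrite -(powRr0 L) ler_powR// oppr_le0 invr_ge0 ltW.
have etaH : eta `^ H = L^-1.
  by rewrite /eta -powRrM mulNr mulVf ?gt_eqF// powR_inv1// ltW.
(* Since theta eta^H = L, a short interval is bad with probability at most expR (- L^2 / 2), smaller
   than any power of 1/T. *)
pose theta := L ^+ 2.
(* The grid fills at most half of [0, T], which leaves room for the last interval of length [eta],
   and still N >= T / (4 lam). *)
pose N := Num.truncn (T / (2 * lam)).
have x1 : 1 <= T / (2 * lam) by rewrite ler_pdivlMr ?mulr_gt0// mul1r.
have N0 : (0 < N)%N by rewrite truncn_gt0.
have NE : N.-1.+1 = N by rewrite prednK.
have /andP[Nle Ngt] := truncn_itv (le_trans ler01 x1).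
rewrite -/N in Nle Ngt; rewrite -[N.+1%:R]natr1 in Ngt.
have N1 : 1 <= N%:R :> R by rewrite ler1n.
have Nlam : N%:R * (2 * lam) <= T by rewrite -ler_pdivlMr ?mulr_gt0.
have NT : T <= 4 * lam * N%:R.
  have : T < (N%:R + 1) * (2 * lam) by rewrite -ltr_pdivrMr ?mulr_gt0.
  have : (N%:R + 1) * (2 * lam) <= (2 * N%:R) * (2 * lam).
    by rewrite ler_pM2r ?mulr_gt0//; move: N1; move: (N%:R) => a; lra.
  move: (N%:R) => a; lra.
have NleT : N%:R <= T.
  apply: le_trans Nlam; rewrite ler_peMr//; lra.
have lnL : ln L <= L by exact/ltW/ln_sublinear.
have lneta : ln eta = - (H^-1 * ln L) by rewrite /eta ln_powR mulNr.
have lnL0 : 0 <= ln L by rewrite ln_ge0.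
have Hi0 : 0 < H^-1 by rewrite invr_gt0.
have ki0 : 0 < k^-1 by rewrite invr_gt0.
pose r := 1 + L / k - ln eta.
have r0 : 0 <= r.
  by rewrite /r lneta opprK !addr_ge0// ?divr_ge0 ?mulr_ge0// ltW.
have rL : 2 * (1 + r) + 4 * k <= C * L.
  have : H^-1 * ln L <= H^-1 * L by rewrite ler_wpM2l// ltW.
  have := ler_wpM2l (ltW k0) L1.
  rewrite /r /C lneta; move: (k^-1) (H^-1) (ln L) => x y l; lra.
pose v := C / L.
have v0 : 0 < v by rewrite divr_gt0.
have v1 : v <= 1 by rewrite ler_pdivrMr// mul1r; lra.
have hv : (2 * (1 + r) * lam `^ (- (2 * H)) + 4 * k * lam `^ (- cov_exp H)) *
    lam `^ H <= v.
  apply: le_trans (drift_mesh_le L1 (lexx _) _ _) _.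
  - by rewrite mulr_ge0// addr_ge0.
  - by rewrite mulr_ge0// ltW.
  - rewrite /v expr2 invfM mulrA ler_wpM2r ?invr_ge0 ?(ltW L0)//.
    by rewrite ler_pdivrMr.
have nT : N.-1.+1%:R * lam + eta <= T.
  rewrite NE [leRHS]splitr lerD//; first by rewrite ler_pdivlMr// mulrC mulrCA.
  by rewrite (le_trans eta1)// (le_trans lam1)// ler_pdivlMr// mulrC.
have th0 : 0 <= theta by rewrite exprn_ge0// ltW.
apply: le_trans (moment_upper H_gt0 H_lt1 fbm k0 T1 lam1 eta0 nT th0 v0 v1 r0 hv) _.
rewrite lee_fin.
set D := T `^ (- (1 - H)); set G := L `^ (1 + mesh_exp).
have GE : G = L * lam.
  by rewrite /G powRD ?(gt_eqF L0) ?implybT// powRr1// ltW.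
have G1 : 1 <= G by rewrite GE -[1]mulr1 ler_pM.
have D0 : 0 <= D by exact: powR_ge0.
have TD : T^-1 <= D.
  by rewrite -(powR_inv1 (ltW T0)) ler_powR// lerN2 gerBl ltW.
have TDG : T^-1 <= D * G.
  by apply: le_trans TD _; rewrite ler_peMr.
have en : eneg X lam N.-1 <= 32 * (D * G).
  have T2 : T <= 2 * T by rewrite ler_peMl ?(ltW T0)// ler1n.
  have N2 : N%:R * lam <= 2 * T.
    by apply: le_trans T2; apply: le_trans nT; rewrite NE lerDl ltW.
  rewrite -NE in N2 NT NleT.
  apply: le_trans (eneg_upper_log T0 L1 lam0 (ltW lam0) N2 (le_trans NleT T2) NT) _.
  by rewrite GE /D -/L le_eqVlt; apply/orP; left; apply/eqP; ring.
have gau : expR (- (2 * v ^+ 2)^-1) <= D * G.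
  by apply: le_trans TDG; rewrite TVE expR_gauss_le.
have tail : T * (N.-1.+1%:R * expR (- theta + (theta * eta `^ H) ^+ 2 / 2)) <= D * G.
  apply: le_trans TDG; rewrite NE etaH.
  have -> : theta / L = L by rewrite /theta expr2 mulfK// gt_eqF.
  apply: (@le_trans _ _ (T * (T * expR (- theta + L ^+ 2 / 2)))).
    by rewrite ler_pM2l// ler_pM2r ?expR_gt0.
  rewrite TVE {1 2}TE -!expRD ler_expR /theta.
  by apply: tailE; rewrite expr2 ler_pM2r.
have ex := expR_gt0 ((2 * k) ^+ 2 / 2).
have t1 : T^-1 * expR ((2 * k) ^+ 2 / 2) <= (D * G) * expR ((2 * k) ^+ 2 / 2).
  by rewrite ler_pM2r.
have t2 : ek * (e2 * eneg X lam N.-1 + expR (- (2 * v ^+ 2)^-1)) <=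
    ek * (e2 * (32 * (D * G)) + D * G).
  rewrite ler_wpM2l ?expR_ge0//; apply: lerD => //.
  by rewrite ler_wpM2l ?expR_ge0.
exact: sumE TDG t1 tail t2.
Qed.

End asymptotics.

Section moment_lower_asymptotics.
Context {R : realType} (H : R) (H_gt0 : 0 < H) (H_lt1 : H < 1).
Context d (Omega : measurableType d) (P : probability Omega R).
Variable X : R -> {RV P >-> R}.
Hypothesis fbm : fractional_brownian_motion H X.

(** The fine mesh: delta^H = 1 / ln T, so an increment over one step has standard deviation 1 / ln
    T. *)
Let delta (T : R) : R := ln T `^ (- H^-1).
Let size (T : R) : nat := Num.truncn (T / delta T).
Let D (T : R) : R := T `^ (- (1 - H)).

Let delta_gt0 (T : R) : 1 <= ln T -> 0 < delta T.
Proof. by move=> L1; rewrite powR_gt0// (lt_le_trans ltr01). Qed.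

Let delta_le1 (T : R) : 1 <= ln T -> delta T <= 1.
Proof. by move=> L1; rewrite -(powRr0 (ln T)) ler_powR// oppr_le0 invr_ge0 ltW. Qed.

Let deltaH (T : R) : 1 <= ln T -> delta T `^ H = (ln T)^-1.
Proof.
move=> L1; rewrite /delta -powRrM mulNr mulVf ?gt_eqF// powR_inv1//.
exact: le_trans L1.
Qed.

Let deltaV (T : R) : (delta T)^-1 = ln T `^ H^-1.
Proof. by rewrite /delta powRN invrK. Qed.

Let ln_le (T : R) : 0 < T -> 1 + ln T <= T.
Proof. by move=> T0; rewrite -{2}(lnK T0) expR_ge1Dx. Qed.

Let invr_expR (T : R) : 0 < T -> T^-1 = expR (- ln T).
Proof. by move=> T0; rewrite expRN lnK. Qed.

Let size_bounds (T : R) : 0 < T -> 1 <= ln T ->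
  [/\ (0 < size T)%N, (size T)%:R * delta T <= T &
      T < (size T).+1%:R * delta T].
Proof.
move=> T0 L1; have d0 := delta_gt0 L1.
have T1 : 1 <= T by have := ln_le T0; lra.
have x1 : 1 <= T / delta T.
  by rewrite ler_pdivlMr// mul1r (le_trans (delta_le1 L1)).
have /andP[] := truncn_itv (le_trans ler01 x1); rewrite -/(size T) => h1 h2.
by rewrite truncn_gt0 x1 -ler_pdivlMr// h1 -ltr_pdivrMr.
Qed.

Let D_ge (T : R) : 0 < T -> 1 <= ln T -> T^-1 <= D T.
Proof.
move=> T0 L1; have T1 : 1 <= T by have := ln_le T0; lra.
by rewrite -(powR_inv1 (ltW T0)) ler_powR//; have := H_gt0; lra.
Qed.

(** As D T >= 1/T and (ln T)^a <= a^a T, an error of order T^(-3) is absorbed by the main term in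
    spite of its logarithms. *)
Let D_over_log (a K e T : R) : 0 < a -> 0 < K -> 0 < T -> 1 <= ln T -> 0 < e ->
  e * (K * a `^ a) <= T -> e * T^-1 ^+ 3 <= D T / (K * ln T `^ a).
Proof.
move=> a0 K0 T0 L1 e0 eT; have L0 : 0 < ln T by exact: lt_le_trans L1.
rewrite ler_pdivlMr ?mulr_gt0 ?powR_gt0//.
apply: le_trans (D_ge T0 L1).
have := powR_le_expR a0 (ltW L0); rewrite lnK// => h.
apply: (@le_trans _ _ (e * T^-1 ^+ 3 * (K * (a `^ a * T)))).
  by rewrite !ler_pM2l ?mulr_gt0 ?exprn_gt0 ?invr_gt0.
have -> : e * T^-1 ^+ 3 * (K * (a `^ a * T)) = e * (K * a `^ a) / T * T^-1.
  by field; rewrite gt_eqF.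
by rewrite ler_piMl ?invr_ge0 ?(ltW T0)// ler_pdivrMr// mul1r.
Qed.

Let PS T := \int[P]_w orthant (size T).+1 (grid X (delta T)) (fun=> 0) w.
(** One factor (ln T)^(1/H) is lost in [eneg_lower], with constant [K]; another comes from the
    number of grid times, at most T (ln T)^(1/H). *)
Let a : R := 2 / H.
Let K : R := (40 * (3 + H^-1)) `^ H^-1.

Let Hi0 : 0 < H^-1. Proof. by rewrite invr_gt0. Qed.
Let a0 : 0 < a. Proof. by rewrite divr_gt0. Qed.
Let K0 : 0 < K. Proof. by rewrite powR_gt0// mulr_gt0// addr_gt0. Qed.

Let persistence_lower (T : R) : 0 < T -> 3 <= ln T ->
  expR 1 * (8 * K * a `^ a) <= ln T ->
  D T / (24 * K * ln T `^ (a + 1)) <= PS T.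
Proof.
move=> T0; set L := ln T => L3 hM.
have L1 : 1 <= L by lra.
have L0 : 0 < L by lra.
have d0 := delta_gt0 L1; have d1 := delta_le1 L1.
have [n0 nd nd'] := size_bounds T0 L1.
set n := size T in n0 nd nd' *.
have n1 : 1 <= n%:R :> R by rewrite ler1n.
have TL := ln_le T0; rewrite -/L in TL.
have h1 := eneg_lower H_gt0 fbm d0 n0.
(* The level 3 ln T makes the error [expR (1 - k)] equal to e T^(-3). *)
have kk0 : 0 <= 3 * L by rewrite mulr_ge0// ltW.
have h2 := eneg_le_persistence H_gt0 fbm n d0 d1 kk0.
rewrite -/(PS T) in h2.
pose Lh := L `^ H^-1.
have Lh0 : 0 < Lh by rewrite powR_gt0.
have LhE : Lh * Lh = L `^ a.
  rewrite /Lh -powRD ?(gt_eqF L0) ?implybT//; congr (_ `^ _); rewrite /a; field.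
  by rewrite gt_eqF.
have nT : n%:R <= T * Lh by rewrite /Lh -deltaV ler_pdivlMr.
have lnn : 2 + ln n%:R <= (3 + H^-1) * L.
  have : ln n%:R <= ln (T * Lh) by rewrite ler_ln ?posrE ?mulr_gt0// ltr0n.
  rewrite lnM ?posrE// /Lh ln_powR -/L.
  have : H^-1 * ln L <= H^-1 * L by rewrite ler_pM2l// ltW// ln_sublinear.
  move: (ln _) (H^-1) => x y; lra.
have ln0' : 0 <= 2 + ln n%:R :> R by rewrite addr_ge0// ln_ge0.
have e1 : (40 * (2 + ln n%:R)) `^ H^-1 <= K * Lh.
  have h3 : 0 <= 3 + H^-1 by rewrite addr_ge0// ltW.
  rewrite /K /Lh -powRM ?(ltW L0) ?mulr_ge0//.
  apply: ge0_ler_powR; rewrite ?nnegrE ?(ltW Hi0) ?mulr_ge0 ?(ltW L0)//.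
  by rewrite -mulrA ler_wpM2l.
have TH : T `^ H = T * D T.
  rewrite -{2}(powRr1 (ltW T0)) /D -powRD ?(gt_eqF T0) ?implybT//.
  by congr (_ `^ _); ring.
have e2 : T * D T / 2 <= (n%:R * delta T) `^ H.
  apply: (@le_trans _ _ ((2^-1 * T) `^ H)); last first.
    rewrite ge0_ler_powR ?nnegrE ?(ltW H_gt0) ?mulr_ge0 ?(ltW T0) ?(ltW d0)//.
    rewrite -natr1 mulrDl mul1r in nd'.
    have := ler_wpM2r (ltW d0) n1; rewrite mul1r.
    move: nd'; move: (n%:R * _) => x; lra.
  rewrite powRM ?(ltW T0)// TH mulrC ler_wpM2r//.
    by rewrite mulr_ge0 ?(ltW T0)// powR_ge0.
  by rewrite ger1_powR ?(ltW H_lt1)//; apply/andP; split; lra.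
have DT0 : 0 < D T by rewrite powR_gt0.
have e3 : D T / (4 * K * L `^ a) <= eneg X (delta T) n.
  apply: le_trans h1.
  have -> : D T / (4 * K * L `^ a) = T * D T / 2 / (T * Lh) / (2 * (K * Lh)).
    by rewrite -LhE; field; rewrite !gt_eqF.
  have p1 : 0 < (40 * (2 + ln n%:R)) `^ H^-1.
    by rewrite powR_gt0// mulr_gt0// ltr_wpDr// ln_ge0.
  apply: ler_pM.
  - by rewrite !mulr_ge0 ?invr_ge0 ?mulr_ge0 ?(ltW T0) ?(ltW DT0) ?(ltW Lh0).
  - by rewrite invr_ge0 !mulr_ge0 ?(ltW K0) ?(ltW Lh0).
  - apply: ler_pM => //.
    + by rewrite !mulr_ge0 ?(ltW T0) ?(ltW DT0).
    + by rewrite invr_ge0 mulr_ge0 ?(ltW T0) ?(ltW Lh0).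
    + by rewrite lef_pV2 ?posrE ?mulr_gt0// ltr0n.
  - by rewrite lef_pV2 ?posrE ?mulr_gt0// ler_pM2l.
have e4 : expR (1 - 3 * L) <= D T / (8 * K * L `^ a).
  have -> : 1 - 3 * L = 1 + 3%:R * - L by ring.
  rewrite expRD expRM_natl -invr_expR//.
  have K8 : 0 < 8 * K by rewrite mulr_gt0.
  have LT : L <= T by apply: le_trans TL; rewrite lerDr.
  exact: D_over_log a0 K8 T0 L1 (expR_gt0 1) (le_trans hM LT).
have La0 : 0 < L `^ a by rewrite powR_gt0.
have e5 : D T / (8 * K * L `^ a) <= 3 * L * PS T.
  have E : D T / (4 * K * L `^ a) = 2 * (D T / (8 * K * L `^ a)).
    by field; rewrite !gt_eqF.
  rewrite E in e3; lra.
rewrite powRD ?(gt_eqF L0) ?implybT// powRr1 ?(ltW L0)//.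
have -> : D T / (24 * K * (L `^ a * L)) = D T / (8 * K * L `^ a) / (3 * L).
  by field; rewrite !gt_eqF.
by rewrite ler_pdivrMr ?mulr_gt0// [leRHS]mulrC.
Qed.

Let b : R := mesh_exp H.
Let b0 : 0 < b. Proof. exact: mesh_exp_gt0. Qed.

(** [m] is the least number of fine steps exceeding (ln T)^b, so the coarse mesh is at most twice
    that; the N = (n + 1) div m coarse steps cover at least half of [0, T]. *)
Let coarse_grid (T : R) : 0 < T -> 1 <= ln T -> 2 * (b + 1) `^ (b + 1) <= ln T ->
  exists m n', [/\ (0 < m)%N, (n'.+1 * m <= (size T).+1)%N,
    1 <= m%:R * delta T, ln T `^ b <= m%:R * delta T &
    eneg X (m%:R * delta T) n' <= 32 * ln T `^ b * ln T * D T].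
Proof.
move=> T0; set L := ln T => L1 hB.
have L0 : 0 < L by exact: lt_le_trans L1.
have d0 := delta_gt0 L1; have d1 := delta_le1 L1.
have [n0 nd nd'] := size_bounds T0 L1.
have T1 : 1 <= T by apply: le_trans (ln_le T0); rewrite lerDl ltW.
set n := size T in n0 nd nd' *.
pose lam := L `^ b.
have lam1 : 1 <= lam by rewrite /lam -(powRr0 L) ler_powR// ltW.
have lam0 : 0 < lam by exact: lt_le_trans lam1.
have lamT : 2 * lam <= T by exact: mesh_le_horizon.
have x0 : 0 <= lam / delta T by rewrite divr_ge0// ltW.
have /andP[] := truncn_itv x0; set m := (Num.truncn _).+1.
rewrite ler_pdivlMr// ltr_pdivrMr// => m1 m2.
have m3 : m%:R * delta T <= 2 * lam.
  rewrite -[m%:R]natr1 mulrDl mul1r [leRHS]mulr_natl mulr2n; apply: lerD => //.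
  exact: le_trans lam1.
have md1 : 1 <= m%:R * delta T by exact/ltW/(le_lt_trans lam1).
have mn : (m <= n.+1)%N.
  rewrite ltnW// -(ltr_nat R) -(ltr_pM2r d0).
  by apply: le_lt_trans nd'; exact: le_trans lamT.
pose N := (n.+1 %/ m)%N.
have N0 : (0 < N)%N by rewrite divn_gt0.
have NE : N.-1.+1 = N by rewrite prednK.
have Nm : N%:R * (m%:R * delta T) <= n.+1%:R * delta T.
  by rewrite mulrA -natrM ler_pM2r// ler_nat leq_divM.
have T2 : n.+1%:R * delta T <= 2 * T.
  rewrite -[n.+1%:R]natr1 mulrDl mul1r [leRHS]mulr_natl mulr2n lerD//; exact: le_trans T1.
have TN : T <= 4 * lam * N%:R.
  apply: (@le_trans _ _ (2 * N%:R * (m%:R * delta T))).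
    apply/ltW/(lt_le_trans nd'); rewrite mulrA ler_pM2r// -!natrM ler_nat.
    apply: leq_trans (ltnW (ltn_ceil _ (isT : 0 < m)%N)) _.
    by rewrite leq_mul2r -/N mul2n -addnn -addn1 leq_add2l N0 orbT.
  have -> : 4 * lam * N%:R = 2 * N%:R * (2 * lam) by ring.
  by rewrite ler_wpM2l.
exists m, N.-1; rewrite NE; split => //; first exact: leq_divM.
  exact: ltW.
apply: eneg_upper_log => //; rewrite ?NE//.
- exact: lt_le_trans md1.
- exact: ltW.
- exact: le_trans T2.
- by apply: le_trans T2; apply: le_trans Nm; rewrite ler_peMr.
Qed.

(** [V0] comes from the variance of the drift, [u0] from the bound on [U], and 576 = 24^2 from
    squaring the bound of [persistence_lower]. *)
Let V0 : R := expR (16 * (1 + H^-1) ^+ 2).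
Let u0 : R := expR 2 * 32 + 1.
Let K2 : R := 576 * K ^+ 2 * V0 * u0.
(** Twice a + 1, as the lower bound for [PS] enters squared, plus 1 + b from the bound on [U]. *)
Let g : R := 4 / H + 3 + b.
(** At least T + 1, because the last grid time may exceed T by one mesh step and [drift_lower] has
    to reach it. *)
Let drift_len (T : R) : nat := (Num.truncn T).+2.
Let p1 (T : R) := \int[P]_w orthant (size T).+1 (grid X (delta T))
  (fun i => - drift H (drift_len T) (i.+1%:R * delta T)) w.

Let u0_gt0 : 0 < u0. Proof. by rewrite addr_gt0// mulr_gt0// expR_gt0. Qed.
Let K2_gt0 : 0 < K2.
Proof.
have n0 : 0 < 576 :> R by rewrite ltr0n.
exact: mulr_gt0 (mulr_gt0 (mulr_gt0 n0 (exprn_gt0 2 K0)) (expR_gt0 _)) u0_gt0.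
Qed.
Let g_gt0 : 0 < g. Proof. by rewrite !addr_gt0// divr_gt0. Qed.

Let logL (L : R) : 0 < L -> L `^ g = (L `^ (a + 1)) ^+ 2 * (L * L `^ b).
Proof.
move=> L0; have -> : g = (a + 1) + (a + 1) + (1 + b).
  by rewrite /g /a; field; rewrite gt_eqF.
set x := a + 1; have cd : L != 0 by rewrite gt_eqF.
by rewrite !powRD ?cd ?implybT// powRr1 ?(ltW L0)// expr2.
Qed.

Let drift_len_bounds (T : R) : 2 <= T ->
  T + 1 <= (drift_len T)%:R /\ ln (drift_len T)%:R <= 2 * ln T.
Proof.
move=> T2; have T0 : 0 < T by lra.
have /andP[] := truncn_itv (ltW T0); rewrite /drift_len.
rewrite -[(_).+2%:R]natr1 -[(_).+1%:R]natr1; set x := (Num.truncn T)%:R => h1 h2.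
split; first lra.
have -> : 2 * ln T = ln (T * T) by rewrite lnM ?posrE// mulr_natl mulr2n.
have x0 : 0 <= x by rewrite /x.
have TT := ler_wpM2r (ltW T0) T2.
rewrite ler_ln ?posrE ?mulr_gt0//; lra.
Qed.

(** In [persistence_drift] the square of [PS] carries two factors [D T] and [U] carries one, so one
    factor is left for [p1 T]. *)
Let drifted_lower (T : R) : 0 < T -> 5000 <= ln T ->
  expR 1 * (8 * K * a `^ a) <= ln T -> 2 * (b + 1) `^ (b + 1) <= ln T ->
  D T / (K2 * ln T `^ g) <= p1 T.
Proof.
move=> T0; set L := ln T => L5 hM hB.
have arith (x y : R) : 5000 <= y -> x <= 2 * y -> 2 * (1 + 0) + 16 * (1 + x) <= 50 * y.
  by lra.
have v1' : 50 <= L by lra.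
(* This is the origin of 5000: [expR_gauss_le] is used with C = 50, a bound for (2 + 16 (1 + 2 L)) /
   L. *)
have v2' : 2 * 50 ^+ 2 <= L by lra.
have L1 : 1 <= L by lra.
have L3 : 3 <= L by lra.
have L0 : 0 < L by exact: lt_le_trans L1.
have T2 : 2 <= T by apply: le_trans (ln_le T0); rewrite -/L; lra.
have d0 := delta_gt0 L1.
have [q1 q2] := drift_len_bounds T2.
have [m [n' [m0 mn md1 mdL en]]] := coarse_grid T0 L1 hB.
have PSl := persistence_lower T0 L3 hM.
pose v := 50 / L.
have v0 : 0 < v by rewrite divr_gt0.
have v1 : v <= 1 by rewrite ler_pdivrMr// mul1r.
have lq0 : 0 <= ln (drift_len T)%:R :> R by rewrite ln_ge0// ler1n.
have hv : (2 * (1 + 0) * (m%:R * delta T) `^ (- (2 * H)) +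
    16 * (1 + ln (drift_len T)%:R) * (m%:R * delta T) `^ (- cov_exp H)) *
    (m%:R * delta T) `^ H <= v.
  apply: le_trans (drift_mesh_le H_gt0 H_lt1 L1 mdL _ _) _.
  - by rewrite addr0 mulr1.
  - by rewrite mulr_ge0// addr_ge0.
  - rewrite /v expr2 invfM mulrA ler_wpM2r ?invr_ge0 ?(ltW L0)//.
    by rewrite ler_pdivrMr// arith.
have := persistence_drift H_gt0 H_lt1 fbm d0 m0 mn (isT : 0 < drift_len T)%N md1 v0 v1 hv.
rewrite -/(PS T) -/(p1 T); set V := expR _; set U := (_ + _).
move=> main.
have p0 : 0 <= p1 T by apply: Rintegral_ge0 => w _; exact: orthant_ge0.
have VV : V <= V0 by rewrite ler_expR (log_drift_var H_gt0 fbm).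
pose G := L * L `^ b.
have Lb1 : 1 <= L `^ b by rewrite -{1}(powRr0 L) ler_powR// ltW.
have G1 : 1 <= G by rewrite -[1]mulr1 ler_pM.
have D0 : 0 < D T by rewrite powR_gt0.
have UU : U <= u0 * (G * D T).
  have -> : u0 * (G * D T) = expR 2 * (32 * L `^ b * L * D T) + G * D T.
    by rewrite /u0 /G; ring.
  apply: lerD; first by rewrite ler_pM2l ?expR_gt0.
  apply: le_trans (expR_gauss_le _ L0 v2') _ => //.
  rewrite -(invr_expR T0); apply: le_trans (D_ge T0 L1) _.
  by rewrite ler_peMl// ltW.
pose A := L `^ (a + 1).
have A0 : 0 < A by rewrite powR_gt0.
have PS2 : (D T / (24 * K * A)) ^+ 2 <= V0 * p1 T * (u0 * (G * D T)).
  apply: (@le_trans _ _ (PS T ^+ 2)).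
    have y0 : 0 <= D T / (24 * K * A).
      by rewrite divr_ge0 ?(ltW D0)// !mulr_ge0 ?(ltW K0) ?(ltW A0).
    by rewrite lerXn2r ?nnegrE// (le_trans y0).
  apply: le_trans main _; apply: ler_pM => //.
  - by rewrite mulr_ge0 ?expR_ge0.
  - by rewrite addr_ge0 ?mulr_ge0 ?expR_ge0 ?eneg_ge0.
  - by rewrite ler_wpM2r.
have KL : 0 < K2 * L `^ g.
  by apply: mulr_gt0; [exact: K2_gt0|rewrite powR_gt0].
rewrite ler_pdivrMr// (logL L0) -/A -/G.
move: PS2; rewrite expr_div_n ler_pdivrMr ?exprn_gt0 ?mulr_gt0//.
have -> : V0 * p1 T * (u0 * (G * D T)) * (24 * K * A) ^+ 2 =
  p1 T * (K2 * (A ^+ 2 * G)) * D T by rewrite /K2; ring.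
by rewrite expr2 ler_pM2r.
Qed.

Lemma moment_lower_log (k : R) : 0 < k -> exists M C : R, 0 < C /\
  forall T : R, 0 < T -> M <= ln T ->
  ((C * (T `^ (- (1 - H)) * ln T `^ (- (4 / H + 3 + mesh_exp H))))%:E <=
   'E_P[(fun w => exp_functional_inv X T w `^ k)%R])%E.
Proof.
move=> k0.
have ar1 (x z : R) : 10 * x <= z -> 0 < x -> - z <= 3%:R * - x by lra.
have ar2 (x z : R) : 10 * x <= z -> - z + z / 2 <= 5%:R * - x by lra.
(* [e0] collects the errors: n + 2 <= 3 h^h T^2 bad intervals, each of probability at most T^(-5),
   plus T^(-3) for X 0. *)
pose h := H^-1; pose e0 := 3 * h `^ h + 1.
pose c0 : R := exit_cst `^ k.
have c0_gt0 : 0 < c0 by rewrite powR_gt0// addr_gt0// ?mulr_gt0// expR_gt0.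
have hh0 : 0 <= h `^ h by exact: powR_ge0.
have e00 : 0 < e0 by rewrite ltr_wpDl// mulr_ge0.
exists (5000 + expR 1 * (8 * K * a `^ a) + 2 * (b + 1) `^ (b + 1) +
  e0 * (2 * K2 * g `^ g)).
exists (2 * K2 * c0)^-1; split.
  by rewrite invr_gt0; apply: mulr_gt0 => //; apply: mulr_gt0 => //; exact: K2_gt0.
move=> T T0; set L := ln T => ML.
have M1 : 0 <= expR 1 * (8 * K * a `^ a).
  by rewrite !mulr_ge0 ?expR_ge0 ?powR_ge0 ?(ltW K0).
have M2 : 0 <= 2 * (b + 1) `^ (b + 1) by rewrite mulr_ge0 ?powR_ge0.
have M3 : 0 <= e0 * (2 * K2 * g `^ g).
  by apply: mulr_ge0 (ltW e00) (mulr_ge0 (mulr_ge0 _ (ltW K2_gt0)) (powR_ge0 _ _)).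
have L5 : 5000 <= L by lra.
have dl : D T / (K2 * L `^ g) <= p1 T by apply: drifted_lower => //; rewrite -/L; lra.
have Te : e0 * (2 * K2 * g `^ g) <= T by have := ln_le T0; rewrite -/L; lra.
have L1 : 1 <= L by lra.
have L0 : 0 < L by lra.
have L10 : 10 <= L by lra.
have T2 : 2 <= T by have := ln_le T0; rewrite -/L; lra.
have d0 := delta_gt0 L1; have d1 := delta_le1 L1.
have [n0 nd nd'] := size_bounds T0 L1.
have [q1 q2] := drift_len_bounds T2.
set n := size T in n0 nd nd' *.
have th1 : 1 <= L ^+ 2 by rewrite exprn_ege1.
have nT : T <= n.+2%:R * delta T.
  by apply/ltW/(lt_le_trans nd'); rewrite ler_pM2r// ler_nat.
have nq : n.+1%:R * delta T <= (drift_len T)%:R.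
  by apply: le_trans q1; rewrite -[n.+1%:R]natr1 mulrDl mul1r lerD.
have := persistence_le_moment H_gt0 fbm d0 d1 T0 k0 th1 nT nq.
rewrite -[X in (X%:E <= _)%E]/(p1 T) -/c0.
pose y := D T / (2 * K2 * L `^ g).
have ye : D T / (K2 * L `^ g) = 2 * y.
  by rewrite /y; field; rewrite !gt_eqF// powR_gt0.
have tail : n.+2%:R * expR (- L ^+ 2 + (L ^+ 2 * delta T `^ H) ^+ 2 / 2) +
    expR (- L ^+ 2) <= y.
  have K22 : 0 < 2 * K2 by rewrite mulr_gt0.
  apply: le_trans (D_over_log g_gt0 K22 T0 L1 e00 Te).
  have -> : L ^+ 2 * delta T `^ H = L.
    by rewrite deltaH// -/L expr2 mulfK// gt_eqF.
  have LL : 10 * L <= L ^+ 2 by rewrite expr2 ler_pM2r.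
  have -> : e0 * T^-1 ^+ 3 = 3 * h `^ h * T ^+ 2 * T^-1 ^+ 5 + T^-1 ^+ 3.
    by rewrite /e0; field; rewrite gt_eqF.
  rewrite (invr_expR T0) -/L -!expRM_natl.
  apply: lerD; last by rewrite ler_expR ar1.
  apply: ler_pM; rewrite ?expR_ge0//; last first.
    by rewrite ler_expR ar2.
  have nn : n%:R <= h `^ h * T ^+ 2.
    apply: (@le_trans _ _ (T * L `^ h)); first by rewrite /h -deltaV ler_pdivlMr.
    rewrite expr2 mulrCA ler_pM2l// -[X in _ <= _ * X](lnK T0).
    by apply: powR_le_expR; [exact: Hi0|exact: ltW].
  apply: (@le_trans _ _ (3 * n%:R)); last by rewrite -mulrA ler_pM2l.
  by rewrite -natrM ler_nat -addn2 mulSn leq_add2l leq_pmulr.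
have -> : (2 * K2 * c0)^-1 * (T `^ (- (1 - H)) * L `^ (- (4 / H + 3 + mesh_exp H))) = y / c0.
  rewrite -/b -/g -/(D T) powRN /y.
  have c00 := c0_gt0; have Lg : 0 < L `^ g by rewrite powR_gt0.
  by field; rewrite (gt_eqF Lg) (gt_eqF c00) (gt_eqF K2_gt0).
rewrite {}ye in dl.
have E0 : (0 <= 'E_P[(fun w => exp_functional_inv X T w `^ k)%R])%E.
  by apply: expectation_ge0 => w; exact: powR_ge0.
move: E0; case: ('E_P[_])%E => [e e0'|_|//]; last by rewrite leey.
rewrite -EFinM -EFinD !lee_fin => hp.
rewrite ler_pdivrMr// mulrC.
move: (le_trans dl (le_trans hp (lerD (lexx _) tail))).
by rewrite mulr_natl mulr2n lerD2r.
Qed.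

End moment_lower_asymptotics.

(** * From eventual bounds to [precsim], and the conclusion *)

Section precsim_criteria.
Context {R : realType}.
Implicit Types (f g : R -> \bar R) (u : R -> R).

Lemma precsim_near f g (C : R) :
  (\forall T \near pinfty_nbhs R, (f T / g T <= C%:E)%E) -> precsim f g.
Proof.
move=> fg; rewrite /precsim limf_esupE; apply: (@le_lt_trans _ _ C%:E); last exact: ltry.
apply: ge_ereal_inf; exists (ereal_sup ((fun T => (f T / g T)%E) @` [set T | (f T / g T <= C%:E)%E])).
  by exists [set T | (f T / g T <= C%:E)%E].
by apply: ge_ereal_sup => _ [T /= h <-].
Qed.

Lemma precsim_upper f u (C : R) :
  (\forall T \near pinfty_nbhs R, 0 < u T /\ (f T <= (C * u T)%:E)%E) ->
  precsim f (fun T => (u T)%:E).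
Proof.
move=> fu; apply: (@precsim_near _ _ C).
apply: filterS fu => T [u0 fT]; rewrite inver gt_eqF//.
apply: le_trans (lee_wpmul2r _ fT) _; first by rewrite lee_fin invr_ge0 ltW.
by rewrite -EFinM mulfK ?gt_eqF.
Qed.

Lemma precsim_lower u g (C : R) : 0 < C ->
  (\forall T \near pinfty_nbhs R, 0 < u T /\ ((C * u T)%:E <= g T)%E) ->
  precsim (fun T => (u T)%:E) g.
Proof.
move=> C0 ug; apply: (@precsim_near _ _ C^-1).
apply: filterS ug => T [u0]; case: (g T) => [e| |//].
  rewrite lee_fin => ue; have e0 : 0 < e by apply: lt_le_trans ue; rewrite mulr_gt0.
  by rewrite inver gt_eqF// -EFinM lee_fin ler_pdivrMr// ler_pdivlMl.
(* An infinite value of [g T] makes the quotient 0. *)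
by move=> _; rewrite invey mule0 lee_fin invr_ge0 ltW.
Qed.

Lemma near_ln_ge (M : R) :
  \forall T \near pinfty_nbhs R, [/\ 0 < T, 1 <= ln T & M <= ln T].
Proof.
exists (expR (Num.max 1 M)); split; first exact: num_real.
move=> T MT; have T0 : 0 < T by exact: lt_trans (expR_gt0 _) MT.
have : Num.max 1 M <= ln T by rewrite -ler_expR lnK// ltW.
by rewrite ge_max => /andP[].
Qed.

End precsim_criteria.

Unset Implicit Arguments.

Theorem proposition2 (R : realType) (H : R) (H_gt0 : 0 < H) (H_lt1 : H < 1) :
  exists2 c : R, 0 < c &
  forall (k : R), 0 < k ->
  forall (d : measure_display) (Omega : measurableType d)
    (P : probability Omega R) (X : R -> {RV P >-> R}),
  fractional_brownian_motion H X ->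
  precsim (fun T : R => (T `^ (- (1 - H)) * (ln T) `^ (- c))%:E)
    (fun T : R => 'E_P[(fun w : Omega => exp_functional_inv X T w `^ k)%R]%E) /\
  precsim (fun T : R => 'E_P[(fun w : Omega => exp_functional_inv X T w `^ k)%R]%E)
    (fun T : R => (T `^ (- (1 - H)) * (ln T) `^ c)%:E).
Proof.
have b0 := mesh_exp_gt0 H_gt0 H_lt1.
have h0 : 0 < 4 / H by rewrite divr_gt0.
(* The exponent of the lower bound; it exceeds [1 + mesh_exp H], which the upper bound needs. *)
exists (4 / H + 3 + mesh_exp H); first by rewrite !addr_gt0.
move=> k k0 d Omega P X fbm; split.
  have [M [C [C0 hC]]] := moment_lower_log H_gt0 H_lt1 fbm k0.
  apply: (precsim_lower C0); apply: filterS (near_ln_ge M) => T [T0 L1 LM].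
  by rewrite mulr_gt0 ?powR_gt0 ?(lt_le_trans ltr01 L1)//; split=> //; exact: hC.
have [M [C hC]] := moment_upper_log H_gt0 H_lt1 fbm k0.
apply: (@precsim_upper _ _ _ (Num.max 0 C)).
apply: filterS (near_ln_ge M) => T [T0 L1 LM].
have L0 : 0 < ln T by exact: lt_le_trans L1.
split; first by rewrite mulr_gt0 ?powR_gt0.
apply: le_trans (hC T T0 LM) _; rewrite lee_fin.
have C0 : C <= Num.max 0 C by rewrite le_max lexx orbT.
apply: le_trans (ler_wpM2r _ C0) _; first by rewrite mulr_ge0 ?powR_ge0.
apply: ler_wpM2l; first by rewrite le_max lexx.
apply: ler_wpM2l; first exact: powR_ge0.
apply: ler_powR => //; rewrite lerD2r; lra.
Qed.
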